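(* Let $U$ and $V$ be finite-dimensional vector spaces over $\mathbb{F}_2$, and let $\mathcal{S}$ be a linear subspace of $\mathcal{L}(U,V)$ whose codimension in $\mathcal{L}(U,V)$ equals $2\dim V-3$, and which has none of Types 1 to 7. Then every range-compatible linear map on $\mathcal{S}$ is local.
   Context: $\mathcal{L}(U,V)$ is the space of linear operators from $U$ to $V$; $\mathrm{M}_{n,p}(\mathbb{F}_2)$ is the space of $n\times p$ matrices over $\mathbb{F}_2$ ($n$ or $p$ may be $0$); $\mathrm{S}_n(\mathbb{F}_2)$ is the space of symmetric $n\times n$ matrices. A linear map $F:\mathcal{S}\to V$ is range-compatible when $F(s)\in\operatorname{Im}s$ for all $s\in\mathcal{S}$; it is local when there is a vector $x\in U$ such that $F(s)=s(x)$ for all $s\in\mathcal{S}$. For $\mathcal{A}\subset \mathrm{M}_{m,p}(\mathbb{F}_2)$ and $\mathcal{B}\subset \mathrm{M}_{n,q}(\mathbb{F}_2)$, set $$\mathcal{A}\vee\mathcal{B}:=\left\{\begin{bmatrix}A & C\\ 0_{n\times p} & B\end{bmatrix} : A\in\mathcal{A},\ B\in\mathcal{B},\ C\in \mathrm{M}_{m,q}(\mathbb{F}_2)\right\}\subset \mathrm{M}_{m+n,p+q}(\mathbb{F}_2).$$ For $\mathcal{A}\subset \mathrm{M}_{n,p}(\mathbb{F}_2)$ and $\mathcal{B}\subset \mathrm{M}_{n,q}(\mathbb{F}_2)$, set $\mathcal{A}\coprod\mathcal{B}:=\{[A\ \ B] : A\in\mathcal{A},\ B\in\mathcal{B}\}\subset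 \mathrm{M}_{n,p+q}(\mathbb{F}_2)$. Special matrix spaces (all parameters range over $\mathbb{F}_2$): $$\mathcal{V}_2:=\left\{\begin{bmatrix} a&b\\ b&c\\ c&0\end{bmatrix}\right\},\quad \mathcal{G}_3:=\left\{\begin{bmatrix} a&c&b\\ 0&b+c&e\\ b&d&f\end{bmatrix}\right\},\quad \mathcal{H}_3:=\left\{\begin{bmatrix} a&b&c\\ b&d&f\\ c&e&b+c+d\end{bmatrix}\right\},$$ $$\mathcal{I}_3:=\left\{\begin{bmatrix} a&d&e\\ b&c&f\\ c&a&a+c+e+f\end{bmatrix}\right\},\quad \mathcal{H}_4:=\left\{\begin{bmatrix} a&b+c&f&h\\ b&d&a+c&i\\ c&e&g&a+b\end{bmatrix}\right\}.$$ A linear subspace $\mathcal{S}$ of $\mathcal{L}(U,V)$ has Type $i$ when, in some bases of $U$ and $V$, it is represented by the following matrix space: Type 1: $\mathrm{S}_2(\mathbb{F}_2)\vee \mathrm{M}_{n,p}(\mathbb{F}_2)$ for some $n\ge0$, $p\ge 0$; Type 2: $\mathrm{S}_3(\mathbb{F}_2)\coprod \mathrm{M}_{3,p}(\mathbb{F}_2)$ for some $p\ge0$; Type 3: $\mathcal{V}_2\vee \mathrm{M}_{n,p}(\mathbb{F}_2)$ for some $n\ge0$, $p\ge 0$; Type 4: $\mathcal{G}_3\coprod \mathrm{M}_{3,p}(\mathbb{F}_2)$ for some $p\ge0$; Type 5: $\mathcal{H}_3\coprod \mathrm{M}_{3,p}(\mathbb{F}_2)$ for some $p\ge0$; Type 6: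 $\mathcal{I}_3\coprod \mathrm{M}_{3,p}(\mathbb{F}_2)$ for some $p\ge0$; Type 7: $\mathcal{H}_4\coprod \mathrm{M}_{3,p}(\mathbb{F}_2)$ for some $p\ge0$. *)

(* Defs.v *)
From mathcomp Require Import all_boot all_algebra.

Set Implicit Arguments.
Unset Strict Implicit.
Unset Printing Implicit Defensive.

Import GRing.Theory.
Local Open Scope ring_scope.

Definition codimv (U V : vectType 'F_2) (S : {vspace 'Hom(U, V)}) : nat :=
  (\dim {: 'Hom(U, V)} - \dim S)%N.

Definition range_compatible (U V : vectType 'F_2) (S : {vspace 'Hom(U, V)})
    (F : subvs_of S -> V) : Prop :=
  forall s : subvs_of S, F s \in limg (vsval s).

Definition local_map (U V : vectType 'F_2) (S : {vspace 'Hom(U, V)})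
    (F : subvs_of S -> V) : Prop :=
  exists x : U, forall s : subvs_of S, F s = vsval s x.

(* Column convention: column j holds the coordinates of s (bU_j) in bV. *)
Definition mx_in_bases (U V : vectType 'F_2) (m p : nat)
    (bU : p.-tuple U) (bV : m.-tuple V) (s : 'Hom(U, V)) : 'M['F_2]_(m, p) :=
  \matrix_(i < m, j < p) coord bV i (s (tnth bU j)).

Definition represented_by (U V : vectType 'F_2) (S : {vspace 'Hom(U, V)})
    (m p : nat) (M : {set 'M['F_2]_(m, p)}) : Prop :=
  exists (bU : p.-tuple U) (bV : m.-tuple V),
    [/\ basis_of fullv bU, basis_of fullv bV
      & forall s : 'Hom(U, V), (s \in S) = (mx_in_bases bU bV s \in M)].

Definition vee (m p n q : nat)
    (SA : {set 'M['F_2]_(m, p)}) (SB : {set 'M['F_2]_(n, q)}) :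
    {set 'M['F_2]_(m + n, p + q)} :=
  [set M | [exists A in SA, exists B in SB, exists C : 'M['F_2]_(m, q),
    M == block_mx A C 0 B]].

Definition mx_coprod (n p q : nat)
    (SA : {set 'M['F_2]_(n, p)}) (SB : {set 'M['F_2]_(n, q)}) :
    {set 'M['F_2]_(n, p + q)} :=
  [set M | [exists A in SA, exists B in SB, M == row_mx A B]].

Definition sym_mx (n : nat) : {set 'M['F_2]_n} := [set M | M^T == M].

Definition mx_of_rows (m p : nat) (rows : seq (seq 'F_2)) : 'M['F_2]_(m, p) :=
  \matrix_(i < m, j < p) nth 0 (nth [::] rows i) j.

Definition V2 : {set 'M['F_2]_(3, 2)} :=
  [set M | [exists a, exists b, exists c,
    M == mx_of_rows 3 2 [:: [:: a; b];
                            [:: b; c];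
                            [:: c; 0]]]].

Definition G3 : {set 'M['F_2]_(3, 3)} :=
  [set M | [exists a, exists b, exists c, exists d, exists e, exists f,
    M == mx_of_rows 3 3 [:: [:: a; c; b];
                            [:: 0; b + c; e];
                            [:: b; d; f]]]].

Definition H3 : {set 'M['F_2]_(3, 3)} :=
  [set M | [exists a, exists b, exists c, exists d, exists e, exists f,
    M == mx_of_rows 3 3 [:: [:: a; b; c];
                            [:: b; d; f];
                            [:: c; e; b + c + d]]]].

Definition I3 : {set 'M['F_2]_(3, 3)} :=
  [set M | [exists a, exists b, exists c, exists d, exists e, exists f,
    M == mx_of_rows 3 3 [:: [:: a; d; e];
                            [:: b; c; f];
                            [:: c; a; a + c + e + f]]]].

Definition H4 : {set 'M['F_2]_(3, 4)} :=
  [set M | [exists a, exists b, exists c, exists d, exists e, exists f,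
            exists g, exists h, exists i,
    M == mx_of_rows 3 4 [:: [:: a; b + c; f; h];
                            [:: b; d; a + c; i];
                            [:: c; e; g; a + b]]]].

Definition type1 (U V : vectType 'F_2) (S : {vspace 'Hom(U, V)}) : Prop :=
  exists n p : nat, represented_by S (vee (sym_mx 2) [set: 'M['F_2]_(n, p)]).

Definition type2 (U V : vectType 'F_2) (S : {vspace 'Hom(U, V)}) : Prop :=
  exists p : nat, represented_by S (mx_coprod (sym_mx 3) [set: 'M['F_2]_(3, p)]).

Definition type3 (U V : vectType 'F_2) (S : {vspace 'Hom(U, V)}) : Prop :=
  exists n p : nat, represented_by S (vee V2 [set: 'M['F_2]_(n, p)]).

Definition type4 (U V : vectType 'F_2) (S : {vspace 'Hom(U, V)}) : Prop :=
  exists p : nat, represented_by S (mx_coprod G3 [set: 'M['F_2]_(3, p)]).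

Definition type5 (U V : vectType 'F_2) (S : {vspace 'Hom(U, V)}) : Prop :=
  exists p : nat, represented_by S (mx_coprod H3 [set: 'M['F_2]_(3, p)]).

Definition type6 (U V : vectType 'F_2) (S : {vspace 'Hom(U, V)}) : Prop :=
  exists p : nat, represented_by S (mx_coprod I3 [set: 'M['F_2]_(3, p)]).

Definition type7 (U V : vectType 'F_2) (S : {vspace 'Hom(U, V)}) : Prop :=
  exists p : nat, represented_by S (mx_coprod H4 [set: 'M['F_2]_(3, p)]).

(* Main.v *)
From HB Require Import structures.
Require Import Defs.
From mathcomp Require Import all_boot all_algebra zify.

(** Why the theorem holds.

    Write V in coordinates, with n = dim V, and replace the space S of matrices
    by its annihilator W under the trace pairing; W consists of tensors, sums of
    rank-one matrices x (x) phi with x a column and phi a row, and has dimension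
    2n - 3.  A map F on S is range-compatible exactly when for every row phi
    there is a column x(phi) with phi F(A) = phi A x(phi) for all A in S.
    Linearity of F then says that phi |-> x(phi) (x) phi is additive modulo W
    ([quasilinear]), and F is local when a single column u can replace all the
    x(phi) modulo W ([local]).  Signs are irrelevant over F_2.

    Projecting V along a vector y restricts the rows to those killing y and
    lowers dim W by the rank of the evaluation of W at y.  The image of this
    evaluation contains x(phi) + x(psi) whenever phi y = psi y = 1, so many
    values of x mean large evaluations, hence small W after the cut.  In the
    other direction, if the cuts by three independent vectors are local, then x
    is local as soon as dim W <= 2n - 3 ([three_good]).  Playing these two facts
    against each other shows that dim W <= 2n - 4 always implies locality
    ([local_low_codim]).  A first consequence is that in the critical dimension
    a nonlocal x determines S: a matrix A is in S exactly when
    phi |-> phi A x(phi) is additive ([critical_mem]).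

    Let x be nonlocal in the critical dimension.  When n >= 4, either a cut is
    local, and x can be normalized to vanish on a hyperplane of rows, or every
    evaluation has rank at most two; in both cases the values of x, suitably
    chosen, lie in an affine plane ([critical_plane]).  When n = 2 there are only
    three values.  When n = 3, the dimension 3 of W is smaller than the
    dimension 4 of the Hamming code formed by the sets of rows of zero sum, so
    the sum of x(phi) (x) phi over some nonzero codeword vanishes
    ([dim_three]).  Then x is affine, which gives symmetric matrices, or constant
    on a line of the Fano plane; in the latter case the type of S is read off
    from the linear relations between the values of x at the four other points,
    and is G3, H3, I3 or H4 unless the values lie in a plane.

    There remains the planar case, common to all n.  There S is determined by its
    action on two vectors u and v, as a space of dimension 3 covered by the four
    proper subspaces on which F is A |-> A y, y in {0, u, v, u + v}
    ([cover_exists]).  Such a covering forces a basis in which the pairs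
    (A y1, A y2) are spanned by (p, 0), (al, p) and (be, al): this is V2 when p,
    al, be are independent, and the symmetric 2 x 2 matrices otherwise
    ([normal_form_type]). *)

Set Implicit Arguments.
Unset Strict Implicit.
Unset Printing Implicit Defensive.

Import GRing.Theory.
Local Open Scope ring_scope.

(** * Identities between sums in characteristic two *)

Lemma F2P (k : 'F_2) : k = 0 \/ k = 1.
Proof.
by case: k => [[|[|//]]] i; [left|right]; apply: val_inj.
Qed.

Lemma addF2 (k : 'F_2) : k + k = 0.
Proof. by case: (F2P k) => ->; apply: val_inj. Qed.

Lemma add_self (V : lmodType 'F_2) (x : V) : x + x = 0.
Proof. by rewrite -[x]scale1r -scalerDl addF2 scale0r. Qed.

(** A sum in a group of exponent two depends only on the parity with which each
    atom occurs.  [char2] decides such identities by computing parity vectors;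
    [char2_by h] proves [a = b] from [h : l = r] when [a + b = l + r]. *)
Section Parity.
Variables (V : zmodType) (addV2 : forall x : V, x + x = 0).

Inductive expr := Zero | Atom of nat | Plus of expr & expr.

Fixpoint eval (env : seq V) e :=
  match e with
  | Zero => 0
  | Atom i => nth 0 env i
  | Plus e1 e2 => eval env e1 + eval env e2
  end.

Fixpoint xorb_seq (s t : seq bool) :=
  match s, t with
  | [::], _ => t
  | _, [::] => s
  | a :: s', b :: t' => addb a b :: xorb_seq s' t'
  end.

Fixpoint parity e :=
  match e with
  | Zero => [::]
  | Atom i => ncons i false [:: true]
  | Plus e1 e2 => xorb_seq (parity e1) (parity e2)
  end.

Fixpoint evalp (env : seq V) (s : seq bool) :=
  match s, env with
  | b :: s', x :: env' => (if b then x else 0) + evalp env' s'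
  | _, _ => 0
  end.

Lemma evalp_xor env s t : evalp env (xorb_seq s t) = evalp env s + evalp env t.
Proof.
elim: env s t => [|x env IH] [|a s] [|b t] //=; rewrite ?addr0 ?add0r // IH.
by rewrite addrACA; congr (_ + _); case: a; case: b; rewrite /= ?addV2 ?addr0 ?add0r.
Qed.

Lemma eval_parity env e : eval env e = evalp env (parity e).
Proof.
elim: e => [|i|e1 IH1 e2 IH2] /=; [by case: env| |by rewrite evalp_xor IH1 IH2].
elim: env i => [|x env IH] [|i] //=; first by case: env {IH} => *; rewrite addr0.
by rewrite add0r IH.
Qed.

Lemma evalp0 env s : ~~ has id s -> evalp env s = 0.
Proof.
by elim: s env => [|b s IH] [|x env] //= /norP[/negbTE-> /IH->]; rewrite addr0.
Qed.

Lemma parity_eq env e1 e2 :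
  ~~ has id (parity (Plus e1 e2)) -> eval env e1 = eval env e2.
Proof.
move=> h; have := evalp0 env h; rewrite -eval_parity /= => h2.
by rewrite -[LHS]addr0 -(addV2 (eval env e2)) addrA h2 add0r.
Qed.

Lemma eq_from (l r a b : V) : l = r -> a + b = l + r -> a = b.
Proof. by move=> ->; rewrite addV2 => h; rewrite -[a]addr0 -(addV2 b) addrA h add0r. Qed.

End Parity.

Lemma addeq (V : zmodType) (a b c d : V) : a = b -> c = d -> a + c = b + d.
Proof. by move=> -> ->. Qed.

(** Atoms are compared up to unification, since equal terms may carry
    different but convertible paths of algebraic structures. *)
Ltac same_term x y :=
  match constr:(tt) with
  | _ => let _ := match constr:(tt) with _ => unify x y end in constr:(true)
  | _ => constr:(false)
  end.
Ltac mem_atom x l :=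
  match l with
  | nil => constr:(false)
  | cons ?y ?l' =>
      let b := same_term x y in
      match b with true => constr:(true) | false => mem_atom x l' end
  end.
Ltac atoms t l :=
  match t with
  | @GRing.zero _ => l
  | @GRing.add _ ?a ?b => let l1 := atoms a l in atoms b l1
  | _ => let b := mem_atom t l in
         match b with true => l | false => constr:(cons t l) end
  end.
Ltac index_atom x l :=
  match l with
  | cons ?y ?l' =>
      let b := same_term x y in
      match b with
      | true => constr:(O)
      | false => let n := index_atom x l' in constr:(S n)
      end
  end.
Ltac reify t l :=
  match t with
  | @GRing.zero _ => constr:(Zero)
  | @GRing.add _ ?a ?b =>
      let e1 := reify a l in let e2 := reify b l in constr:(Plus e1 e2)
  | _ => let i := index_atom t l in constr:(Atom i)
  end.
Ltac char2 :=
  match goal with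
  | |- @eq ?T ?a ?b =>
    let l0 := constr:(@nil T) in
    let l1 := atoms a l0 in let l := atoms b l1 in
    let e1 := reify a l in let e2 := reify b l in
    (first [ refine (@parity_eq _ (@add_self _) l e1 e2 _)
           | refine (@parity_eq _ addF2 l e1 e2 _) ]);
    vm_compute; reflexivity
  end.
Ltac char2_by h :=
  first [ apply: (eq_from (@add_self _) h) | apply: (eq_from addF2 h) ]; char2.

(** * Freeness and duality over F_2 *)

Lemma addmove (V : lmodType 'F_2) (a b : V) : (a + b == 0) = (a == b).
Proof. by apply/eqP/eqP => [h|->]; [char2_by h | rewrite add_self]. Qed.

Lemma mem_span_cons (vT : vectType 'F_2) (v a : vT) (X : seq vT) :
  (v \in <<a :: X>>%VS) = (v \in <<X>>%VS) || (v + a \in <<X>>%VS).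
Proof.
rewrite span_cons; apply/memv_addP/orP => [[p /vlineP[k ->] [q hq ->]]|[h|h]].
- case: (F2P k) => ->; rewrite ?scale0r ?scale1r ?add0r; first by left.
  by right; rewrite (_ : a + q + a = q) //; char2.
- by exists 0; [exact: mem0v | exists v; rewrite ?add0r].
- by exists a; [exact: memv_line | exists (v + a); last char2].
Qed.

Definition freeE := (free_cons, nil_free, mem_span_cons, span_nil, memv0, andbT).

Ltac free_bool :=
  rewrite !freeE; repeat match goal with |- context [?x == 0] => case: (x == 0) end.

Lemma free2E (vT : vectType 'F_2) (a b : vT) :
  free [:: a; b] = [&& a != 0, b != 0 & a + b != 0].
Proof. by free_bool. Qed.

Lemma free3E (vT : vectType 'F_2) (a b c : vT) :
  free [:: a; b; c] =
  [&& a != 0, b != 0, c != 0, a + b != 0, a + c != 0, b + c != 0 & a + b + c != 0].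
Proof. by free_bool. Qed.

Lemma free4E (vT : vectType 'F_2) (a b c d : vT) :
  free [:: a; b; c; d] =
  free [:: a; b; c] && [&& d != 0, d + a != 0, d + b != 0, d + c != 0,
    d + a + b != 0, d + a + c != 0, d + b + c != 0 & d + a + b + c != 0].
Proof.
have -> : free [:: a; b; c; d] = free [:: d; a; b; c].
  by apply: perm_free; rewrite (perm_catC [:: a; b; c] [:: d]).
rewrite free_cons andbC; congr (_ && _).
rewrite !mem_span_cons span_nil !memv0.
by repeat match goal with |- context [?x == 0] => case: (x == 0) end.
Qed.

Lemma free_size_dim (vT : vectType 'F_2) (X : seq vT) (A : {vspace vT}) :
  free X -> {subset X <= A} -> (size X <= \dim A)%N.
Proof. by rewrite /free => /eqP <- /span_subvP /dimvS. Qed.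

Lemma exists_notin_span (vT : vectType 'F_2) (X : seq vT) (A : {vspace vT}) :
  (size X < \dim A)%N -> exists2 d, d \in A & d \notin <<X>>%VS.
Proof.
move=> h; apply/subvPn; apply: contraL h => /dimvS hA.
by rewrite -leqNgt (leq_trans hA) // dim_span.
Qed.

(** Over F_2 additivity is linearity, and the trace pairing between n x m and
    m x n matrices is perfect. *)
Lemma linform_trace a b (h : 'M['F_2]_(a, b) -> 'F_2) :
  (forall A B, h (A + B) = h A + h B) ->
  exists N : 'M_(b, a), forall A, h A = \tr (A *m N).
Proof.
move=> hD; have h0 : h 0 = 0 by have := hD 0 0; rewrite addr0 => {1}->; rewrite addF2.
have hZ k A : h (k *: A) = k * h A.
  by case: (F2P k) => ->; rewrite ?scale0r ?scale1r ?mul0r ?mul1r.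
exists (\matrix_(j, i) h (delta_mx i j)) => A.
rewrite {1}[A]matrix_sum_delta (big_morph h hD h0) /mxtrace.
apply: eq_bigr => i _; rewrite (big_morph h hD h0) mxE.
by apply: eq_bigr => j _; rewrite hZ mxE.
Qed.

(** Prescribing the value of a linear form on each member of a free family:
    the coordinate forms of the family are trace forms. *)
Lemma free_dual a b (X : seq 'M['F_2]_(a, b)) (v : nat -> 'F_2) : free X ->
  exists N : 'M_(b, a), forall i, (i < size X)%N -> \tr (X`_i *m N) = v i.
Proof.
move=> fX; pose h A := \sum_(i < size X) v i * coord (in_tuple X) i A.
have [|N hN] := @linform_trace a b h.
  by move=> A B; rewrite -big_split; apply: eq_bigr => i _; rewrite linearD mulrDr.
exists N => i hi; rewrite -hN /h (bigD1 (Ordinal hi)) //= big1 ?addr0 => [|j hj].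
  by have /= -> := coord_free (X := in_tuple X) (Ordinal hi) (Ordinal hi) fX; rewrite eqxx mulr1.
have /= -> := coord_free (X := in_tuple X) (Ordinal hi) j fX.
by rewrite eq_sym in hj; rewrite (negbTE hj) mulr0.
Qed.

Section Pairing.
Variables (m n : nat).
Implicit Types (phi psi : 'rV['F_2]_n) (y : 'cV['F_2]_n) (u : 'cV['F_2]_m).

Definition pr phi y : 'F_2 := (phi *m y) 0 0.

Lemma prDl phi psi y : pr (phi + psi) y = pr phi y + pr psi y.
Proof. by rewrite /pr mulmxDl mxE. Qed.

Lemma prDr phi y y' : pr phi (y + y') = pr phi y + pr phi y'.
Proof. by rewrite /pr mulmxDr mxE. Qed.

Lemma pr_trace phi y : pr phi y = \tr (phi *m y).
Proof. by rewrite /pr trace_mx11. Qed.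

Lemma tensor_eval u phi y : u *m phi *m y = pr phi y *: u.
Proof. by rewrite -mulmxA [phi *m y]mx11_scalar mul_mx_scalar. Qed.

Lemma trace_tensor (A : 'M_(n, m)) u phi : \tr (A *m (u *m phi)) = pr phi (A *m u).
Proof. by rewrite pr_trace mulmxA mxtrace_mulC. Qed.

Definition ev y : 'Hom('M['F_2]_(m, n), 'cV['F_2]_m) := linfun (mulmxr y).

Lemma evE y N : ev y N = N *m y.
Proof. by rewrite lfunE. Qed.

Lemma pr_separates y : y != 0 -> exists phi, pr phi y = 1.
Proof.
move=> y0; have f : free [:: y] by rewrite seq1_free.
have [N /(_ 0%N isT) /= h] := free_dual (fun=> 1) f; exists N.
by rewrite pr_trace mxtrace_mulC.
Qed.

Lemma pr_eq0 y : (forall phi, pr phi y = 0) -> y = 0.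
Proof.
by move=> h; apply/eqP; apply: contraT => /pr_separates[phi]; rewrite h => /eqP.
Qed.

Lemma dual2 (a b : 'rV['F_2]_n) i j : free [:: a; b] ->
  exists y, pr a y = i /\ pr b y = j.
Proof.
move=> /(free_dual (nth 0 [:: i; j]))[y h]; exists y.
by rewrite !pr_trace (h 0%N isT) (h 1%N isT).
Qed.

Lemma dual3 (a b c : 'rV['F_2]_n) i j k : free [:: a; b; c] ->
  exists y, [/\ pr a y = i, pr b y = j & pr c y = k].
Proof.
move=> /(free_dual (nth 0 [:: i; j; k]))[y h]; exists y.
by rewrite !pr_trace (h 0%N isT) (h 1%N isT) (h 2%N isT).
Qed.

Lemma dual4 (a b c d : 'rV['F_2]_n) i j k l : free [:: a; b; c; d] ->
  exists y, [/\ pr a y = i, pr b y = j, pr c y = k & pr d y = l].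
Proof.
move=> /(free_dual (nth 0 [:: i; j; k; l]))[y h]; exists y.
by rewrite !pr_trace (h 0%N isT) (h 1%N isT) (h 2%N isT) (h 3%N isT).
Qed.

End Pairing.

(** * Locality modulo a space of tensors *)

Lemma memv_eq (vT : vectType 'F_2) (W : {vspace vT}) a b : a \in W -> a = b -> b \in W.
Proof. by move=> h <-. Qed.

Section Local.
Variables (m n : nat).
Implicit Types (phi psi : 'rV['F_2]_n) (y : 'cV['F_2]_n) (u : 'cV['F_2]_m).
Implicit Types (W : {vspace 'M['F_2]_(m, n)}) (E : {vspace 'rV['F_2]_n}).
Implicit Types (x : 'rV['F_2]_n -> 'cV['F_2]_m).

(** The tensor x(phi) (x) phi is the rank-one matrix [x phi *m phi]; [defect]
    measures how far it is from being additive in phi. *)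
Definition defect x phi psi : 'M_(m, n) :=
  x phi *m phi + x psi *m psi + x (phi + psi) *m (phi + psi).

Definition quasilinear W E x :=
  forall phi psi, phi \in E -> psi \in E -> defect x phi psi \in W.

Definition local W E x :=
  exists u, forall phi, phi \in E -> (x phi + u) *m phi \in W.

(** Composing the operators with the projection of V along y amounts to
    keeping only the rows that kill y. *)
Definition perp E y : {vspace 'rV['F_2]_n} := (E :&: lker (linfun (mulmxr y)))%VS.

Lemma memv_perp E y phi : (phi \in perp E y) = (phi \in E) && (pr phi y == 0).
Proof.
rewrite memv_cap memv_ker lfunE /=; congr (_ && _).
rewrite [phi *m y]mx11_scalar -/(pr phi y).
apply/eqP/eqP => [/matrixP/(_ 0 0)|->]; first by rewrite !mxE.
by apply/matrixP => i j; rewrite !mxE mul0rn.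
Qed.

Lemma dim_perp E y : (\dim E <= (\dim (perp E y)).+1)%N.
Proof.
have := limg_ker_dim (linfun (mulmxr y : 'rV_n -> 'M_1)) E => <-; rewrite -[X in (_ <= X)%N]addn1 leq_add2l.
by apply: leq_trans (dimvS (subvf _)) _; rewrite dimvf.
Qed.

Lemma dim_ev W y :
  (\dim (W :&: lker (ev m y)) + \dim (ev m y @: W) = \dim W)%N.
Proof. exact: limg_ker_dim. Qed.

Lemma memv_ev W y N : N \in W -> N *m y \in (ev m y @: W)%VS.
Proof. by move=> h; rewrite -evE memv_img. Qed.

Lemma memv_kev W y N :
  (N \in (W :&: lker (ev m y))%VS) = (N \in W) && (N *m y == 0).
Proof. by rewrite memv_cap memv_ker evE. Qed.

(** Two choices of columns that represent the same range-compatible map up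
    to a local one. *)
Definition shift_equiv W E x x' :=
  exists c, forall phi, phi \in E -> (x phi + x' phi + c) *m phi \in W.

Lemma quasilinear_shift_equiv W E x x' :
  shift_equiv W E x x' -> quasilinear W E x -> quasilinear W E x'.
Proof.
move=> [c h] hx phi psi hp hq.
have := memvD (hx _ _ hp hq) (memvD (memvD (h _ hp) (h _ hq)) (h _ (memvD hp hq))).
by rewrite /defect; move/memv_eq; apply; rewrite !(mulmxDl, mulmxDr); char2.
Qed.

Lemma local_shift_equiv W E x x' : shift_equiv W E x x' -> local W E x' -> local W E x.
Proof.
move=> [c h] [u hu]; exists (u + c) => phi hp.
by have := memvD (h _ hp) (hu _ hp); rewrite -mulmxDl; move/memv_eq; apply; congr (_ *m _); char2.
Qed.

Lemma local_sub W W' E x : (W <= W')%VS -> local W E x -> local W' E x.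
Proof. by move=> /subvP h [u hu]; exists u => phi hp; apply: h; exact: hu. Qed.

Lemma quasilinear_cut W E x y :
  quasilinear W E x -> quasilinear (W :&: lker (ev m y)) (perp E y) x.
Proof.
move=> hx phi psi; rewrite !memv_perp => /andP[p1 /eqP p2] /andP[q1 /eqP q2].
rewrite memv_kev hx //= /defect !mulmxDl !tensor_eval prDl p2 q2.
by rewrite addr0 !scale0r !addr0.
Qed.

(** Many values of x force large evaluations: of the three tensors in a
    defect, y only sees the two whose rows take the value 1 at y. *)
Lemma evD_mem W E x y phi psi : quasilinear W E x -> phi \in E -> psi \in E ->
  pr phi y = 1 -> pr psi y = 1 -> x phi + x psi \in (ev m y @: W)%VS.
Proof.
move=> hx hp hq p q; have := memv_ev y (hx _ _ hp hq).
by rewrite /defect !mulmxDl !tensor_eval prDl p q !scale1r addF2 scale0r addr0.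
Qed.

(** If x is the constant c off a hyperplane, the defect of phi in the
    hyperplane and h outside it is (x(phi) + c) (x) phi. *)
Lemma local_const W E x y c : quasilinear W E x ->
  (exists2 h, h \in E & pr h y = 1) ->
  (forall phi, phi \in E -> pr phi y = 1 -> x phi = c) -> local W E x.
Proof.
move=> hx [h hE h1] hc; exists c => phi hp.
case: (F2P (pr phi y)) => hy; last by rewrite hc // add_self mul0mx mem0v.
have hph : pr (phi + h) y = 1 by rewrite prDl h1 hy add0r.
have := hx _ _ hp hE; rewrite /defect (hc h) // (hc (phi + h)) //; last exact: memvD.
by move/memv_eq; apply; rewrite !(mulmxDl, mulmxDr); char2.
Qed.

(** If q (x) a is in W whenever x(a) = c + q, then c works everywhere.
    Otherwise pick a violating a: after a shift by c, the defect of a and any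
    phi with x(phi) = c is q (x) a or q (x) phi, so it must be the latter and c + q works. *)
Lemma local_two W E x c q : quasilinear W E x ->
  (forall phi, phi \in E -> phi != 0 -> x phi = c \/ x phi = c + q) -> local W E x.
Proof.
move=> hx hcq.
have [/existsP[a /and3P[aE /eqP xa aW]]|] :=
  boolP [exists a, [&& a \in E, x a == c + q & q *m a \notin W]]; last first.
  rewrite negb_exists => /forallP h; exists c => phi hp.
  have [->|p0] := eqVneq phi 0; first by rewrite mulmx0 mem0v.
  have [->|xp] := hcq _ hp p0; first by rewrite add_self mul0mx mem0v.
  have := h phi; rewrite hp xp eqxx /= negbK.
  by move/memv_eq; apply; congr (_ *m _); char2.
exists (c + q) => phi hp.
have [->|p0] := eqVneq phi 0; first by rewrite mulmx0 mem0v.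
have [xp|->] := hcq _ hp p0; last by rewrite add_self mul0mx mem0v.
have [s0|s0] := eqVneq (phi + a) 0.
  have e : phi = a by char2_by s0.
  rewrite -e xp in xa aW; move: aW; have -> : q = 0 by char2_by xa.
  by rewrite mul0mx mem0v.
have := hx _ _ hp aE; rewrite /defect xa xp.
have [->|->] := hcq _ (memvD hp aE) s0.
  rewrite (_ : _ + _ = q *m a) ?(negbTE aW) //.
  by rewrite !(mulmxDl, mulmxDr); char2.
by move/memv_eq; apply; rewrite !(mulmxDl, mulmxDr); char2.
Qed.

(** Two distinct nonzero columns p, q make p (x) E and q (x) E independent. *)
Lemma dim_tensor2 W E p q : free [:: p; q] ->
  (forall phi, phi \in E -> p *m phi \in W /\ q *m phi \in W) ->
  (2 * \dim E <= \dim W)%N.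
Proof.
rewrite free2E => /and3P[p0 q0 pq] h.
have inj (r : 'cV_m) : r != 0 -> (E :&: lker (linfun (mulmx r)) = 0)%VS.
  move=> /pr_separates[f hf]; apply/eqP; rewrite -subv0.
  apply/subvP => phi; rewrite memv_cap memv_ker lfunE /= memv0 => /andP[_ /eqP h0].
  by have := congr1 (mulmx f) h0; rewrite mulmxA [f *m r]mx11_scalar -/(pr _ _) hf mul1mx mulmx0 => ->.
pose A r := (linfun (mulmx r : 'rV_n -> 'M_(m, n)) @: E)%VS.
have dA r : r != 0 -> \dim (A r) = \dim E by move=> /inj; exact: limg_dim_eq.
have AW : (A p + A q <= W)%VS.
  by apply/subvP => N /memv_addP[? /memv_imgP[f /h[h1 h2] ->] [? /memv_imgP[g /h[h3 h4] ->] ->]];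
     rewrite !lfunE memvD.
apply: leq_trans (dimvS AW); rewrite dimv_disjoint_sum ?dA ?addnn ?mul2n //.
apply/eqP; rewrite -subv0; apply/subvP => N; rewrite memv_cap memv0.
move=> /andP[/memv_imgP[f fE ->] /memv_imgP[g gE]]; rewrite !lfunE /= => e.
have fr : free [:: p; q] by rewrite free2E p0 q0.
have [r /= hr] := free_dual (nth 0 [:: 1; 0]) fr.
have rp : pr r p = 1 by rewrite pr_trace mxtrace_mulC (hr 0%N).
have rq : pr r q = 0 by rewrite pr_trace mxtrace_mulC (hr 1%N).
have := congr1 (mulmx r) e; rewrite !mulmxA [r *m p]mx11_scalar [r *m q]mx11_scalar.
rewrite -!/(pr _ _) rp rq mul1mx mul_scalar_mx scale0r => ->.
by rewrite mulmx0.
Qed.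

(** Two cuts that are local with the same column glue together, since the rows
    killing y1 and the rows killing y2 span all rows. *)
Lemma good_same W E x y1 y2 u phi1 : quasilinear W E x -> phi1 \in E ->
  pr phi1 y1 = 1 -> pr phi1 y2 = 0 ->
  (forall phi, phi \in perp E y1 -> (x phi + u) *m phi \in W) ->
  (forall phi, phi \in perp E y2 -> (x phi + u) *m phi \in W) -> local W E x.
Proof.
move=> hx h1E h1 h2 g1 g2; exists u => phi hp.
case: (F2P (pr phi y1)) => hy; first by apply: g1; rewrite memv_perp hp hy eqxx.
have s1 : phi + phi1 \in perp E y1 by rewrite memv_perp memvD //= prDl hy h1.
have s2 : phi1 \in perp E y2 by rewrite memv_perp h1E h2 /=.
have := memvD (hx _ _ hp h1E) (memvD (g1 _ s1) (g2 _ s2)).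
by rewrite /defect; move/memv_eq; apply; rewrite !(mulmxDl, mulmxDr); char2.
Qed.

Lemma dim_le1_eq (vT : vectType 'F_2) (A : {vspace vT}) a b :
  (\dim A <= 1)%N -> a \in A -> b \in A -> a != 0 -> b != 0 -> a = b.
Proof.
move=> d hA hB a0 b0; apply/eqP; rewrite -addmove; apply: contraLR d => ab.
rewrite -ltnNge; apply: (@free_size_dim _ [:: a; b]).
  by rewrite free2E a0 b0.
by move=> z; rewrite !inE => /orP[] /eqP->.
Qed.

Lemma dim_gt0_mem (vT : vectType 'F_2) (A : {vspace vT}) a :
  a \in A -> a != 0 -> (0 < \dim A)%N.
Proof.
move=> hA a0; apply: (@free_size_dim _ [:: a]); first by rewrite seq1_free.
by move=> z; rewrite inE => /eqP->.
Qed.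

(** Suppose that the three cuts are local through u1, u2, u3.  By [good_same]
    these are distinct if x is not local; with p = u1 + u2 and q = u1 + u3, W
    contains p (x) phi, q (x) phi and (p + q) (x) phi for phi killing (y1, y2),
    (y1, y3) and (y2, y3) respectively.  This already fills the dimension
    2 dim E - 3, so the successive evaluations of W at y1, y2, y3 have rank
    exactly one, and the defect of phi1 + phi2 + phi3 does not fit into them. *)
Lemma three_good W E x phi1 phi2 phi3 y1 y2 y3 :
  quasilinear W E x -> (\dim W + 3 <= 2 * \dim E)%N ->
  [/\ phi1 \in E, phi2 \in E & phi3 \in E] ->
  [/\ pr phi1 y1 = 1, pr phi1 y2 = 0 & pr phi1 y3 = 0] ->
  [/\ pr phi2 y1 = 0, pr phi2 y2 = 1 & pr phi2 y3 = 0] ->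
  [/\ pr phi3 y1 = 0, pr phi3 y2 = 0 & pr phi3 y3 = 1] ->
  local W (perp E y1) x -> local W (perp E y2) x -> local W (perp E y3) x ->
  local W E x.
Proof.
move=> hx dW [E1 E2 E3] [p11 p12 p13] [p21 p22 p23] [p31 p32 p33].
move=> [u1 g1] [u2 g2] [u3 g3].
have [e|u12] := eqVneq u1 u2; first by rewrite -e in g2; exact: (good_same hx E1 p11 p12 g1 g2).
have [e|u13] := eqVneq u1 u3; first by rewrite -e in g3; exact: (good_same hx E1 p11 p13 g1 g3).
have [e|u23] := eqVneq u2 u3; first by rewrite -e in g3; exact: (good_same hx E2 p22 p23 g2 g3).
exfalso.
have diff E' u u' phi : phi \in E' -> (x phi + u) *m phi \in W ->
    (x phi + u') *m phi \in W -> (u + u') *m phi \in W.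
  by move=> _ a b; have := memvD a b; rewrite -mulmxDl; move/memv_eq; apply; congr (_ *m _); char2.
pose p := u1 + u2; pose q := u1 + u3.
have p0 : p != 0 by rewrite addmove.
have q0 : q != 0 by rewrite addmove.
have pq0 : p + q != 0 by rewrite (_ : p + q = u2 + u3) ?addmove // /p /q; char2.
have pW phi : phi \in E -> pr phi y1 = 0 -> pr phi y2 = 0 -> p *m phi \in W.
  move=> h a b; apply: (diff E) => //; [apply: g1|apply: g2];
  by rewrite memv_perp h ?a ?b /=.
have qW phi : phi \in E -> pr phi y1 = 0 -> pr phi y3 = 0 -> q *m phi \in W.
  move=> h a b; apply: (diff E) => //; [apply: g1|apply: g3];
  by rewrite memv_perp h ?a ?b /=.
have pqW phi : phi \in E -> pr phi y2 = 0 -> pr phi y3 = 0 -> (p + q) *m phi \in W.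
  move=> h a b; rewrite (_ : p + q = u2 + u3) ?/p ?/q; last by char2.
  apply: (diff E) => //; [apply: g2|apply: g3]; by rewrite memv_perp h ?a ?b /=.
pose W1 := (W :&: lker (ev m y1))%VS; pose W2 := (W1 :&: lker (ev m y2))%VS.
pose W3 := (W2 :&: lker (ev m y3))%VS.
pose F := perp (perp (perp E y1) y2) y3.
have dF : (\dim E <= \dim F + 3)%N.
  rewrite addn3; apply: leq_trans (dim_perp E y1) _; rewrite ltnS.
  apply: leq_trans (dim_perp _ y2) _; rewrite ltnS; exact: dim_perp.
have memW1 u phi : u *m phi \in W -> pr phi y1 = 0 -> u *m phi \in W1.
  by move=> h e; rewrite memv_kev h tensor_eval e scale0r eqxx.
have memW2 u phi : u *m phi \in W -> pr phi y1 = 0 -> pr phi y2 = 0 -> u *m phi \in W2.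
  by move=> h e e'; rewrite memv_kev memW1 // tensor_eval e' scale0r eqxx.
have dW3 : (2 * \dim F <= \dim W3)%N.
  apply: (@dim_tensor2 _ _ p q).
    by rewrite free2E p0 q0.
  move=> phi; rewrite !memv_perp => /andP[/andP[/andP[h /eqP a] /eqP b] /eqP c].
  by split; rewrite memv_kev tensor_eval c scale0r eqxx andbT memW2 ?pW ?qW.
have i1 : p + q \in (ev m y1 @: W)%VS.
  by have := memv_ev y1 (pqW _ E1 p12 p13); rewrite tensor_eval p11 scale1r.
have i2 : q \in (ev m y2 @: W1)%VS.
  by have := memv_ev y2 (memW1 _ _ (qW _ E2 p21 p23) p21); rewrite tensor_eval p22 scale1r.
have i3 : p \in (ev m y3 @: W2)%VS.
  by have := memv_ev y3 (memW2 _ _ (pW _ E3 p31 p32) p31 p32); rewrite tensor_eval p33 scale1r.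
have d1 : (\dim W1 + \dim (ev m y1 @: W) = \dim W)%N := dim_ev W y1.
have d2 : (\dim W2 + \dim (ev m y2 @: W1) = \dim W1)%N := dim_ev W1 y2.
have d3 : (\dim W3 + \dim (ev m y3 @: W2) = \dim W2)%N := dim_ev W2 y3.
have r1 := dim_gt0_mem i1 pq0; have r2 := dim_gt0_mem i2 q0; have r3 := dim_gt0_mem i3 p0.
have [l1 l2 l3] : [/\ \dim (ev m y1 @: W) <= 1, \dim (ev m y2 @: W1) <= 1 & \dim (ev m y3 @: W2) <= 1]%N.
  clear -dW dF dW3 d1 d2 d3 r1 r2 r3.
  by split; lia.
have [s es] : exists s, s = phi1 + (phi2 + phi3) by eexists.
have sE : s \in E by rewrite es !memvD.
pose t := x s + u1.
(* the defect at phi1 + phi2 + phi3 = s, with every column shifted by u1 *)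
have NW : (t + p) *m phi1 + t *m phi2 + t *m phi3 \in W.
  have h23 : phi2 + phi3 \in E by rewrite memvD.
  have g1' : phi2 + phi3 \in perp E y1 by rewrite memv_perp h23 prDl p21 p31.
  have g2' : phi1 \in perp E y2 by rewrite memv_perp E1 p12.
  have := memvD (hx _ _ E1 h23) (memvD (g1 _ g1') (g2 _ g2')).
  rewrite /defect -es; move/memv_eq; apply; rewrite /t /p; move: (x s) => xs.
  by rewrite es !(mulmxDl, mulmxDr); char2.
have := memv_ev y1 NW; rewrite !mulmxDl !tensor_eval p11 p21 p31 !scale1r !scale0r !addr0 => j1.
have [tp|tp] := eqVneq (t + p) 0.
  have tE : t = p by char2_by tp.
  have : p *m phi2 \in W.
    have := memvD NW (pW _ E3 p31 p32); rewrite tE; move/memv_eq; apply.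
    by rewrite !(mulmxDl, mulmxDr); char2.
  move=> /memW1/(_ p21)/(memv_ev y2); rewrite tensor_eval p22 scale1r => j2.
  by have := dim_le1_eq l2 i2 j2 q0 p0 => e; rewrite e add_self eqxx in pq0.
have tE : t = q.
  have e : t + p = p + q := dim_le1_eq l1 j1 i1 tp pq0.
  by char2_by e.
have : q *m phi3 \in W.
  have := memvD NW (memvD (qW _ E2 p21 p23) (pqW _ E1 p12 p13)); rewrite tE; move/memv_eq; apply.
  by rewrite !(mulmxDl, mulmxDr); char2.
move=> /memW2/(_ p31 p32)/(memv_ev y3); rewrite tensor_eval p33 scale1r => j3.
by have := dim_le1_eq l3 i3 j3 p0 q0 => e; rewrite e add_self eqxx in pq0.
Qed.

End Local.

(** * Small annihilators force locality *)

Lemma neq0_eq (V : zmodType) (a b : V) : a != 0 -> b = a -> b != 0.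
Proof. by move=> h ->. Qed.

(** Proves that a sum is nonzero by recognizing it among the nonzero sums of the
    context, up to reordering and cancellation. *)
Ltac nonzero :=
  match goal with
  | H : is_true (_ != 0) |- _ => refine (neq0_eq H _); char2
  end.

Lemma free_rcons (vT : vectType 'F_2) (X : seq vT) c :
  free X -> c \notin <<X>>%VS -> free (rcons X c).
Proof. by move=> fX hc; rewrite (perm_free (permEl (perm_rcons _ _))) free_cons hc. Qed.

Section LowCodim.
Variables (m n : nat).
Implicit Types (W : {vspace 'M['F_2]_(m, n)}) (E : {vspace 'rV['F_2]_n}).
Implicit Types (x : 'rV['F_2]_n -> 'cV['F_2]_m).

(** Rows and columns over F_2 form finite types, so locality is decidable. *)
Definition localb W E x :=
  [exists u : 'cV_m, [forall phi : 'rV_n, (phi \in E) ==> ((x phi + u) *m phi \in W)]].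

Lemma localP W E x : reflect (local W E x) (localb W E x).
Proof.
apply: (iffP existsP) => [[u /forallP h]|[u h]]; exists u.
  by move=> phi hp; have := h phi; rewrite hp.
by apply/forallP => phi; apply/implyP => /h.
Qed.

Lemma dim_perp_lt E y h : h \in E -> pr h y = 1 -> (\dim (perp E y) < \dim E)%N.
Proof.
move=> hE hy; rewrite ltnNge; apply/negP => d.
have /eqP e : perp E y == E by rewrite eqEdim capvSl d.
by have := memv_perp E y h; rewrite e hE hy.
Qed.

Lemma shift_equiv_vanish W E x y u :
  (forall phi, phi \in perp E y -> (x phi + u) *m phi \in W) ->
  shift_equiv W E x (fun phi => if pr phi y == 0 then 0 else x phi + u).
Proof.
move=> h; exists u => phi hp; case: ifP => hy.
  by rewrite addr0; apply: h; rewrite memv_perp hp.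
by rewrite (_ : _ + _ + _ = 0) ?mul0mx ?mem0v //; char2.
Qed.

Lemma pr1_neq0 (phi : 'rV['F_2]_n) y : pr phi y = 1 -> phi != 0.
Proof. by move=> h; apply/eqP => e; move: h; rewrite e /pr mul0mx mxE. Qed.

(** When x vanishes on the rows killing y, the defect of phi and h is
    x(phi) (x) phi + x(h) (x) h off the hyperplane; a zero of x there would put
    all the tensors x(phi) (x) phi in W. *)
Lemma vanish_nonzero W E x y h : quasilinear W E x -> h \in E -> pr h y = 1 ->
  (forall phi, phi \in perp E y -> x phi = 0) -> ~ local W E x -> x h <> 0.
Proof.
move=> hx hE hy x0 nl xh; apply: nl; exists 0 => phi hp; rewrite addr0.
case: (F2P (pr phi y)) => py; first by rewrite x0 ?mul0mx ?mem0v // memv_perp hp py /=.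
have := hx _ _ hp hE; rewrite /defect xh (x0 (phi + h)).
  by rewrite !mul0mx !addr0.
by rewrite memv_perp memvD //= prDl py hy.
Qed.

(** Pairing a with a row b on which x vanishes turns the difference of
    [evD_mem] into the value x(a) itself. *)
Lemma ev_vanish W E x y z a b : quasilinear W E x ->
  (forall phi, phi \in perp E y -> x phi = 0) ->
  a \in E -> b \in E -> pr b y = 0 -> pr a z = 1 -> pr b z = 1 ->
  x a \in (ev m z @: W)%VS.
Proof.
move=> hx x0 hA hB yb za zb; have := evD_mem hx hA hB za zb.
by rewrite (x0 b) ?addr0 // memv_perp hB yb /=.
Qed.

Lemma dim_gt1 (vT : vectType 'F_2) (A : {vspace vT}) a b :
  free [:: a; b] -> a \in A -> b \in A -> (1 < \dim A)%N.
Proof.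
by move=> f hA hB; apply: (free_size_dim f) => z; rewrite !inE => /orP[] /eqP->.
Qed.

(** The cut by y lowers the dimension of W by the rank of the evaluation at y,
    and 2 dim E by at most two. *)
Lemma local_cut_good W E x y h :
  (forall W' E' x', (\dim E' < \dim E)%N -> quasilinear W' E' x' ->
     (\dim W' + 4 <= 2 * \dim E')%N -> local W' E' x') ->
  quasilinear W E x -> h \in E -> pr h y = 1 ->
  (\dim W + 6 <= 2 * \dim E + \dim (ev m y @: W))%N -> local W (perp E y) x.
Proof.
move=> IH hx hE hy d; apply: (@local_sub _ _ (W :&: lker (ev m y))%VS); first exact: capvSl.
apply: IH; [exact: dim_perp_lt hy|exact: quasilinear_cut|].
have := dim_ev W y; have := dim_perp E y; lia.
Qed.

(** One local cut produces three: x takes two distinct nonzero values at rows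
    a, h off the hyperplane, so the evaluation at any z equal to 1 on a, h and
    some row where x vanishes has rank two, and the cut by z is local.  Replacing one of a, h by a + c gives
    a second such z, independent from y and the first one. *)
Lemma vanish_local W E x y h : quasilinear W E x -> (2 < \dim E)%N ->
  (\dim W + 3 <= 2 * \dim E)%N -> h \in E -> pr h y = 1 ->
  (forall phi, phi \in perp E y -> x phi = 0) ->
  (forall z f, f \in E -> pr f z = 1 -> (1 < \dim (ev m z @: W))%N ->
     local W (perp E z) x) ->
  local W E x.
Proof.
move=> hx dE dW hE hy x0 good; apply/localP; apply: contraT => /localP nl; exfalso.
have xn a : a \in E -> pr a y = 1 -> x a != 0.
  by move=> hA ya; apply/eqP; exact: (vanish_nonzero hx hA ya).
have [a [aE ya xah]] : exists a, [/\ a \in E, pr a y = 1 & x a != x h].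
  have [/existsP[a /and3P[? /eqP ? ?]]|] :=
    boolP [exists a, [&& a \in E, pr a y == 1 & x a != x h]]; first by exists a.
  rewrite negb_exists => /forallP H; case: nl.
  apply: (@local_const _ _ _ _ _ y (x h)) => //; first by exists h.
  by move=> phi hp py; have := H phi; rewrite hp py eqxx /= negbK => /eqP.
have yg : local W (perp E y) x.
  by exists 0 => phi hp; rewrite x0 // addr0 mul0mx mem0v.
have fah : free [:: a; h].
  rewrite free2E (pr1_neq0 ya) (pr1_neq0 hy) addmove /=.
  by apply: contraNneq xah => ->.
have [c0 c0E c0n] : exists2 d, d \in E & d \notin <<[:: a; h]>>%VS.
  exact: exists_notin_span.
have [c [cE cn yc]] : exists c, [/\ c \in E, c \notin <<[:: a; h]>>%VS & pr c y = 0].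
  case: (F2P (pr c0 y)) => yc; first by exists c0.
  exists (c0 + a); rewrite memvD // prDl yc ya addF2; split => //.
  by rewrite rpredDr // memv_span ?mem_head.
have f3 : free [:: a; h; c] := free_rcons fah cn.
have xc' : x (a + c) != 0 by apply: xn; rewrite ?memvD ?prDl ?ya ?yc ?addr0.
have [z1 [z1a z1h z1c]] := dual3 1 1 1 f3.
have g1 : local W (perp E z1) x.
  apply: (good _ a) => //; apply: (@dim_gt1 _ _ (x a) (x h)).
  - by rewrite free2E addmove xah !xn.
  - exact: (ev_vanish hx x0 aE cE).
  - exact: (ev_vanish hx x0 hE cE).
have acE : a + c \in E by rewrite memvD.
have ahE : a + h \in E by rewrite memvD.
have hcE : h + c \in E by rewrite memvD.
have yah : pr (a + h) y = 0 by rewrite prDl ya hy addF2.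
have [e|xca] := eqVneq (x (a + c)) (x a).
  have xch : x (a + c) != x h by rewrite e.
  (* z2 is 1 on a + c and h, whose values differ *)
  have [z2 [z2a z2h z2c]] := dual3 0 1 1 f3.
  have g2 : local W (perp E z2) x.
    apply: (good _ h) => //; apply: (@dim_gt1 _ _ (x (a + c)) (x h)).
    + by rewrite free2E addmove xch xc' xn.
    + by apply: (ev_vanish hx x0 acE cE); rewrite ?prDl ?z2a ?z2c ?add0r.
    + exact: (ev_vanish hx x0 hE cE).
  have ahcE : a + h + c \in E by rewrite memvD.
  apply: nl; apply: (three_good hx dW (And3 hcE ahcE ahE) _ _ _ yg g1 g2);
  by split; rewrite !prDl ?(ya, hy, yc, z1a, z1h, z1c, z2a, z2h, z2c) !(addF2, addr0, add0r).
(* z2 is 1 on a + c and a, whose values differ *)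
have [z2 [z2a z2h z2c]] := dual3 1 0 0 f3.
have g2 : local W (perp E z2) x.
  apply: (good _ a) => //; apply: (@dim_gt1 _ _ (x (a + c)) (x a)).
  - by rewrite free2E addmove xca xc' xn.
  - by apply: (ev_vanish hx x0 acE ahE); rewrite ?yah ?prDl ?z2a ?z2c ?z2h ?addr0.
  - by apply: (ev_vanish hx x0 aE ahE); rewrite ?yah ?prDl ?z2a ?z2c ?z2h ?addr0.
apply: nl; apply: (three_good hx dW (And3 hcE cE ahE) _ _ _ yg g1 g2);
by split; rewrite ?prDl ?(ya, hy, yc, z1a, z1h, z1c, z2a, z2h, z2c) ?(addF2, addr0, add0r).
Qed.

(** If all evaluations have rank at most one, any three independent rows see at
    most two values of x, since some y is 1 on all three.  The only possible
    exception is the sum of two rows with distinct values, and replacing one of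
    the two rows by that sum excludes it. *)
Lemma local_thin W E x : quasilinear W E x -> (2 < \dim E)%N ->
  (forall z f, f \in E -> pr f z = 1 -> (\dim (ev m z @: W) <= 1)%N) ->
  local W E x.
Proof.
move=> hx dE thin.
have three a b c : a \in E -> b \in E -> c \in E -> free [:: a; b; c] ->
    x a != x b -> x c = x a \/ x c = x b.
  move=> hA hB hC f xab; have [y [ya yb yc]] := dual3 1 1 1 f.
  have [e|xca] := eqVneq (x c) (x a); [by left | right].
  have := dim_le1_eq (thin _ _ hA ya) (evD_mem hx hB hA yb ya) (evD_mem hx hC hA yc ya).
  rewrite !addmove eq_sym => /(_ xab xca) e.
  by char2_by e.
have [/existsP[a /existsP[b /and5P[hA hB a0 b0 xab]]]|] := boolP [exists a, exists b,
  [&& a \in E, b \in E, a != 0, b != 0 & x a != x b]]; last first.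
  rewrite negb_exists => /forallP H.
  have [a hA a0] : exists2 a, a \in E & a != 0.
    have [|a hA] := @exists_notin_span _ [::] E; first by rewrite /=; lia.
    by rewrite span_nil memv0 => ?; exists a.
  apply: (@local_two _ _ _ _ _ (x a) 0) => // phi hp p0; left.
  have := H a; rewrite negb_exists => /forallP/(_ phi).
  by rewrite hp hA a0 p0 /= negbK => /eqP.
have ab : a + b != 0 by rewrite addmove; apply: contraNneq xab => ->.
have f2 : free [:: a; b] by rewrite free2E a0 b0.
have [c cE cn] : exists2 d, d \in E & d \notin <<[:: a; b]>>%VS.
  exact: exists_notin_span.
have f3 : free [:: a; b; c] := free_rcons f2 cn.
apply: (@local_two _ _ _ _ _ (x a) (x a + x b)) => // phi hp p0.
suff : x phi = x a \/ x phi = x b.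
  by case=> ->; [left | right; char2].
have [|pn] := boolP (phi \in <<[:: a; b]>>%VS); last first.
  exact: (three a b phi hA hB hp (free_rcons f2 pn)).
rewrite !mem_span_cons span_nil !memv0 (negbTE p0) /= => /orP[/eqP e|/orP[/eqP e|/eqP e]].
- by right; congr x; char2_by e.
- by left; congr x; char2_by e.
have {e hp p0} -> : phi = a + b by char2_by e.
have [->|xa] := eqVneq (x (a + b)) (x a); first by left.
have [->|xb] := eqVneq (x (a + b)) (x b); first by right.
move: (f3); rewrite free3E => /and5P[? ? ? ? /and3P[? ? ?]].
have abE := memvD hA hB.
have f1 : free [:: a + b; a; c].
  by rewrite free3E; repeat (apply/andP; split); nonzero.
have f4 : free [:: a + b; b; c].
  by rewrite free3E; repeat (apply/andP; split); nonzero.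
have k1 := three _ _ _ abE hA cE f1 xa; have k2 := three _ _ _ abE hB cE f4 xb.
have k := three _ _ _ hA hB cE f3 xab; exfalso.
case: k k1 k2 => -> [] k1 [] k2; rewrite ?k1 ?k2 ?eqxx // in xa xb xab.
Qed.

(** Induction on the number of rows.  If x is not local, an evaluation of rank
    at least two gives a local cut by induction; either such a cut exists and
    [vanish_local] applies, or [local_thin] does. *)
Theorem local_low_codim W E x : quasilinear W E x ->
  (\dim W + 4 <= 2 * \dim E)%N -> local W E x.
Proof.
have [k] := ubnP (\dim E); elim: k W E x => // k IHk W E x; rewrite ltnS => dk hx dW.
have IH W' E' x' : (\dim E' < \dim E)%N -> quasilinear W' E' x' ->
     (\dim W' + 4 <= 2 * \dim E')%N -> local W' E' x'.
  by move=> d; apply: IHk; apply: leq_trans d dk.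
have good x' (hx' : quasilinear W E x') z f : f \in E -> pr f z = 1 ->
    (1 < \dim (ev m z @: W))%N -> local W (perp E z) x'.
  by move=> hf fz d; apply: (local_cut_good IH hx' hf fz); lia.
have [d2|d2] := leqP (\dim E) 2.
  have d2E : \dim E = 2%N by lia.
  have W0 : W = 0%VS by apply/eqP; rewrite -dimv_eq0; lia.
  have [|a aE a0] := @exists_notin_span _ [::] E; first by rewrite /=; lia.
  rewrite span_nil memv0 in a0.
  have fa : free [:: a] by rewrite seq1_free.
  have [|b bE bn] := @exists_notin_span _ [:: a] E; first by rewrite /=; lia.
  have fab : free [:: a; b] := free_rcons fa bn.
  have D : defect x a b = 0 by apply/eqP; rewrite -memv0 -W0 hx.
  have xab : x a = x (a + b).
    have [y [ya yb]] := dual2 1 0 fab; have := congr1 (mulmx^~ y) D.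
    rewrite /defect mul0mx !mulmxDl !tensor_eval !prDl ya yb addr0 !scale1r scale0r addr0 => h.
    by char2_by h.
  have xbb : x b = x (a + b).
    have [y [ya yb]] := dual2 0 1 fab; have := congr1 (mulmx^~ y) D.
    rewrite /defect mul0mx !mulmxDl !tensor_eval !prDl ya yb add0r !scale1r scale0r add0r => h.
    by char2_by h.
  apply: (local_two (c := x a) (q := 0) hx) => phi hp p0; left.
  have [|pn] := boolP (phi \in <<[:: a; b]>>%VS); last first.
    have : (3 <= \dim E)%N.
      apply: (free_size_dim (free_rcons fab pn)) => z.
      by rewrite mem_rcons !inE => /or3P[] /eqP->.
    by rewrite d2E.
  rewrite !mem_span_cons span_nil !memv0 (negbTE p0) /= => /orP[/eqP e|/orP[/eqP e|/eqP e]].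
  - by rewrite xab -xbb; congr x; char2_by e.
  - by congr x; char2_by e.
  - by rewrite xab; congr x; char2_by e.
have [/existsP[y /existsP[h /and3P[hE /eqP hy /localP[u hu]]]]|] :=
  boolP [exists y, exists h, [&& h \in E, pr h y == 1 & localb W (perp E y) x]].
  have ex := shift_equiv_vanish hu; apply: (local_shift_equiv ex).
  have hx' := quasilinear_shift_equiv ex hx.
  apply: (vanish_local hx' d2 _ hE hy) => [|phi|]; first by lia.
    by rewrite memv_perp => /andP[_ ->].
  exact: good.
rewrite negb_exists => /forallP nogood; apply: local_thin => // z f hf fz.
rewrite leqNgt; apply/negP => d; have := nogood z; rewrite negb_exists => /forallP/(_ f).
by rewrite hf fz eqxx /= => /localP; apply; exact: (good x hx z f hf fz d).
Qed.

End LowCodim.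

Section HighDim.
Variables (m n : nat).
Implicit Types (W : {vspace 'M['F_2]_(m, n)}) (E : {vspace 'rV['F_2]_n}).
Implicit Types (x : 'rV['F_2]_n -> 'cV['F_2]_m).

(** * The critical dimension with at least four rows *)

Lemma dual3_col (a b c : 'cV['F_2]_m) i j k : free [:: a; b; c] ->
  exists r, [/\ pr r a = i, pr r b = j & pr r c = k].
Proof.
move=> /(free_dual (nth 0 [:: i; j; k]))[r h]; exists r.
by rewrite !pr_trace ![\tr (r *m _)]mxtrace_mulC (h 0%N isT) (h 1%N isT) (h 2%N isT).
Qed.

Lemma dim_gt2 (vT : vectType 'F_2) (A : {vspace vT}) a b c :
  free [:: a; b; c] -> a \in A -> b \in A -> c \in A -> (2 < \dim A)%N.
Proof.
by move=> f hA hB hC; apply: (free_size_dim f) => z; rewrite !inE => /or3P[] /eqP->.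
Qed.

Lemma mem_span2 (vT : vectType 'F_2) (a b e : vT) : e \in <<[:: a; b]>>%VS ->
  [\/ e = 0, e = a, e = b | e = a + b].
Proof.
rewrite !mem_span_cons span_nil !memv0 => /orP[/orP[]|/orP[]] /eqP h.
- by constructor 1.
- by constructor 3; char2_by h.
- by constructor 2; char2_by h.
- by constructor 4; char2_by h.
Qed.

(** The analogue of [vanish_local] one dimension higher.  If
    x(a), x(b), x(c) are independent, the cut is local at any z equal to 1 on
    a, b, c and some row where x vanishes; if x(a + d) left one of the two spans, a further triple of values would give
    a third local cut independent from the first two. *)
Lemma vanish_free3 W E x y a b c d : quasilinear W E x ->
  (\dim W + 3 <= 2 * \dim E)%N ->
  (forall phi, phi \in perp E y -> x phi = 0) -> ~ local W E x ->
  (forall z f, f \in E -> pr f z = 1 -> (2 < \dim (ev m z @: W))%N ->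
     local W (perp E z) x) ->
  [/\ a \in E, b \in E, c \in E & d \in E] ->
  [/\ pr a y = 1, pr b y = 1, pr c y = 1 & pr d y = 0] ->
  free [:: a; b; c; d] -> free [:: x a; x b; x c] ->
  x (a + d) \in <<[:: x a; x b]>>%VS /\ x (a + d) \in <<[:: x b; x c]>>%VS.
Proof.
move=> hx dW x0 nl good [aE bE cE dE] [ya yb yc yd] f4 fx.
have yg : local W (perp E y) x.
  by exists 0 => phi hp; rewrite x0 // addr0 mul0mx mem0v.
have [z1 [z1a z1b z1c z1d]] := dual4 1 1 1 1 f4.
have g1 : local W (perp E z1) x.
  apply: (good _ a) => //; apply: (dim_gt2 fx).
  - exact: (ev_vanish hx x0 aE dE).
  - exact: (ev_vanish hx x0 bE dE).
  - exact: (ev_vanish hx x0 cE dE).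
have adE := memvD aE dE; have acE := memvD aE cE; have cdE := memvD cE dE.
have abE := memvD aE bE; have bdE := memvD bE dE; have abdE := memvD abE dE.
have yac : pr (a + c) y = 0 by rewrite prDl ya yc addF2.
have /and3P[xa xb xab] : [&& x a != 0, x b != 0 & x a + x b != 0].
  by move: fx; rewrite free3E => /and5P[-> -> _ -> _].
have /and3P[_ xc xbc] : [&& x b != 0, x c != 0 & x b + x c != 0].
  by move: fx; rewrite free3E => /and5P[_ -> -> _ /and3P[_ -> _]].
split; apply: contraT => hn; exfalso; apply: nl.
  (* z2 is 1 on a, b and a + d, whose values are independent *)
  have [z2 [z2a z2b z2c z2d]] := dual4 1 1 0 0 f4.
  have fx2 : free [:: x a; x b; x (a + d)].
    by apply: free_rcons hn; rewrite free2E xa xb.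
  have g2 : local W (perp E z2) x.
    apply: (good _ a) => //; apply: (dim_gt2 fx2).
    - by apply: (ev_vanish hx x0 aE acE); rewrite ?yac ?prDl ?z2a ?z2c ?addr0.
    - by apply: (ev_vanish hx x0 bE acE); rewrite ?yac ?prDl ?z2a ?z2c ?addr0.
    - by apply: (ev_vanish hx x0 adE acE); rewrite ?yac ?prDl ?z2a ?z2c ?z2d ?addr0.
  apply: (three_good hx dW (And3 cdE dE acE) _ _ _ yg g1 g2);
  by split; rewrite ?prDl ?(ya, z1a, z2a) ?(yb, yc, yd, z1b, z1c, z1d, z2b, z2c, z2d)
    ?(ya, yb, yc, yd, z1b, z1c, z1d, z2b, z2c, z2d) ?(addF2, addr0, add0r).
(* z2 is 1 on b, c and a + d, whose values are independent *)
have [z2 [z2a z2b z2c z2d]] := dual4 0 1 1 1 f4.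
have fx2 : free [:: x b; x c; x (a + d)].
  by apply: free_rcons hn; rewrite free2E xc xb.
have g2 : local W (perp E z2) x.
  apply: (good _ b) => //; apply: (dim_gt2 fx2).
  - exact: (ev_vanish hx x0 bE dE).
  - exact: (ev_vanish hx x0 cE dE).
  - by apply: (ev_vanish hx x0 adE dE); rewrite ?prDl ?z2a ?z2d ?add0r.
apply: (three_good hx dW (And3 bdE abdE abE) _ _ _ yg g1 g2);
by split; rewrite !prDl ?ya ?z1a ?z2a ?yb ?z1b ?z2b ?yd ?z1d ?z2d ?addF2 ?addr0 ?add0r ?addF2.
Qed.

Lemma free_extend E x y a b c : (3 < \dim E)%N ->
  [/\ a \in E, b \in E & c \in E] -> [/\ pr a y = 1, pr b y = 1 & pr c y = 1] ->
  free [:: x a; x b; x c] ->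
  exists d, [/\ d \in E, pr d y = 0 & free [:: a; b; c; d]].
Proof.
move=> dE [aE bE cE] [ya yb yc] fx.
have f3 : free [:: a; b; c].
  move: fx; rewrite !free3E => /and5P[_ _ _ ab /and3P[ac bc _]].
  have ne (u v : 'rV_n) : x u + x v != 0 -> u + v != 0.
    by rewrite !addmove; apply: contraNneq => ->.
  rewrite (pr1_neq0 ya) (pr1_neq0 yb) (pr1_neq0 yc) (ne a b ab) (ne a c ac) (ne b c bc) /=.
  by apply: (@pr1_neq0 _ _ y); rewrite !prDl ya yb yc addF2 add0r.
have [d0 d0E d0n] : exists2 d, d \in E & d \notin <<[:: a; b; c]>>%VS by apply: exists_notin_span.
case: (F2P (pr d0 y)) => yd; first by exists d0; split => //; exact: (free_rcons f3 d0n).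
exists (d0 + a); rewrite memvD // prDl ya yd addF2; split => //.
by apply: (free_rcons f3); rewrite rpredDr // memv_span ?mem_head.
Qed.

(** Three independent values would force x(a + d), which is nonzero, into the
    three planes spanned by two of them, whose intersection is zero. *)
Lemma vanish_plane W E x y h : quasilinear W E x -> (3 < \dim E)%N ->
  (\dim W + 3 <= 2 * \dim E)%N -> h \in E -> pr h y = 1 ->
  (forall phi, phi \in perp E y -> x phi = 0) -> ~ local W E x ->
  (forall z f, f \in E -> pr f z = 1 -> (2 < \dim (ev m z @: W))%N ->
     local W (perp E z) x) ->
  exists u v, forall phi, phi \in E -> x phi \in <<[:: u; v]>>%VS.
Proof.
move=> hx dE dW hE hy x0 nl good.
have no3 a b c : [/\ a \in E, b \in E & c \in E] ->
    [/\ pr a y = 1, pr b y = 1 & pr c y = 1] -> ~~ free [:: x a; x b; x c].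
  move=> iE iy; apply/negP => fx.
  have [d [dE' yd f4]] := free_extend dE iE iy fx.
  case: iE iy => aE bE cE [ya yb yc].
  have [ab bc] := vanish_free3 hx dW x0 nl good (And4 aE bE cE dE') (And4 ya yb yc yd) f4 fx.
  have f4' : free [:: a; c; b; d].
    by rewrite -(@perm_free _ _ [:: a; b; c; d]) // perm_cons (perm_catCA [:: b] [:: c] [:: d]).
  have fx' : free [:: x a; x c; x b].
    by rewrite -(@perm_free _ _ [:: x a; x b; x c]) // perm_cons (perm_catC [:: x b] [:: x c]).
  have [ac _] := vanish_free3 hx dW x0 nl good (And4 aE cE bE dE') (And4 ya yc yb yd) f4' fx'.
  have : x (a + d) != 0.
    by apply/eqP/(vanish_nonzero hx _ _ x0 nl); rewrite ?memvD ?prDl ?ya ?yd ?addr0.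
  move: ab bc ac; move: (x (a + d)) => e ab bc ac; apply/negP; rewrite negbK.
  have [r1 [ra rb rc]] := dual3_col 1 0 0 fx.
  have [r2 [sa sb sc]] := dual3_col 0 1 0 fx.
  have e1 : pr r1 e = 0 by case: (mem_span2 bc) => ->; rewrite ?prDr ?rb ?rc ?addr0 // /pr mulmx0 mxE.
  have e2 : pr r2 e = 0 by case: (mem_span2 ac) => ->; rewrite ?prDr ?sa ?sc ?addr0 // /pr mulmx0 mxE.
  case: (mem_span2 ab) e1 e2 => ->; rewrite ?prDr ?ra ?rb ?sa ?sb ?addr0 ?add0r //.
have inH phi : phi \in E -> pr phi y = 0 -> x phi = 0.
  by move=> hp py; rewrite x0 // memv_perp hp py /=.
have xh : x h != 0 by apply/eqP; exact: (vanish_nonzero hx hE hy).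
have [/existsP[b /and3P[bE /eqP yb bn]]|] :=
    boolP [exists b, [&& b \in E, pr b y == 1 & x b \notin <<[:: x h]>>%VS]].
  exists (x h), (x b) => phi hp; case: (F2P (pr phi y)) => py.
    by rewrite inH ?mem0v.
  have fhb : free [:: x h; x b] by apply: free_rcons bn; rewrite seq1_free.
  have := no3 h b phi (And3 hE bE hp) (And3 hy yb py).
  by apply: contraR => hn; exact: (free_rcons fhb hn).
rewrite negb_exists => /forallP H; exists (x h), (x h) => phi hp.
case: (F2P (pr phi y)) => py; first by rewrite inH ?mem0v.
have := H phi; rewrite hp py eqxx /= negbK => k.
by rewrite mem_span_cons k.
Qed.

(** Over F_2 an affine plane is three distinct points and their sum. *)
Definition in_plane (vT : vectType 'F_2) (p q r e : vT) :=
  [\/ e = p, e = q, e = r | e = p + q + r].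

(** Some y equals 1 on a, b, c and phi unless phi is 0 or a sum of two of
    a, b, c; evaluation at this y has rank two, which confines x(phi). *)
Lemma flat_four W E x a b c phi : quasilinear W E x ->
  (forall z f, f \in E -> pr f z = 1 -> (\dim (ev m z @: W) <= 2)%N) ->
  [/\ a \in E, b \in E, c \in E & phi \in E] -> free [:: a; b; c] ->
  [/\ x a != x b, x a != x c & x b != x c] ->
  [/\ phi != 0, phi != a + b, phi != a + c & phi != b + c] ->
  in_plane (x a) (x b) (x c) (x phi).
Proof.
move=> hx flat [aE bE cE hp] f3 [xab xac xbc] [p0 pab pac pbc].
have three y : pr a y = 1 -> pr b y = 1 -> pr c y = 1 -> pr phi y = 1 ->
    in_plane (x a) (x b) (x c) (x phi).
  move=> ya yb yc yp.
  have f : free [:: x a + x b; x a + x c].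
    rewrite free2E !addmove xab xac /=; apply: contraNneq xbc => e.
    by apply/eqP; char2_by e.
  have [|hn] := boolP (x a + x phi \in <<[:: (x a + x b)%R; (x a + x c)%R]>>%VS).
    case/mem_span2 => e.
    - by constructor 1; char2_by e.
    - by constructor 2; char2_by e.
    - by constructor 3; char2_by e.
    - by constructor 4; char2_by e.
  have := flat _ _ aE ya; rewrite leqNgt => /negP[].
  apply: (dim_gt2 (free_rcons f hn)); exact: evD_mem hx _ _ _ _.
have [y [ya yb yc]] := dual3 1 1 1 f3.
case: (F2P (pr phi y)) => yp; last exact: (three y).
have [|hn] := boolP (phi \in <<[:: a; b; c]>>%VS); last first.
  have [z [? ? ? ?]] := dual4 1 1 1 1 (free_rcons f3 hn); exact: (three z).
rewrite mem_span_cons => /orP[] /mem_span2[] e; exfalso.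
- by rewrite e eqxx in p0.
- by rewrite e yb in yp.
- by rewrite e yc in yp.
- by rewrite e eqxx in pbc.
- by have e' : phi = a by [char2_by e]; rewrite e' ya in yp.
- by have e' : phi = a + b by [char2_by e]; rewrite e' eqxx in pab.
- by have e' : phi = a + c by [char2_by e]; rewrite e' eqxx in pac.
- have e' : phi = a + b + c by char2_by e.
  by move: yp; rewrite e' !prDl ya yb yc addF2 add0r.
Qed.

(** If x(a + b) is off the plane of x(a), x(b), x(c), then [flat_four] applies to
    the three triples obtained from a, b, c, a + b.  Their planes meet in x(c)
    only, so x = x(c) off the span of a, b, c, and x is local. *)
Lemma flat_sum W E x a b c : quasilinear W E x -> (3 < \dim E)%N -> ~ local W E x ->
  (forall z f, f \in E -> pr f z = 1 -> (\dim (ev m z @: W) <= 2)%N) ->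
  [/\ a \in E, b \in E & c \in E] -> free [:: a; b; c] ->
  [/\ x a != x b, x a != x c & x b != x c] ->
  in_plane (x a) (x b) (x c) (x (a + b)).
Proof.
move=> hx dE nl flat [aE bE cE] f3 [xab xac xbc].
pose dec (p q r e : 'cV['F_2]_m) := [|| e == p, e == q, e == r | e == p + q + r].
have decP p q r e : reflect (in_plane p q r e) (dec p q r e).
  apply: (iffP idP) => [/or4P[] /eqP->|[] ->]; rewrite /dec ?eqxx ?orbT //;
  by [constructor 1|constructor 2|constructor 3|constructor 4].
apply/decP; apply: contraT; rewrite /dec !negb_or => /and4P[na nb nc nabc].
exfalso; apply: nl.
have [h hE hn] : exists2 d, d \in E & d \notin <<[:: a; b; c]>>%VS by apply: exists_notin_span.
(* q kills a, b, c, so the rows with phi q = 1 are off their span *)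
have [q [qa qb qc qh]] := dual4 0 0 0 1 (free_rcons f3 hn).
apply: (@local_const _ _ _ _ _ q (x c)) => //; first by exists h.
move=> phi hp qp.
have ne s : pr s q = 0 -> phi != s.
  by move=> qs; apply: contraTneq isT => e; move: qp; rewrite e qs.
have abE := memvD aE bE.
move: (f3); rewrite free3E => /and5P[? ? ? ? /and3P[? ? ?]].
have f1 : free [:: a + b; a; c] by rewrite free3E; repeat (apply/andP; split); nonzero.
have f2 : free [:: a + b; b; c] by rewrite free3E; repeat (apply/andP; split); nonzero.
have P1 : in_plane (x a) (x b) (x c) (x phi).
  by apply: (flat_four hx flat (And4 aE bE cE hp) f3) => //; split; apply: ne;
     rewrite ?prDl ?qa ?qb ?qc ?addr0 // /pr mul0mx mxE.
have P2 : in_plane (x (a + b)) (x a) (x c) (x phi).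
  by apply: (flat_four hx flat (And4 abE aE cE hp) f1) => //; split; try (apply: ne);
     rewrite ?prDl ?qa ?qb ?qc ?addr0 // /pr mul0mx mxE.
have P3 : in_plane (x (a + b)) (x b) (x c) (x phi).
  by apply: (flat_four hx flat (And4 abE bE cE hp) f2) => //; split; try (apply: ne);
     rewrite ?prDl ?qa ?qb ?qc ?addr0 // /pr mul0mx mxE.
move: P1 P2 P3 na nb nc nabc xab xac xbc.
move: (x a) (x b) (x c) (x (a + b)) (x phi) => A B C S P.
case=> -> P2 P3 nA nB nC nABC AB AC BC; [exfalso|exfalso|by []|exfalso].
- case: P3 => e.
  + by rewrite e eqxx in nA.
  + by rewrite e eqxx in AB.
  + by rewrite e eqxx in AC.
  + by move/negP: nABC; apply; apply/eqP; char2_by e.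
- case: P2 => e.
  + by rewrite e eqxx in nB.
  + by rewrite e eqxx in AB.
  + by rewrite e eqxx in BC.
  + by move/negP: nABC; apply; apply/eqP; char2_by e.
- case: P2 => e.
  + by rewrite e eqxx in nABC.
  + by move/negP: BC; apply; apply/eqP; char2_by e.
  + by move/negP: AB; apply; apply/eqP; char2_by e.
  + by move/negP: nB; apply; apply/eqP; char2_by e.
Qed.

(** Three distinct values can always be realized at three independent rows: if
    they occur on a line a, b, a + b, any row off the line differs from two of
    them. *)
Lemma flat_plane W E x : quasilinear W E x -> (3 < \dim E)%N -> ~ local W E x ->
  (forall z f, f \in E -> pr f z = 1 -> (\dim (ev m z @: W) <= 2)%N) ->
  exists c u v, forall phi, phi \in E -> phi != 0 -> x phi + c \in <<[:: u; v]>>%VS.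
Proof.
move=> hx dE nl flat.
have base a b c : [/\ a \in E, b \in E & c \in E] -> free [:: a; b; c] ->
    [/\ x a != x b, x a != x c & x b != x c] ->
    exists c u v, forall phi, phi \in E -> phi != 0 -> x phi + c \in <<[:: u; v]>>%VS.
  move=> [aE bE cE] f3 [xab xac xbc].
  have fp a' b' c' : perm_eq [:: a; b; c] [:: a'; b'; c'] -> free [:: a'; b'; c'].
    by move=> /perm_free <-.
  have sab := flat_sum hx dE nl flat (And3 aE bE cE) f3 (And3 xab xac xbc).
  have sac : in_plane (x a) (x c) (x b) (x (a + c)).
    apply: (flat_sum hx dE nl flat) => //; last by rewrite [x c == _]eq_sym.
    by apply: fp; rewrite perm_cons (perm_catC [:: b] [:: c]).
  have sbc : in_plane (x b) (x c) (x a) (x (b + c)).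
    apply: (flat_sum hx dE nl flat) => //; last by rewrite ![_ == x a]eq_sym.
    by apply: fp; rewrite (perm_catC [:: a] [:: b; c]).
  have {}sac : in_plane (x a) (x b) (x c) (x (a + c)).
    by case: sac => ->; [constructor 1|constructor 3|constructor 2|constructor 4; rewrite addrAC].
  have {}sbc : in_plane (x a) (x b) (x c) (x (b + c)).
    by case: sbc => ->; [constructor 2|constructor 3|constructor 1|constructor 4; char2].
  exists (x a), (x a + x b), (x a + x c) => phi hp p0.
  have : in_plane (x a) (x b) (x c) (x phi).
    have [->//|pab] := eqVneq phi (a + b); have [->//|pac] := eqVneq phi (a + c).
    have [->//|pbc] := eqVneq phi (b + c).
    exact: (flat_four hx flat (And4 aE bE cE hp) f3).
  rewrite !mem_span_cons span_nil !memv0 => -[] ->.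
  - by rewrite add_self eqxx.
  - by rewrite (_ : x b + x a + (x a + x b) = 0) ?eqxx ?orbT //; char2.
  - by rewrite (_ : x c + x a + (x a + x c) = 0) ?eqxx ?orbT //; char2.
  - rewrite (_ : _ + (x a + x b) + (x a + x c) = 0) ?eqxx ?orbT //; char2.
have [/existsP[a /existsP[b /existsP[c /and5P[/and3P[aE bE cE] /and3P[a0 b0 c0] xab xac xbc]]]]|] :=
  boolP [exists a, exists b, exists c, [&& [&& a \in E, b \in E & c \in E],
    [&& a != 0, b != 0 & c != 0], x a != x b, x a != x c & x b != x c]].
  have ne (u v : 'rV_n) : x u != x v -> u + v != 0.
    by rewrite addmove; apply: contraNneq => ->.
  have [e|abc] := eqVneq (a + b + c) 0; last first.
    by apply: (base a b c) => //; rewrite free3E a0 b0 c0 abc !ne.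
  have ec : c = a + b by char2_by e.
  have f2 : free [:: a; b] by rewrite free2E a0 b0 ne.
  have [d dE' dn] : exists2 d, d \in E & d \notin <<[:: a; b]>>%VS.
    by apply: exists_notin_span; exact: ltnW.
  have f3 := free_rcons f2 dn; rewrite /= in f3.
  move: (f3); rewrite free3E => /and5P[? ? ? ? /and3P[? ? ?]].
  have [xda|xda] := eqVneq (x d) (x a).
    apply: (base c b d) => //; last by split; rewrite ?xda // eq_sym.
    by rewrite ec free3E; repeat (apply/andP; split); nonzero.
  have [xdb|xdb] := eqVneq (x d) (x b).
    apply: (base a c d) => //; last by split; rewrite ?xdb // eq_sym.
    by rewrite ec free3E; repeat (apply/andP; split); nonzero.
  by apply: (base a b d) => //; split; rewrite // eq_sym.
rewrite negb_exists => /forallP H.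
have [/existsP[a /existsP[b /and5P[aE bE a0 b0 xab]]]|] := boolP [exists a, exists b,
  [&& a \in E, b \in E, a != 0, b != 0 & x a != x b]].
  exists (x a), (x a + x b), 0 => phi hp p0.
  have := H a; rewrite negb_exists => /forallP/(_ b); rewrite negb_exists => /forallP/(_ phi).
  rewrite aE bE hp a0 b0 p0 xab /= negb_and !negbK !mem_span_cons span_nil !memv0.
  case/orP=> /eqP <-; first by rewrite add_self eqxx.
  by rewrite (_ : x b + x a + (x a + x b) = 0) ?eqxx ?orbT //; char2.
rewrite negb_exists => /forallP G; case: nl.
have [|a aE] := @exists_notin_span _ [::] E; first by rewrite /=; lia.
rewrite span_nil memv0 => a0.
apply: (local_two (c := x a) (q := 0) hx) => phi hp p0; left.
have := G a; rewrite negb_exists => /forallP/(_ phi).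
by rewrite hp aE a0 p0 /= negbK => /eqP.
Qed.

(** An evaluation of rank at least three gives a local cut by
    [local_low_codim].  Either some cut is local, and x can be made to vanish on
    a hyperplane, or all evaluations have rank at most two. *)
Theorem critical_plane W E x : quasilinear W E x -> (3 < \dim E)%N ->
  (\dim W + 3 <= 2 * \dim E)%N -> ~ local W E x ->
  exists2 x', shift_equiv W E x x' &
    exists c u v, forall phi, phi \in E -> phi != 0 -> x' phi + c \in <<[:: u; v]>>%VS.
Proof.
move=> hx dE dW nl.
have good x' (hx' : quasilinear W E x') z f : f \in E -> pr f z = 1 ->
    (2 < \dim (ev m z @: W))%N -> local W (perp E z) x'.
  move=> hf fz d; apply: (@local_cut_good _ _ W E _ z f) => //; last by lia.
  by move=> W' E' x'' _; exact: local_low_codim.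
have [/existsP[y /existsP[h /and3P[hE /eqP hy /localP[u hu]]]]|] :=
  boolP [exists y, exists h, [&& h \in E, pr h y == 1 & localb W (perp E y) x]].
  have ex := shift_equiv_vanish hu.
  have hx' := quasilinear_shift_equiv ex hx.
  eexists; first exact: ex.
  have [||a [b ab]] := vanish_plane hx' dE dW hE hy _ _ (good _ hx').
  - by move=> phi; rewrite memv_perp => /andP[_ ->].
  - by move=> l; apply: nl; exact: (local_shift_equiv ex l).
  by exists 0, a, b => phi hp _; rewrite addr0 ab.
rewrite negb_exists => /forallP nogood; exists x.
  by exists 0 => phi hp; rewrite add_self addr0 mul0mx mem0v.
apply: (flat_plane hx dE nl) => z f hf fz.
rewrite leqNgt; apply/negP => d; have := nogood z; rewrite negb_exists => /forallP/(_ f).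
by rewrite hf fz eqxx /= => /localP; apply; exact: (good x hx z f hf fz d).
Qed.

End HighDim.

(** * Annihilators of spaces of operators *)

Section Annihilator.
Variables (m n : nat).
Implicit Types (S : {vspace 'M['F_2]_(n, m)}) (A : 'M['F_2]_(n, m)) (N : 'M['F_2]_(m, n)).
Implicit Types (x : 'rV['F_2]_n -> 'cV['F_2]_m) (phi psi : 'rV['F_2]_n).

Definition traces (X : seq 'M['F_2]_(n, m)) (N : 'M['F_2]_(m, n)) : 'rV['F_2]_(size X) :=
  \row_i \tr (X`_i *m N).

Fact traces_linear X : linear (traces X).
Proof.
by move=> k N N'; apply/rowP => i; rewrite !mxE mulmxDr -scalemxAr mxtraceD mxtraceZ.
Qed.
HB.instance Definition _ X :=
  GRing.isLinear.Build 'F_2 'M['F_2]_(m, n) 'rV['F_2]_(size X) _ (traces X) (traces_linear X).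

Definition annihilator S : {vspace 'M['F_2]_(m, n)} := lker (linfun (traces (vbasis S))).

Lemma annihilatorP S N :
  reflect (forall A, A \in S -> \tr (A *m N) = 0) (N \in annihilator S).
Proof.
rewrite memv_ker lfunE /=; apply: (iffP eqP) => [h A hA|h].
  rewrite (coord_vbasis hA) mulmx_suml raddf_sum big1 // => i _ /=.
  have hi : (i < size (vbasis S))%N by rewrite size_tuple.
  have /rowP/(_ (Ordinal hi)) := h; rewrite !mxE /= => e.
  by rewrite -scalemxAl mxtraceZ e mulr0.
apply/rowP => i; rewrite !mxE h //; apply: vbasis_mem; apply: mem_nth; exact: ltn_ord.
Qed.

Lemma dim_annihilator S : (\dim (annihilator S) + \dim S = m * n)%N.
Proof.
have := limg_ker_dim (linfun (traces (vbasis S))) fullv; rewrite capfv.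
have -> : (linfun (traces (vbasis S)) @: fullv = fullv)%VS.
  apply/eqP; rewrite eqEsubv subvf /=; apply/subvP => r _.
  have [N hN] := free_dual (fun i => if insub i is Some j then r 0 j else 0) (basis_free (vbasisP S)).
  apply/memv_imgP; exists N; rewrite ?memvf // lfunE /=; apply/rowP => i.
  by rewrite mxE hN ?ltn_ord // valK.
have dR k : \dim {: 'rV['F_2]_k} = k by rewrite dimvf /dim /= mul1n.
have dM : \dim {: 'M['F_2]_(m, n)} = (m * n)%N by rewrite dimvf.
by rewrite dR dM => <-; congr addn; rewrite size_tuple.
Qed.

Lemma double_annihilator S A :
  (forall N, N \in annihilator S -> \tr (A *m N) = 0) -> A \in S.
Proof.
move=> h; apply: contraT => hA.
have f : free (A :: vbasis S).
  by rewrite free_cons (basis_free (vbasisP S)) (span_basis (vbasisP S)) hA.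
have [N hN] := free_dual (fun i => (i == 0)%:R) f.
have := hN 0%N isT; rewrite /= h ?mulr1n; first by move/eqP; rewrite eq_sym oner_eq0.
apply/annihilatorP => B hB; rewrite (coord_vbasis hB) mulmx_suml raddf_sum big1 // => i _ /=.
have hi : (i.+1 < size (A :: vbasis S))%N by rewrite /= ltnS size_tuple.
by have /= e := hN _ hi; rewrite -scalemxAl mxtraceZ e mulr0.
Qed.

(** The dual form of a nonlocal range-compatible map on a space of codimension
    2n - 3. *)
Definition critical S x :=
  [/\ quasilinear (annihilator S) fullv x, ~ local (annihilator S) fullv x &
      (\dim (annihilator S) + 3 = 2 * n)%N].

Lemma critical_shift S x x' : shift_equiv (annihilator S) fullv x x' ->
  critical S x -> critical S x'.
Proof.
move=> e [hx nl d]; split; [exact: (quasilinear_shift_equiv e hx)| |exact: d].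
by move=> l; apply: nl; exact: (local_shift_equiv e l).
Qed.

Lemma shift_equiv_const W E x c : @shift_equiv m n W E x (fun phi => x phi + c).
Proof.
exists c => phi _; rewrite (_ : _ + _ + c = 0) ?mul0mx ?mem0v //; char2.
Qed.

Definition qform A x phi := pr phi (A *m x phi).

Lemma trace_defect A x phi psi :
  \tr (A *m defect x phi psi) = qform A x phi + qform A x psi + qform A x (phi + psi).
Proof. by rewrite /defect /qform 2!mulmxDr !mxtraceD !trace_tensor. Qed.

Lemma dim_rV : (\dim {: 'rV['F_2]_n} = n)%N.
Proof. by rewrite dimvf /dim /= mul1n. Qed.

(** The defects of x span a subspace of the annihilator modulo which x is still
    nonlocal, so by [local_low_codim] it is not smaller than the annihilator.
    Membership in S can thus be tested on the defects alone. *)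
Lemma critical_mem S x A : critical S x ->
  (forall phi psi, qform A x (phi + psi) = qform A x phi + qform A x psi) -> A \in S.
Proof.
move=> [hx nl dW] hA; apply: double_annihilator => N hN.
(* rows are finitely many, so the defects form a finite family *)
pose D := [seq defect x p.1 p.2 | p <- enum {: 'rV['F_2]_n * 'rV['F_2]_n}].
have DW : (<<D>> <= annihilator S)%VS.
  by apply/span_subvP => ? /mapP[p _ ->]; apply: hx; exact: memvf.
have qD : quasilinear <<D>>%VS fullv x.
  by move=> phi psi _ _; apply: memv_span; apply/mapP; exists (phi, psi); rewrite ?mem_enum.
have : annihilator S = <<D>>%VS.
  apply/esym/eqP; rewrite eqEdim DW leqNgt; apply/negP => d; apply: nl.
  apply: (local_sub DW); apply: local_low_codim qD _.
  by rewrite dim_rV; lia.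
move=> e; rewrite e in hN; move: hN => /(coord_span (X := in_tuple D)) ->.
rewrite mulmx_sumr raddf_sum big1 // => i _ /=.
rewrite -scalemxAr mxtraceZ; have : D`_i \in D by apply: mem_nth; exact: ltn_ord.
by move=> /mapP[p _ ->]; rewrite trace_defect hA addF2 mulr0.
Qed.

Lemma critical_additive S x A phi psi : critical S x -> A \in S ->
  qform A x (phi + psi) = qform A x phi + qform A x psi.
Proof.
move=> [hx _ _] hA.
have /annihilatorP/(_ A hA) := hx phi psi (memvf _) (memvf _).
rewrite trace_defect; move: (qform _ _ _) (qform _ _ _) (qform _ _ _) => p q r h.
by char2_by h.
Qed.

(** Rectangular P and Q keep the dimensions of the model independent from those
    of S, so that no cast along an equality of dimensions is needed. *)
Definition mx_rep S (n' m' : nat) (M : {set 'M['F_2]_(n', m')}) :=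
  exists (P : 'M_(n', n)) (P' : 'M_(n, n')) (Q : 'M_(m, m')) (Q' : 'M_(m', m)),
    [/\ P *m P' = 1%:M, P' *m P = 1%:M, Q *m Q' = 1%:M, Q' *m Q = 1%:M &
        forall A, (A \in S) = (P *m A *m Q \in M)].

Definition mx_of_cols k (s : seq 'cV['F_2]_k) : 'M['F_2]_(k, size s) :=
  \matrix_(i, j) s`_j i 0.

Lemma mul_mx_of_cols k l (B : 'M_(l, k)) (s : seq 'cV['F_2]_k) (j : 'I_(size s)) i :
  (B *m mx_of_cols s) i j = (B *m s`_j) i 0.
Proof. by rewrite !mxE; apply: eq_bigr => l' _; rewrite mxE. Qed.

Lemma complete_cols k (s : seq 'cV['F_2]_k) : free s ->
  exists p (C : 'M_(k, p)) (Q' : 'M_(size s + p, k)),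
    row_mx (mx_of_cols s) C *m Q' = 1%:M /\ Q' *m row_mx (mx_of_cols s) C = 1%:M.
Proof.
move=> fs; set Y := mx_of_cols s.
have [L hL] : exists L, L *m Y = 1%:M.
  have [f hf] : exists f : 'I_(size s) -> 'rV_k, forall i j : 'I_(size s), (f i *m s`_j) 0 0 = (j == i)%:R.
    have /fin_all_exists[f hf] : forall i : 'I_(size s), exists r : 'rV_k,
        forall j : 'I_(size s), (r *m s`_j) 0 0 = (j == i)%:R.
      move=> i; have [r hr] := free_dual (fun j => (j == i)%:R) fs.
      by exists r => j; rewrite -trace_mx11 mxtrace_mulC hr.
    by exists f.
  exists (\matrix_i f i); apply/matrixP => i j.
  rewrite mul_mx_of_cols !mxE eq_sym -hf !mxE.
  by apply: eq_bigr => l _; rewrite !mxE.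
have rY : row_free Y^T.
  by apply/row_freeP; exists L^T; rewrite -trmx_mul hL trmx1.
pose Z := row_base (Y^T)^C%MS.
have full : row_full (col_mx Y^T Z).
  have h : (1%:M <= Y^T + Y^T^C)%MS by rewrite sub1mx addsmx_compl_full.
  by rewrite -sub1mx; apply: submx_trans h _; rewrite -addsmxE addsmxS // eq_row_base.
exists _, Z^T, (pinvmx (col_mx Y^T Z))^T.
have -> : row_mx Y Z^T = (col_mx Y^T Z)^T by rewrite tr_col_mx trmxK.
rewrite -!trmx_mul mulVpmx // trmx1 mulmxVp ?trmx1 //.
have rk : \rank Y^T = size s by exact/eqP.
by rewrite /row_free (eqP full) mxrank_compl rk subnKC // -{1}rk rank_leq_col.
Qed.

End Annihilator.

(** * Matrix coordinates for three rows *)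

Ltac gen_pr := repeat match goal with |- context [pr ?a ?b] => move: (pr a b) => ? end.

Section Stack.
Variable m : nat.
Implicit Types (A : 'M['F_2]_(3, m)).
Implicit Types (x : 'rV['F_2]_3 -> 'cV['F_2]_m) (e : 'rV['F_2]_3) (v : 'cV['F_2]_m).

Definition stack (e1 e2 e3 : 'rV['F_2]_3) : 'M['F_2]_3 := \matrix_(i, j) [:: e1; e2; e3]`_i 0 j.

Lemma stack_entry e1 e2 e3 A (s : seq 'cV['F_2]_m) i (j : 'I_(size s)) :
  (stack e1 e2 e3 *m A *m mx_of_cols s) i j = pr [:: e1; e2; e3]`_i (A *m s`_j).
Proof.
rewrite mul_mx_of_cols -mulmxA mxE /pr mxE.
by apply: eq_bigr => k _; rewrite mxE.
Qed.

Lemma forall_I3 (P : 'I_3 -> Prop) : P 0 -> P 1 -> P (inord 2) -> forall i, P i.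
Proof.
move=> h0 h1 h2 [[|[|[|//]]] hi].
- by rewrite (_ : Ordinal hi = 0) //; apply: val_inj.
- by rewrite (_ : Ordinal hi = 1) //; apply: val_inj.
- by rewrite (_ : Ordinal hi = inord 2) //; apply: val_inj; rewrite /= inordK.
Qed.

Lemma forall_I4 (P : 'I_4 -> Prop) : P 0 -> P 1 -> P (inord 2) -> P (inord 3) -> forall i, P i.
Proof.
move=> h0 h1 h2 h3 [[|[|[|[|//]]]] hi].
- by rewrite (_ : Ordinal hi = 0) //; apply: val_inj.
- by rewrite (_ : Ordinal hi = 1) //; apply: val_inj.
- by rewrite (_ : Ordinal hi = inord 2) //; apply: val_inj; rewrite /= inordK.
- by rewrite (_ : Ordinal hi = inord 3) //; apply: val_inj; rewrite /= inordK.
Qed.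

Lemma stack_eq3 e1 e2 e3 A v1 v2 v3 a11 a12 a13 a21 a22 a23 a31 a32 a33 :
  stack e1 e2 e3 *m A *m mx_of_cols [:: v1; v2; v3] =
    mx_of_rows 3 3 [:: [:: a11; a12; a13]; [:: a21; a22; a23]; [:: a31; a32; a33]] <->
  [/\ [/\ pr e1 (A *m v1) = a11, pr e1 (A *m v2) = a12 & pr e1 (A *m v3) = a13],
      [/\ pr e2 (A *m v1) = a21, pr e2 (A *m v2) = a22 & pr e2 (A *m v3) = a23] &
      [/\ pr e3 (A *m v1) = a31, pr e3 (A *m v2) = a32 & pr e3 (A *m v3) = a33]].
Proof.
split=> [/matrixP E|[[h1 h2 h3] [h4 h5 h6] [h7 h8 h9]]].
  have h i j := E i j; split; split.
  - by have := h 0 0; rewrite stack_entry mxE.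
  - by have := h 0 1; rewrite stack_entry mxE.
  - by have := h 0 (inord 2); rewrite stack_entry mxE /= inordK.
  - by have := h 1 0; rewrite stack_entry mxE.
  - by have := h 1 1; rewrite stack_entry mxE.
  - by have := h 1 (inord 2); rewrite stack_entry mxE /= inordK.
  - by have := h (inord 2) 0; rewrite stack_entry mxE /= inordK.
  - by have := h (inord 2) 1; rewrite stack_entry mxE /= inordK.
  - by have := h (inord 2) (inord 2); rewrite stack_entry mxE /= inordK.
apply/matrixP; apply: forall_I3; apply: forall_I3;
  by rewrite stack_entry mxE ?inordK.
Qed.

Lemma stack_eq4 e1 e2 e3 A v1 v2 v3 v4 a11 a12 a13 a14 a21 a22 a23 a24 a31 a32 a33 a34 :
  stack e1 e2 e3 *m A *m mx_of_cols [:: v1; v2; v3; v4] =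
    mx_of_rows 3 4 [:: [:: a11; a12; a13; a14]; [:: a21; a22; a23; a24];
                       [:: a31; a32; a33; a34]] <->
  [/\ [/\ pr e1 (A *m v1) = a11, pr e1 (A *m v2) = a12, pr e1 (A *m v3) = a13 & pr e1 (A *m v4) = a14],
      [/\ pr e2 (A *m v1) = a21, pr e2 (A *m v2) = a22, pr e2 (A *m v3) = a23 & pr e2 (A *m v4) = a24] &
      [/\ pr e3 (A *m v1) = a31, pr e3 (A *m v2) = a32, pr e3 (A *m v3) = a33 & pr e3 (A *m v4) = a34]].
Proof.
split=> [/matrixP E|[[h1 h2 h3 h4] [k1 k2 k3 k4] [l1 l2 l3 l4]]].
  have h i j := E i j; split; split.
  - by have := h 0 0; rewrite stack_entry mxE.
  - by have := h 0 1; rewrite stack_entry mxE.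
  - by have := h 0 (inord 2); rewrite stack_entry mxE /= inordK.
  - by have := h 0 (inord 3); rewrite stack_entry mxE /= inordK.
  - by have := h 1 0; rewrite stack_entry mxE.
  - by have := h 1 1; rewrite stack_entry mxE.
  - by have := h 1 (inord 2); rewrite stack_entry mxE /= inordK.
  - by have := h 1 (inord 3); rewrite stack_entry mxE /= inordK.
  - by have := h (inord 2) 0; rewrite stack_entry mxE /= inordK.
  - by have := h (inord 2) 1; rewrite stack_entry mxE /= inordK.
  - by have := h (inord 2) (inord 2); rewrite stack_entry mxE /= !inordK.
  - by have := h (inord 2) (inord 3); rewrite stack_entry mxE /= !inordK.
apply/matrixP; apply: forall_I3; apply: forall_I4;
  by rewrite stack_entry mxE ?inordK.
Qed.

End Stack.

Section DimThree.
Variable m : nat.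
Implicit Types (S : {vspace 'M['F_2]_(3, m)}) (A : 'M['F_2]_(3, m)).
Implicit Types (x : 'rV['F_2]_3 -> 'cV['F_2]_m) (e : 'rV['F_2]_3) (v : 'cV['F_2]_m).

Definition coprod_type S k (M0 : {set 'M['F_2]_(3, k)}) :=
  exists p, mx_rep S (mx_coprod M0 [set: 'M['F_2]_(3, p)]).

(** Testing membership on the columns s suffices: completing s to a basis only
    adds columns on which S imposes no condition. *)
Lemma coprod_type_intro S e1 e2 e3 (s : seq 'cV['F_2]_m) (M0 : {set 'M['F_2]_(3, size s)}) :
  free [:: e1; e2; e3] -> free s ->
  (forall A, (A \in S) = (stack e1 e2 e3 *m A *m mx_of_cols s \in M0)) ->
  coprod_type S M0.
Proof.
move=> fe fs hS; have [p [C [Q' [h1 h2]]]] := complete_cols fs.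
have [y1 [p11 p21 p31]] := dual3 1 0 0 fe.
have [y2 [p12 p22 p32]] := dual3 0 1 0 fe.
have [y3 [p13 p23 p33]] := dual3 0 0 1 fe.
pose P' := mx_of_cols [:: y1; y2; y3].
have PP : stack e1 e2 e3 *m P' = 1%:M.
  rewrite -[stack _ _ _]mulmx1.
  apply/matrixP; apply: forall_I3; apply: forall_I3;
  rewrite (@stack_entry _ _ _ _ 1%:M) mul1mx /= ?inordK //= mxE -?val_eqE /= ?inordK //=.
exists p, (stack e1 e2 e3), P', (row_mx (mx_of_cols s) C), Q'; split=> //.
  exact: mulmx1C.
move=> A; rewrite hS mul_mx_row; apply/idP/idP.
  move=> h; rewrite inE; apply/existsP; eexists; apply/andP; split; first exact: h.
  by apply/existsP; eexists; rewrite inE /=; exact: eqxx.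
rewrite inE => /existsP[X /andP[hX /existsP[Y /andP[_ /eqP e]]]].
by have [-> _] := eq_row_mx e.
Qed.

End DimThree.

(** * Three rows: configurations and their types *)

Section DimThreeTypes.
Variable m : nat.
Implicit Types (S : {vspace 'M['F_2]_(3, m)}) (A : 'M['F_2]_(3, m)).
Implicit Types (x : 'rV['F_2]_3 -> 'cV['F_2]_m) (e : 'rV['F_2]_3) (v : 'cV['F_2]_m).

Lemma span3_full e1 e2 e3 e : free [:: e1; e2; e3] -> e \in <<[:: e1; e2; e3]>>%VS.
Proof.
move=> f; apply: contraT => h.
have := free_size_dim (free_rcons f h) (fun z _ => memvf z).
by rewrite dim_rV.
Qed.

Lemma span3_ind (P : 'rV['F_2]_3 -> Prop) e1 e2 e3 : free [:: e1; e2; e3] ->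
  P 0 -> P e1 -> P e2 -> P e3 -> P (e1 + e2) -> P (e1 + e3) -> P (e2 + e3) ->
  P (e1 + e2 + e3) -> forall e, P e.
Proof.
move=> f; have hs e := span3_full e f; move=> p0 p1 p2 p3 p12 p13 p23 p123 e.
have := hs e; rewrite mem_span_cons => /orP[] /mem_span2[] h.
- by rewrite h.
- by rewrite h.
- by rewrite h.
- by rewrite h.
- by rewrite (_ : e = e1) //; char2_by h.
- by rewrite (_ : e = e1 + e2) //; char2_by h.
- by rewrite (_ : e = e1 + e3) //; char2_by h.
- by rewrite (_ : e = e1 + e2 + e3) //; char2_by h.
Qed.

(** x vanishes on the line {e1 + e2, e1 + e3, e2 + e3} of the Fano plane, and
    e1, e2, e3, e4 are the four points off that line.  All permutations of the
    four points preserve the configuration. *)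
Definition frame x e1 e2 e3 e4 :=
  [/\ free [:: e1; e2; e3], e4 = e1 + e2 + e3 &
      [/\ x (e1 + e2) = 0, x (e1 + e3) = 0 & x (e2 + e3) = 0]].

Lemma frame_swap12 x e1 e2 e3 e4 : frame x e1 e2 e3 e4 -> frame x e2 e1 e3 e4.
Proof.
move=> [f -> [h1 h2 h3]]; split; [|by char2|by rewrite [e2 + e1]addrC].
by rewrite (perm_free (permEl (perm_catCA [:: e2] [:: e1] [:: e3]))).
Qed.

Lemma frame_swap23 x e1 e2 e3 e4 : frame x e1 e2 e3 e4 -> frame x e1 e3 e2 e4.
Proof.
move=> [f -> [h1 h2 h3]]; split; [|by char2|by rewrite [e3 + e2]addrC].
by move: f; rewrite !free3E; case/and5P => ? ? ? ? /and3P[? ? ?];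
   repeat (apply/andP; split); nonzero.
Qed.

Lemma frame_swap34 x e1 e2 e3 e4 : frame x e1 e2 e3 e4 -> frame x e1 e2 e4 e3.
Proof.
move=> [f -> [h1 h2 h3]]; split; [|by char2|].
  by move: f; rewrite !free3E; case/and5P => ? ? ? ? /and3P[? ? ?];
   repeat (apply/andP; split); nonzero.
rewrite (_ : e1 + (e1 + e2 + e3) = e2 + e3); last by char2.
by rewrite (_ : e2 + (e1 + e2 + e3) = e1 + e3); last by char2.
Qed.

Lemma frame_swap13 x e1 e2 e3 e4 : frame x e1 e2 e3 e4 -> frame x e3 e2 e1 e4.
Proof. by move=> /frame_swap12/frame_swap23/frame_swap12. Qed.

Lemma frame_swap24 x e1 e2 e3 e4 : frame x e1 e2 e3 e4 -> frame x e1 e4 e3 e2.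
Proof. by move=> /frame_swap23/frame_swap34/frame_swap23. Qed.

Lemma frame_swap14 x e1 e2 e3 e4 : frame x e1 e2 e3 e4 -> frame x e4 e2 e3 e1.
Proof. by move=> /frame_swap12/frame_swap24/frame_swap12. Qed.

(** The form phi |-> phi A x(phi) vanishes on the line, so it is additive exactly
    when it takes the same value at the four remaining points. *)
Lemma frame_mem S x e1 e2 e3 e4 A : critical S x -> frame x e1 e2 e3 e4 ->
  A \in S <-> [/\ qform A x e1 = qform A x e2, qform A x e1 = qform A x e3 &
                  qform A x e1 = qform A x e4].
Proof.
move=> cr [f ee [x12 x13 x23]]; subst e4.
have q0 e : x e = 0 -> qform A x e = 0.
  by move=> h; rewrite /qform h mulmx0 /pr mulmx0 mxE.
split=> [hA|[h2 h3 h4]].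
  have a12 := critical_additive e1 e2 cr hA; have a13 := critical_additive e1 e3 cr hA.
  have a1 := critical_additive (e1 + e2) e3 cr hA.
  have a123 : qform A x (e1 + e2 + e3) = qform A x e3 by rewrite a1 (q0 _ x12) add0r.
  rewrite (q0 _ x12) in a12; rewrite (q0 _ x13) in a13; rewrite a123.
  move: a12 a13; move: (qform _ _ _) (qform _ _ _) (qform _ _ _) => p q r h1 h2.
  by split; [char2_by h1|char2_by h2|char2_by h2].
apply: (critical_mem cr).
have [y [y1 y2 y3]] := dual3 1 1 1 f.
suff q e : qform A x e = qform A x e1 * pr e y.
  by move=> phi psi; rewrite (q phi) (q psi) q prDl mulrDr.
move: e; apply: (span3_ind f); rewrite ?prDl ?y1 ?y2 ?y3 ?addF2 ?add0r ?mulr1 ?mulr0.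
- by rewrite /qform /pr !mul0mx !mxE mulr0.
- reflexivity.
- exact: esym h2.
- exact: esym h3.
- exact: q0 x12.
- exact: q0 x13.
- exact: q0 x23.
- exact: esym h4.
Qed.

(** The values of x, up to a translation, lie in a plane; these are the
    configurations in which two columns carry all the information. *)
Definition planar n (x : 'rV['F_2]_n -> 'cV['F_2]_m) :=
  exists c u v, forall phi, phi != 0 -> x phi + c \in <<[:: u; v]>>%VS.

Lemma not_free3 (vT : vectType 'F_2) (a b c : vT) : ~~ free [:: a; b; c] ->
  exists u v : vT, [/\ a \in <<[:: u; v]>>%VS, b \in <<[:: u; v]>>%VS & c \in <<[:: u; v]>>%VS].
Proof.
have m1 (u v : vT) : u \in <<[:: u; v]>>%VS by rewrite memv_span ?mem_head.
have m2 (u v : vT) : v \in <<[:: u; v]>>%VS by rewrite memv_span // !inE eqxx orbT.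
rewrite free_cons negb_and negbK => /orP[ha|]; first by exists b, c.
rewrite free_cons negb_and negbK => /orP[hb|].
  by exists a, c; split => //; rewrite mem_span_cons hb.
rewrite seq1_free negbK => /eqP ->; exists a, b; split => //; exact: mem0v.
Qed.

Lemma frame_planar x e1 e2 e3 e4 u v : frame x e1 e2 e3 e4 ->
  [/\ x e1 \in <<[:: u; v]>>%VS, x e2 \in <<[:: u; v]>>%VS,
      x e3 \in <<[:: u; v]>>%VS & x e4 \in <<[:: u; v]>>%VS] -> planar x.
Proof.
move=> [f e [h12 h13 h23]] [h1 h2 h3 h4]; subst e4.
exists 0, u, v => phi; rewrite addr0.
by move: phi; apply: (span3_ind f); rewrite ?h12 ?h13 ?h23 ?mem0v // eqxx.
Qed.

(** Types 2, 4, 5, 6 and 7. *)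
Definition special S :=
  [\/ coprod_type S (sym_mx 3), coprod_type S G3, coprod_type S H3 | coprod_type S I3]
  \/ coprod_type S H4.

(** If x(e1) = 0 the defects of e1 with the other points put every
    x(phi) (x) phi in the annihilator. *)
Lemma frame_nonzero S x e1 e2 e3 e4 : critical S x -> frame x e1 e2 e3 e4 -> x e1 <> 0.
Proof.
move=> [hx nl _] [f e [h12 h13 h23]] x1; apply: nl; exists 0 => phi _; rewrite addr0.
have d a b := hx a b (memvf _) (memvf _).
move: phi; apply: (span3_ind f); rewrite ?mulmx0 ?x1 ?h12 ?h13 ?h23 ?mul0mx ?mem0v //.
- by have := d e1 e2; rewrite /defect x1 h12 !mul0mx add0r addr0.
- by have := d e1 e3; rewrite /defect x1 h13 !mul0mx add0r addr0.
- have := d e1 (e1 + e2 + e3); rewrite /defect x1.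
  rewrite (_ : e1 + (e1 + e2 + e3) = e2 + e3); last by char2.
  by rewrite h23 !mul0mx add0r addr0.
Qed.

Ltac combine h2 h3 h4 :=
  first [ reflexivity | char2 | char2_by h2 | char2_by h3 | char2_by h4
        | char2_by (addeq h2 h3) | char2_by (addeq h2 h4) | char2_by (addeq h3 h4)
        | char2_by (addeq h2 (addeq h3 h4)) ].

(** The relation x(e1) = x(e2) is the only one in the generic case, which gives
    G3 in the rows (e3, e1 + e2, e1) and the columns (x(e1), x(e4), x(e3)). *)
Lemma frame_eq S x e1 e2 e3 e4 : critical S x -> frame x e1 e2 e3 e4 ->
  x e1 = x e2 -> planar x \/ special S.
Proof.
move=> cr fr x12.
have [fx|] := boolP (free [:: x e1; x e4; x e3]); last first.
  move=> /not_free3[u [v [? ? ?]]]; left; apply: (frame_planar (u := u) (v := v) fr).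
  by split; rewrite // -x12.
right; left; constructor 2.
have ff : free [:: e3; e1 + e2; e1].
  have [f _ _] := fr; move: f; rewrite !free3E; case/and5P => ? ? ? ? /and3P[? ? ?];
   repeat (apply/andP; split); nonzero.
apply: (coprod_type_intro (s := [:: x e1; x e4; x e3]) ff fx) => A.
apply/idP/idP.
  move=> /(frame_mem A cr fr); rewrite /qform -x12 => hh.
  rewrite inE.
  apply/existsP; exists (pr e3 (A *m x e1)).
  apply/existsP; exists (pr e3 (A *m x e3)).
  apply/existsP; exists (pr e3 (A *m x e4)).
  apply/existsP; exists (pr e1 (A *m x e4)).
  apply/existsP; exists (pr (e1 + e2) (A *m x e3)).
  apply/existsP; exists (pr e1 (A *m x e3)).
  apply/eqP/stack_eq3.
  case: (fr) hh => _ e4E _; rewrite e4E; move: (x (e1 + e2 + e3)) => y4.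
  rewrite !(mulmxDr, prDr, prDl); gen_pr => -[h2 h3 h4].
  by split; split; combine h2 h3 h4.
rewrite inE.
case/existsP=> a /existsP[b] /existsP[c] /existsP[d] /existsP[g] /existsP[f] /eqP/stack_eq3.
case: (fr) => _ e4E _; rewrite e4E => -[[E11 E12 E13] [E21 E22 E23] [E31 E32 E33]].
apply/(frame_mem A cr fr); rewrite /qform -x12 e4E.
move: E11 E12 E13 E21 E22 E23 E31 E32 E33; rewrite !prDl; gen_pr.
move=> E11 E12 E13 E21 E22 E23 E31 E32 E33; split.
- char2_by E21.
- char2_by (addeq E13 E31).
- char2_by (addeq E22 (addeq E31 E12)).
Qed.

(** Generic case of the relation x(e3) = x(e1) + x(e2): I3 in the rows
    (e1 + e3, e2 + e3, e3) and the columns (x(e1), x(e2), x(e4)). *)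
Lemma frame_line S x e1 e2 e3 e4 : critical S x -> frame x e1 e2 e3 e4 ->
  x e3 = x e1 + x e2 -> planar x \/ special S.
Proof.
move=> cr fr x3.
have [fx|] := boolP (free [:: x e1; x e2; x e4]); last first.
  move=> /not_free3[u [v [? ? ?]]]; left; apply: (frame_planar (u := u) (v := v) fr).
  by split; rewrite ?x3 ?memvD.
right; left; constructor 4.
have ff : free [:: e1 + e3; e2 + e3; e3].
  have [f _ _] := fr; move: f; rewrite !free3E; case/and5P => ? ? ? ? /and3P[? ? ?];
   repeat (apply/andP; split); nonzero.
apply: (coprod_type_intro (s := [:: x e1; x e2; x e4]) ff fx) => A.
apply/idP/idP.
  move=> /(frame_mem A cr fr); rewrite /qform x3 => hh.
  rewrite inE.
  apply/existsP; exists (pr (e1 + e3) (A *m x e1)).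
  apply/existsP; exists (pr (e2 + e3) (A *m x e1)).
  apply/existsP; exists (pr e3 (A *m x e1)).
  apply/existsP; exists (pr (e1 + e3) (A *m x e2)).
  apply/existsP; exists (pr (e1 + e3) (A *m x e4)).
  apply/existsP; exists (pr (e2 + e3) (A *m x e4)).
  apply/eqP/stack_eq3.
  case: (fr) hh => _ e4E _; rewrite e4E; move: (x (e1 + e2 + e3)) => y4.
  rewrite !(mulmxDr, prDr, prDl); gen_pr => -[h2 h3 h4].
  by split; split; combine h2 h3 h4.
rewrite inE.
case/existsP=> a /existsP[b] /existsP[c] /existsP[d] /existsP[g] /existsP[f] /eqP/stack_eq3.
case: (fr) => _ e4E _; rewrite e4E => -[[E11 E12 E13] [E21 E22 E23] [E31 E32 E33]].
apply/(frame_mem A cr fr); rewrite /qform x3 e4E.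
move: E11 E12 E13 E21 E22 E23 E31 E32 E33; rewrite !(mulmxDr, prDr, prDl); gen_pr.
move=> E11 E12 E13 E21 E22 E23 E31 E32 E33; split.
- char2_by (addeq (addeq E11 E32) (addeq E22 E31)).
- char2_by (addeq E11 E32).
- char2_by (addeq E33 (addeq (addeq E13 E23) (addeq E31 E11))).
Qed.

(** Generic case of the relation x(e4) = x(e1) + x(e2) + x(e3): H3 in the rows
    (e1 + e2, e1, e4) and the columns (x(e1) + x(e2), x(e2), x(e3)). *)
Lemma frame_sum S x e1 e2 e3 e4 : critical S x -> frame x e1 e2 e3 e4 ->
  x e4 = x e1 + x e2 + x e3 -> planar x \/ special S.
Proof.
move=> cr fr x4.
have [fx|] := boolP (free [:: x e1; x e2; x e3]); last first.
  move=> /not_free3[u [v [? ? ?]]]; left; apply: (frame_planar (u := u) (v := v) fr).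
  by split; rewrite ?x4 ?memvD.
right; left; constructor 3.
have ff : free [:: e1 + e2; e1; e4].
  have [f -> _] := fr; move: f; rewrite !free3E; case/and5P => ? ? ? ? /and3P[? ? ?];
   repeat (apply/andP; split); nonzero.
have fx' : free [:: x e1 + x e2; x e2; x e3].
  move: fx; move: (x e1) (x e2) (x e3) => ? ? ?.
  rewrite !free3E; case/and5P => ? ? ? ? /and3P[? ? ?];
   repeat (apply/andP; split); nonzero.
apply: (coprod_type_intro (s := [:: x e1 + x e2; x e2; x e3]) ff fx') => A.
apply/idP/idP.
  move=> /(frame_mem A cr fr); rewrite /qform x4 => hh; rewrite inE.
  apply/existsP; exists (pr (e1 + e2) (A *m (x e1 + x e2))).
  apply/existsP; exists (pr (e1 + e2) (A *m x e2)).
  apply/existsP; exists (pr (e1 + e2) (A *m x e3)).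
  apply/existsP; exists (pr e1 (A *m x e2)).
  apply/existsP; exists (pr e4 (A *m x e2)).
  apply/existsP; exists (pr e1 (A *m x e3)).
  apply/eqP/stack_eq3.
  case: (fr) hh => _ e4E _; rewrite e4E; move: (x (e1 + e2 + e3)) => y4.
  rewrite !(mulmxDr, prDr, prDl); gen_pr => -[h2 h3 h4].
  by split; split; combine h2 h3 h4.
rewrite inE.
case/existsP=> a /existsP[b] /existsP[c] /existsP[d] /existsP[g] /existsP[f] /eqP/stack_eq3.
case: (fr) => _ e4E _; rewrite e4E => -[[E11 E12 E13] [E21 E22 E23] [E31 E32 E33]].
apply/(frame_mem A cr fr); rewrite /qform x4 e4E.
move: E11 E12 E13 E21 E22 E23 E31 E32 E33; rewrite !(mulmxDr, prDr, prDl); gen_pr.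
move=> E11 E12 E13 E21 E22 E23 E31 E32 E33; split.
- char2_by (addeq E12 E21).
- char2_by (addeq (addeq E33 E21) (addeq E13 E22)).
- char2_by (addeq (addeq E33 E21) (addeq E31 E22)).
Qed.

(** Four independent values give H4 in the rows (e1, e2, e3) and the columns
    (x(e4), x(e1) + x(e4), x(e2) + x(e4), x(e3) + x(e4)). *)
Lemma frame_free S x e1 e2 e3 e4 : critical S x -> frame x e1 e2 e3 e4 ->
  free [:: x e1; x e2; x e3; x e4] -> special S.
Proof.
move=> cr fr fx; right.
have [ff e4E _] := fr.
have fx' : free [:: x e4; x e1 + x e4; x e2 + x e4; x e3 + x e4].
  move: fx; move: (x e1) (x e2) (x e3) (x e4) => ? ? ? ?.
  rewrite !(free3E, free4E); case/andP => /and5P[? ? ? ? /and3P[? ? ?]].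
  case/and5P => ? ? ? ? /and4P[? ? ? ?].
  repeat (apply/andP; split); nonzero.
apply: (coprod_type_intro (s := [:: x e4; x e1 + x e4; x e2 + x e4; x e3 + x e4]) ff fx') => A.
apply/idP/idP.
  move=> /(frame_mem A cr fr); rewrite /qform => hh.
  rewrite inE.
  apply/existsP; exists (pr e1 (A *m x e4)).
  apply/existsP; exists (pr e2 (A *m x e4)).
  apply/existsP; exists (pr e3 (A *m x e4)).
  apply/existsP; exists (pr e2 (A *m (x e1 + x e4))).
  apply/existsP; exists (pr e3 (A *m (x e1 + x e4))).
  apply/existsP; exists (pr e1 (A *m (x e2 + x e4))).
  apply/existsP; exists (pr e3 (A *m (x e2 + x e4))).
  apply/existsP; exists (pr e1 (A *m (x e3 + x e4))).
  apply/existsP; exists (pr e2 (A *m (x e3 + x e4))).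
  apply/eqP/stack_eq4.
  move: hh; rewrite e4E; move: (x (e1 + e2 + e3)) => y4.
  rewrite !(mulmxDr, prDr, prDl); gen_pr => -[h2 h3 h4].
  by split; split; combine h2 h3 h4.
rewrite inE.
case/existsP=> a /existsP[b] /existsP[c] /existsP[d] /existsP[g] /existsP[f] /existsP[h].
case/existsP=> i /existsP[j] /eqP/stack_eq4.
case=> -[E11 E12 E13 E14] [E21 E22 E23 E24] [E31 E32 E33 E34].
apply/(frame_mem A cr fr); rewrite /qform.
move: E11 E12 E13 E14 E21 E22 E23 E24 E31 E32 E33 E34; rewrite e4E.
move: (x (e1 + e2 + e3)) => y4.
rewrite !(mulmxDr, prDr, prDl); gen_pr.
move=> E11 E12 E13 E14 E21 E22 E23 E24 E31 E32 E33 E34; split.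
- char2_by (addeq (addeq E12 E21) (addeq E23 E11)).
- char2_by (addeq (addeq E12 E31) (addeq E34 E11)).
- char2_by (addeq E12 (addeq E21 E31)).
Qed.

(** When x is a linear map l, the condition on A reads
    phi A l(psi) = psi A l(phi), so A is symmetric in suitable bases. *)
Lemma affine_case S x e1 e2 e3 : critical S x -> free [:: e1; e2; e3] ->
  [/\ x (e1 + e2) = x e1 + x e2, x (e1 + e3) = x e1 + x e3,
      x (e2 + e3) = x e2 + x e3 & x (e1 + e2 + e3) = x e1 + x e2 + x e3] ->
  planar x \/ special S.
Proof.
move=> cr ff [x12 x13 x23 x123].
have [fx|] := boolP (free [:: x e1; x e2; x e3]); last first.
  move=> /not_free3[u [v [? ? ?]]]; left; exists 0, u, v => phi; rewrite addr0.
  by move: phi; apply: (span3_ind ff); rewrite ?x12 ?x13 ?x23 ?x123 ?eqxx // => _; rewrite ?memvD.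
right; left; constructor 1.
have SP A : (A \in S) <-> [/\ pr e1 (A *m x e2) = pr e2 (A *m x e1),
    pr e1 (A *m x e3) = pr e3 (A *m x e1) & pr e2 (A *m x e3) = pr e3 (A *m x e2)].
  split=> [hA|[h12 h13 h23]].
    have := critical_additive e1 e2 cr hA; have := critical_additive e1 e3 cr hA.
    have := critical_additive e2 e3 cr hA.
    rewrite /qform x12 x13 x23 !(mulmxDr, prDr, prDl); gen_pr => h1 h2 h3.
    by split; [char2_by h3|char2_by h2|char2_by h1].
  apply: (critical_mem cr).
  have [y1 [y11 y12 y13]] := dual3 1 0 0 ff.
  have [y2 [y21 y22 y23]] := dual3 0 1 0 ff.
  have [y3 [y31 y32 y33]] := dual3 0 0 1 ff.
  pose w := qform A x e1 *: y1 + qform A x e2 *: y2 + qform A x e3 *: y3.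
  have pw e : pr e w = qform A x e1 * pr e y1 + qform A x e2 * pr e y2 + qform A x e3 * pr e y3.
    by rewrite !prDr /pr -!scalemxAr !mxE.
  have w1 : pr e1 w = qform A x e1 by rewrite pw y11 y21 y31 !mulr0 !addr0 mulr1.
  have w2 : pr e2 w = qform A x e2 by rewrite pw y12 y22 y32 !mulr0 addr0 add0r mulr1.
  have w3 : pr e3 w = qform A x e3 by rewrite pw y13 y23 y33 !mulr0 !add0r mulr1.
  suff q e : qform A x e = pr e w by move=> phi psi; rewrite (q phi) (q psi) q prDl.
  move: e; apply: (span3_ind ff); rewrite ?prDl ?w1 ?w2 ?w3.
  - by rewrite /qform /pr !mul0mx !mxE.
  - reflexivity.
  - reflexivity.
  - reflexivity.
  - rewrite /qform x12 !(mulmxDr, prDr, prDl); move: h12 h13 h23; gen_pr => h12 h13 h23; char2_by h12.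
  - rewrite /qform x13 !(mulmxDr, prDr, prDl); move: h12 h13 h23; gen_pr => h12 h13 h23; char2_by h13.
  - rewrite /qform x23 !(mulmxDr, prDr, prDl); move: h12 h13 h23; gen_pr => h12 h13 h23; char2_by h23.
  - rewrite /qform x123 !(mulmxDr, prDr, prDl); move: h12 h13 h23; gen_pr => h12 h13 h23.
    char2_by (addeq h12 (addeq h13 h23)).
apply: (coprod_type_intro (s := [:: x e1; x e2; x e3]) ff fx) => A.
have ent (i j : 'I_3) : (stack e1 e2 e3 *m A *m mx_of_cols [:: x e1; x e2; x e3]) i j =
  pr [:: e1; e2; e3]`_i (A *m [:: x e1; x e2; x e3]`_j) by exact: stack_entry.
apply/idP/idP.
  move=> /SP[h12 h13 h23]; rewrite inE; apply/eqP/matrixP.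
  have i2 := @inordK 2 2 isT.
  by apply: forall_I3; apply: forall_I3; rewrite mxE !ent /= ?i2 ?h12 ?h13 ?h23; reflexivity.
rewrite inE => /eqP/matrixP h; apply/SP; split.
- by have := h 1 0; rewrite mxE !ent.
- by have := h (inord 2) 0; rewrite mxE !ent /= !inordK.
- by have := h (inord 2) 1; rewrite mxE !ent /= !inordK.
Qed.

End DimThreeTypes.

(** * Three rows: the classification *)

Section DimThreeMain.
Variable m : nat.
Implicit Types (S : {vspace 'M['F_2]_(3, m)}) (A : 'M['F_2]_(3, m)).
Implicit Types (x : 'rV['F_2]_3 -> 'cV['F_2]_m) (e : 'rV['F_2]_3).

(** The four values are independent or satisfy one of fifteen relations, which
    form four orbits under permutation of the four points. *)
Lemma frame_case S x e1 e2 e3 e4 : critical S x -> frame x e1 e2 e3 e4 ->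
  planar x \/ special S.
Proof.
move=> cr fr.
have [f|nf] := boolP (free [:: x e1; x e2; x e3; x e4]).
  by right; exact: frame_free cr fr f.
have s12 := frame_swap12 fr; have s13 := frame_swap13 fr; have s14 := frame_swap14 fr.
have s23 := frame_swap23 fr; have s24 := frame_swap24 fr; have s34 := frame_swap34 fr.
have z1 := frame_nonzero cr fr; have z2 := frame_nonzero cr s12.
have z3 := frame_nonzero cr s13; have z4 := frame_nonzero cr s14.
move: nf; rewrite free4E free3E !negb_and !negbK.
case/orP.
  case/or4P=> [/eqP h|/eqP h|/eqP h|]; [by case: z1|by case: z2|by case: z3|].
  case/or4P=> /eqP h.
  - by apply: (frame_eq cr fr); char2_by h.
  - by apply: (frame_eq cr s23); char2_by h.
  - by apply: (frame_eq cr s13); char2_by h.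
  - by apply: (frame_line cr fr); char2_by h.
case/or4P=> [/eqP h|/eqP h|/eqP h|]; first by case: z4.
- by apply: (frame_eq cr s24); char2_by h.
- by apply: (frame_eq cr s14); char2_by h.
case/orP=> [/eqP h|]; first by apply: (frame_eq cr (frame_swap13 s24)); char2_by h.
case/or4P=> /eqP h.
- by apply: (frame_line cr s34); char2_by h.
- by apply: (frame_line cr (frame_swap34 s23)); char2_by h.
- by apply: (frame_line cr s14); char2_by h.
- by apply: (frame_sum cr fr); char2_by h.
Qed.

Lemma planar_shift n (x : 'rV['F_2]_n -> 'cV['F_2]_m) c :
  planar (fun phi => x phi + c) -> planar x.
Proof. by move=> [d [u [v h]]]; exists (c + d), u, v => phi /h; rewrite addrA. Qed.

(** If x is constant on a line, translating the constant to 0 gives a frame on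
    the four points off the line. *)
Lemma line_case S x c a b ab g : critical S x -> ab = a + b ->
  free [:: a; b; g] -> x a = c -> x b = c -> x ab = c -> planar x \/ special S.
Proof.
move=> cr -> f xa xb xab.
have cr' := critical_shift (shift_equiv_const _ _ x c) cr.
have fr : frame (fun phi => x phi + c) g (g + a) (g + b) (g + (g + a) + (g + b)).
  split => //.
    move: f; rewrite !free3E; case/and5P => ? ? ? ? /and3P[? ? ?];
    repeat (apply/andP; split); nonzero.
  split; [rewrite (_ : g + (g + a) = a)|rewrite (_ : g + (g + b) = b)
         |rewrite (_ : g + a + (g + b) = a + b)]; try char2; by rewrite ?xa ?xb ?xab add_self.
by have [p|p] := frame_case cr' fr; [left; exact: planar_shift p|right].
Qed.

(** The complement of a line is where some y takes the value 1, so x cannot be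
    constant there. *)
Lemma affine_plane_case S x c p1 p2 p3 p4 : critical S x -> p4 = p1 + p2 + p3 ->
  free [:: p1; p2; p3] -> x p1 = c -> x p2 = c -> x p3 = c -> x p4 = c -> False.
Proof.
move=> [hx nl _] -> f x1 x2 x3 x4; apply: nl.
have [q [q1 q2 q3]] := dual3 1 1 1 f.
apply: (local_const (y := q) (c := c) hx); first by exists p1; rewrite ?memvf.
move=> phi _; move: phi; apply: (span3_ind f) => //; rewrite ?prDl ?q1 ?q2 ?q3 ?addF2.
- by rewrite /pr mul0mx mxE.
all: by move=> h.
Qed.

(** The space of sets of nonzero rows with zero sum is the Hamming code of length
    seven, of dimension four, while the annihilator has dimension three.  So
    some nonzero word C satisfies sum_(phi in C) x(phi) (x) phi = 0; it is a
    line, the complement of a line, or everything, and comparing coefficients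
    shows that x is constant on C in the first two cases and affine in the
    third. *)
Lemma dim_three S x e1 e2 e3 : critical S x -> free [:: e1; e2; e3] ->
  planar x \/ special S.
Proof.
move=> cr ff; have [hx nl dW] := cr.
have [y1 [p11 p21 p31]] := dual3 1 0 0 ff.
have [y2 [p12 p22 p32]] := dual3 0 1 0 ff.
have [y3 [p13 p23 p33]] := dual3 0 0 1 ff.
have dW3 : \dim (annihilator S) = 3%N by lia.
have DW a b := hx a b (memvf _) (memvf _).
have pair a b ya yb yc : pr a ya = 1 -> pr b ya = 0 -> pr a yb = 0 -> pr b yb = 1 ->
    pr a yc = 0 -> pr b yc = 0 -> exists2 D, D \in annihilator S &
    [/\ D *m ya = x a + x (a + b), D *m yb = x b + x (a + b) & D *m yc = 0].
  move=> aa ba ab bb ac bc; exists (defect x a b); first exact: DW.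
  rewrite /defect !mulmxDl !tensor_eval !prDl aa ba ab bb ac bc !addr0 !add0r.
  by rewrite !scale1r !scale0r !addr0 !add0r.
have [D12 W12 [A1 A2 A3]] := pair e1 e2 y1 y2 y3 p11 p21 p12 p22 p13 p23.
have [D13 W13 [B1 B3 B2]] := pair e1 e3 y1 y3 y2 p11 p31 p13 p33 p12 p32.
have [D23 W23 [C2 C3 C1]] := pair e2 e3 y2 y3 y1 p22 p32 p23 p33 p21 p31.
have [D W123 [D1 D2 D3]] : exists2 D, D \in annihilator S & [/\ D *m y1 = x e1 + x (e1 + e2 + e3),
    D *m y2 = x e2 + x (e1 + e2 + e3) & D *m y3 = x e3 + x (e1 + e2 + e3)].
  exists (defect x e1 e2 + defect x (e1 + e2) e3); first exact: memvD.
  rewrite /defect !mulmxDl !tensor_eval !prDl p11 p12 p13 p21 p22 p23 p31 p32 p33.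
  by rewrite !addr0 !add0r !scale1r !scale0r !addr0 !add0r; split; char2.
have {DW pair} : ~~ free [:: D12; D13; D23; D].
  apply/negP => f; have := @free_size_dim _ _ (annihilator S) f.
  rewrite dW3 => /(_ _)/negP; apply => //.
  by move=> z; rewrite !inE => /or4P[] /eqP->.
have eqs N : N = 0 -> [/\ N *m y1 = 0, N *m y2 = 0 & N *m y3 = 0].
  by move=> ->; rewrite !mul0mx.
have rew := (A1, A2, A3, B1, B2, B3, C1, C2, C3, D1, D2, D3).
move: (ff); rewrite free3E; case/and5P => n1 n2 n3 n12 /and3P[n13 n23 n123].
rewrite free4E free3E !negb_and !negbK.
have line a b g : free [:: a; b; g] -> x b = x a -> x (a + b) = x a ->
    planar x \/ special S.
  by move=> f xb xab; apply: (@line_case S x (x a) a b (a + b) g).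
have plane p1 p2 p3 p4 : p4 = p1 + p2 + p3 -> free [:: p1; p2; p3] ->
    x p2 = x p1 -> x p3 = x p1 -> x p4 = x p1 -> planar x \/ special S.
  by move=> e f h2 h3 h4; case: (@affine_plane_case S x (x p1) p1 p2 p3 p4).
have r12 : e1 + e2 + (e1 + e3) = e2 + e3 by char2.
have r23 : e3 + (e1 + e2) = e1 + e2 + e3 by char2.
have r13 : e2 + (e1 + e3) = e1 + e2 + e3 by char2.
have r1 : e1 + (e2 + e3) = e1 + e2 + e3 by char2.
have [x1 hx1] : exists y, x e1 = y by eexists.
have [x2 hx2] : exists y, x e2 = y by eexists.
have [x3 hx3] : exists y, x e3 = y by eexists.
have [x12 hx12] : exists y, x (e1 + e2) = y by eexists.
have [x13 hx13] : exists y, x (e1 + e3) = y by eexists.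
have [x23 hx23] : exists y, x (e2 + e3) = y by eexists.
have [x123 hx123] : exists y, x (e1 + e2 + e3) = y by eexists.
pose xs := (hx1, hx2, hx3, hx12, hx13, hx23, hx123).
case/orP.
  case/or4P.
  - (* support: the line {e1, e2, e1 + e2} *)
    move=> /eqP/eqs; rewrite !rew !xs => -[E1 E2 E3].
    apply: (line e1 e2 e3 ff); rewrite !xs; [char2_by (addeq E1 E2)|char2_by E1].
  - (* support: the line {e1, e3, e1 + e3} *)
    move=> /eqP/eqs; rewrite 9?mulmxDl !rew !xs => -[E1 E2 E3].
    apply: (line e1 e3 e2); first (rewrite free3E; repeat (apply/andP; split); nonzero).
      by rewrite !xs; char2_by (addeq E1 E3).
    by rewrite !xs; char2_by E1.
  - (* support: the line {e2, e3, e2 + e3} *)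
    move=> /eqP/eqs; rewrite 9?mulmxDl !rew !xs => -[E1 E2 E3].
    apply: (line e2 e3 e1); first (rewrite free3E; repeat (apply/andP; split); nonzero).
      by rewrite !xs; char2_by (addeq E2 E3).
    by rewrite !xs; char2_by E2.
  case/or4P.
  - (* support: {e2, e3, e1 + e2, e1 + e3}, the complement of a line *)
    move=> /eqP/eqs; rewrite 9?mulmxDl !rew !xs => -[E1 E2 E3].
    apply: (plane e2 e3 (e1 + e2) (e1 + e3)); first by char2.
    + by rewrite free3E; repeat (apply/andP; split); nonzero.
    + by rewrite !xs; char2_by (addeq E1 (addeq E2 E3)).
    + by rewrite !xs; char2_by E2.
    + by rewrite !xs; char2_by (addeq E1 E2).
  - (* support: {e1, e3, e1 + e2, e2 + e3}, the complement of a line *)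
    move=> /eqP/eqs; rewrite 9?mulmxDl !rew !xs => -[E1 E2 E3].
    apply: (plane e1 e3 (e1 + e2) (e2 + e3)); first by char2.
    + by rewrite free3E; repeat (apply/andP; split); nonzero.
    + by rewrite !xs; char2_by (addeq E1 (addeq E2 E3)).
    + by rewrite !xs; char2_by E1.
    + by rewrite !xs; char2_by (addeq E1 E2).
  - (* support: {e1, e2, e1 + e3, e2 + e3}, the complement of a line *)
    move=> /eqP/eqs; rewrite 9?mulmxDl !rew !xs => -[E1 E2 E3].
    apply: (plane e1 e2 (e1 + e3) (e2 + e3)); first by char2.
    + by rewrite free3E; repeat (apply/andP; split); nonzero.
    + by rewrite !xs; char2_by (addeq E1 (addeq E2 E3)).
    + by rewrite !xs; char2_by E1.
    + by rewrite !xs; char2_by (addeq E1 E3).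
  - (* support: the line {e1 + e2, e1 + e3, e2 + e3} *)
    move=> /eqP/eqs; rewrite 9?mulmxDl !rew !xs => -[E1 E2 E3].
    apply: (line (e1 + e2) (e1 + e3) e1); rewrite ?r12.
    + by rewrite free3E; repeat (apply/andP; split); nonzero.
    + by rewrite !xs; char2_by E1.
    + by rewrite !xs; char2_by E2.
case/or4P.
- (* support: {e1, e2, e3, e1 + e2 + e3}, the complement of a line *)
  move=> /eqP/eqs; rewrite 9?mulmxDl !rew !xs => -[E1 E2 E3].
  apply: (plane e1 e2 e3 (e1 + e2 + e3)) => //; rewrite !xs.
  + by char2_by (addeq E1 E2).
  + by char2_by (addeq E1 E3).
  + by char2_by E1.
- (* support: the line {e3, e1 + e2, e1 + e2 + e3} *)
  move=> /eqP/eqs; rewrite 9?mulmxDl !rew !xs => -[E1 E2 E3].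
  apply: (line e3 (e1 + e2) e1); rewrite ?r23.
  + by rewrite free3E; repeat (apply/andP; split); nonzero.
  + by rewrite !xs; char2_by (addeq E1 E3).
  + by rewrite !xs; char2_by E3.
- (* support: the line {e2, e1 + e3, e1 + e2 + e3} *)
  move=> /eqP/eqs; rewrite 9?mulmxDl !rew !xs => -[E1 E2 E3].
  apply: (line e2 (e1 + e3) e1); rewrite ?r13.
  + by rewrite free3E; repeat (apply/andP; split); nonzero.
  + by rewrite !xs; char2_by (addeq E1 E2).
  + by rewrite !xs; char2_by E2.
case/orP.
  (* support: the line {e1, e2 + e3, e1 + e2 + e3} *)
  move=> /eqP/eqs; rewrite 9?mulmxDl !rew !xs => -[E1 E2 E3].
  apply: (line e1 (e2 + e3) e2); rewrite ?r1.
  + by rewrite free3E; repeat (apply/andP; split); nonzero.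
  + by rewrite !xs; char2_by (addeq E1 E2).
  + by rewrite !xs; char2_by E1.
case/or4P.
- (* support: {e1, e1 + e2, e1 + e3, e1 + e2 + e3}, the complement of a line *)
  move=> /eqP/eqs; rewrite 9?mulmxDl !rew !xs => -[E1 E2 E3].
  apply: (plane e1 (e1 + e2) (e1 + e3) (e1 + e2 + e3)); first by char2.
  + by rewrite free3E; repeat (apply/andP; split); nonzero.
  + by rewrite !xs; char2_by (addeq E1 E3).
  + by rewrite !xs; char2_by (addeq E1 E2).
  + by rewrite !xs; char2_by (addeq E1 (addeq E2 E3)).
- (* support: {e2, e1 + e2, e2 + e3, e1 + e2 + e3}, the complement of a line *)
  move=> /eqP/eqs; rewrite 9?mulmxDl !rew !xs => -[E1 E2 E3].
  apply: (plane e2 (e1 + e2) (e2 + e3) (e1 + e2 + e3)); first by char2.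
  + by rewrite free3E; repeat (apply/andP; split); nonzero.
  + by rewrite !xs; char2_by (addeq E2 E3).
  + by rewrite !xs; char2_by (addeq E1 E2).
  + by rewrite !xs; char2_by (addeq E1 (addeq E2 E3)).
- (* support: {e3, e1 + e3, e2 + e3, e1 + e2 + e3}, the complement of a line *)
  move=> /eqP/eqs; rewrite 9?mulmxDl !rew !xs => -[E1 E2 E3].
  apply: (plane e3 (e1 + e3) (e2 + e3) (e1 + e2 + e3)); first by char2.
  + by rewrite free3E; repeat (apply/andP; split); nonzero.
  + by rewrite !xs; char2_by (addeq E2 E3).
  + by rewrite !xs; char2_by (addeq E1 E3).
  + by rewrite !xs; char2_by (addeq E1 (addeq E2 E3)).
(* support: all seven points; [c] is the value at 0 of the affine extension of x *)
move=> /eqP/eqs; rewrite 9?mulmxDl !rew !xs => -[E1 E2 E3].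
pose c := x1 + x2 + x12.
have cr' := critical_shift (shift_equiv_const _ _ x c) cr.
have [|p|p] := affine_case cr' ff; last by right.
  split; rewrite /= !xs /c.
  + by char2.
  + by char2_by (addeq E2 E3).
  + by char2_by (addeq E1 E3).
  + by char2_by (addeq E1 (addeq E2 E3)).
by left; exact: planar_shift p.
Qed.

End DimThreeMain.

(** * Planar configurations: four subspaces covering a space of dimension three *)

Lemma pigeonhole (T : eqType) (s : seq T) k (R : T -> 'I_k -> Prop) :
  (k < size s)%N -> uniq s -> {in s, forall a, exists j, R a j} ->
  exists a b j, [/\ a \in s, b \in s, a != b, R a j & R b j].
Proof.
move=> hk us hR.
have /fin_all_exists[f hf] : forall i : 'I_(size s), exists j, R (tnth (in_tuple s) i) j.
  by move=> i; apply: hR; exact: mem_tnth.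
have /injectivePn[i [j nij eij]] : ~~ injectiveb f.
  by apply/injectiveP => /leq_card; rewrite !card_ord leqNgt hk.
exists (tnth (in_tuple s) i), (tnth (in_tuple s) j), (f i); split.
- exact: (mem_tnth i (in_tuple s)).
- exact: (mem_tnth j (in_tuple s)).
- by have x0 : T := tnth (in_tuple s) i; rewrite !(tnth_nth x0) nth_uniq.
- exact: hf.
- by rewrite eij; exact: hf.
Qed.

Section RankTwo.
Variables (m n : nat).
Implicit Types (S : {vspace 'M['F_2]_(n, m)}) (A B : 'M['F_2]_(n, m)).
Implicit Types (x : 'rV['F_2]_n -> 'cV['F_2]_m) (phi : 'rV['F_2]_n) (y : 'cV['F_2]_m).

Lemma span_separates (X : seq 'cV['F_2]_n) w : w \notin <<X>>%VS ->
  exists phi, pr phi w = 1 /\ {in X, forall z, pr phi z = 0}.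
Proof.
move=> hw; set Y := vbasis <<X>>%VS.
have f : free (w :: Y) by rewrite free_cons (basis_free (vbasisP _)) (span_basis (vbasisP _)) hw.
have [r hr] := free_dual (fun i => (i == 0)%:R) f.
exists r; split; first by rewrite pr_trace mxtrace_mulC (hr 0%N).
move=> z /memv_span/coord_vbasis ->; rewrite pr_trace mulmx_sumr raddf_sum big1 // => i _.
rewrite -scalemxAr /= mxtraceZ mxtrace_mulC.
have hi : (i.+1 < size (w :: Y))%N by rewrite /= ltnS size_tuple.
by have /= -> := hr _ hi; rewrite mulr0.
Qed.

(** The range-compatible map sends A to A y. *)
Definition acts_as x A y := forall phi, qform A x phi = pr phi (A *m y).

Lemma qformD A B x phi : qform (A + B) x phi = qform A x phi + qform B x phi.
Proof. by rewrite /qform mulmxDl prDr. Qed.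

Lemma acts_asD x A B y : acts_as x A y -> acts_as x B y -> acts_as x (A + B) y.
Proof. by move=> hA hB phi; rewrite qformD hA hB mulmxDl prDr. Qed.

Lemma acts_as_add x A y d : acts_as x A y -> acts_as x A (y + d) <-> A *m d = 0.
Proof.
move=> h; split=> [k|k phi]; last by rewrite h mulmxDr k addr0.
apply: pr_eq0 => phi; have := k phi; rewrite h mulmxDr prDr.
by move: (pr _ _) (pr _ _) => a b e; char2_by e.
Qed.

(** A row killing A u and A v kills A x(phi) for all phi, so the value of the
    range-compatible map at A lies in the span of A u and A v. *)
Lemma acts_as_exists S x A u v : critical S x ->
  (forall phi, phi != 0 -> x phi \in <<[:: u; v]>>%VS) -> A \in S ->
  exists2 y, y \in <<[:: u; v]>>%VS & acts_as x A y.
Proof.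
move=> cr hx hA.
have [w hw] := linform_trace (fun phi psi => critical_additive phi psi cr hA).
have {}hw phi : qform A x phi = pr phi w by rewrite hw pr_trace.
have : w \in <<[:: A *m u; A *m v]>>%VS.
  apply: contraT => /span_separates[phi [h1 h2]].
  have hu : pr phi (A *m u) = 0 by apply: h2; rewrite mem_head.
  have hv : pr phi (A *m v) = 0 by apply: h2; rewrite !inE eqxx orbT.
  have := hw phi; rewrite h1 /qform.
  have pz : pr phi (A *m 0) = 0 by rewrite mulmx0 /pr mulmx0 mxE.
  case: (mem_span2 (hx _ (pr1_neq0 h1))) => ->; rewrite ?mulmxDr ?prDr ?pz ?hu ?hv ?addr0;
  by move/eqP; rewrite eq_sym oner_eq0.
have uv : u \in <<[:: u; v]>>%VS by rewrite memv_span ?mem_head.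
have vu : v \in <<[:: u; v]>>%VS by rewrite memv_span // !inE eqxx orbT.
case/mem_span2 => e.
- by exists 0; rewrite ?mem0v // => phi; rewrite hw e mulmx0.
- by exists u => // phi; rewrite hw e.
- by exists v => // phi; rewrite hw e.
- by exists (u + v); rewrite ?memvD // => phi; rewrite hw e mulmxDr.
Qed.

Lemma acts_as_local S x y : critical S x -> ~ (forall A, A \in S -> acts_as x A y).
Proof.
move=> [_ nl _] h; apply: nl; exists y => phi _; apply/annihilatorP => A hA.
by rewrite mulmxDl mulmxDr mxtraceD !trace_tensor -/(qform A x phi) (h A hA) addF2.
Qed.

Lemma planar_free S x u v : critical S x ->
  (forall phi, phi != 0 -> x phi \in <<[:: u; v]>>%VS) -> free [:: u; v].
Proof.
move=> [hx nl _] hu; apply: contraT; rewrite free2E !negb_and !negbK => h; exfalso; apply: nl.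
have [q hq] : exists q, forall phi, phi != 0 -> x phi = 0 \/ x phi = q.
  case/or3P: h => /eqP e; [exists v|exists u|exists u] => phi /hu /mem_span2[] ->;
    rewrite ?e ?add0r ?addr0; by [left|right|left; reflexivity|right; char2_by e].
by apply: (local_two (c := 0) (q := q) hx) => phi _ /hq; rewrite add0r.
Qed.

Lemma kernel_sub S x u v A : critical S x ->
  (forall phi, phi != 0 -> x phi \in <<[:: u; v]>>%VS) ->
  A *m u = 0 -> A *m v = 0 -> A \in S.
Proof.
move=> cr hx hu hv; apply: (critical_mem cr).
suff q phi : qform A x phi = 0 by move=> *; rewrite !q addr0.
have [->|p0] := eqVneq phi 0; first by rewrite /qform /pr mul0mx mxE.
rewrite /qform; case: (mem_span2 (hx _ p0)) => ->;
by rewrite ?mulmxDr ?hu ?hv ?mulmx0 ?addr0 /pr mulmx0 mxE.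
Qed.

Lemma mul_cols_eq0 k l (B : 'M['F_2]_(l, k)) (s : seq 'cV['F_2]_k) :
  B *m mx_of_cols s = 0 <-> {in s, forall z, B *m z = 0}.
Proof.
split=> [/matrixP h z /(nthP 0)[j hj <-]|h].
  apply/colP => i; rewrite [RHS]mxE -(mul_mx_of_cols B (Ordinal hj)) h mxE //.
apply/matrixP => i j; rewrite mul_mx_of_cols h ?mem_nth // !mxE //.
Qed.

Lemma left_inverse k (s : seq 'cV['F_2]_k) : free s -> exists L, L *m mx_of_cols s = 1%:M.
Proof.
move=> /complete_cols[p [C [Q [_ h]]]]; exists (usubmx Q).
by move: h; rewrite -{1}[Q]vsubmxK mul_col_row scalar_mx_block => /eq_block_mx[].
Qed.

(** S contains all operators vanishing at u and v, and its image in the pairs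
    (A u, A v) has dimension 2n - (2n - 3) = 3; G is a section of this image. *)
Lemma planar_dim3 S x u v : critical S x ->
  (forall phi, phi != 0 -> x phi \in <<[:: u; v]>>%VS) ->
  exists G : {vspace 'M['F_2]_(n, m)},
    [/\ (G <= S)%VS, \dim G = 3%N,
        forall A, A \in G -> A *m u = 0 -> A *m v = 0 -> A = 0 &
        forall A, A \in S -> exists2 B, B \in G & A *m u = B *m u /\ A *m v = B *m v].
Proof.
move=> cr hx; have [_ _ dW] := cr; have fuv := planar_free cr hx.
pose Y := mx_of_cols [:: u; v].
pose g : 'Hom('M['F_2]_(n, m), 'M['F_2]_(n, 2)) := linfun (mulmxr Y).
have gE A : g A = A *m Y by rewrite lfunE.
have kerP A : A \in lker g <-> A *m u = 0 /\ A *m v = 0.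
  rewrite memv_ker gE; split=> [/eqP e|[hu hv]].
    have h := proj1 (mul_cols_eq0 A [:: u; v]) e.
    by split; apply: h; rewrite !inE eqxx ?orbT.
  apply/eqP; apply: (proj2 (mul_cols_eq0 A [:: u; v])) => z.
  by rewrite !inE => /orP[] /eqP->.
have KS : (lker g <= S)%VS.
  by apply/subvP => A /kerP[hu hv]; exact: kernel_sub cr hx hu hv.
have [L hL] := left_inverse fuv.
have lg : limg g = fullv.
  apply/eqP; rewrite eqEsubv subvf /=; apply/subvP => B _.
  by apply/memv_imgP; exists (B *m L); rewrite ?memvf // gE -mulmxA hL mulmx1.
have d1 := limg_ker_dim g fullv; rewrite capfv lg in d1.
have d2 := dim_annihilator S.
have dM k l : \dim {: 'M['F_2]_(k, l)} = (k * l)%N by rewrite dimvf.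
rewrite !dM in d1.
exists (S :\: lker g)%VS; split.
- exact: diffvSl.
- have := dimv_cap_compl S (lker g).
  rewrite (capv_idPr KS) => d3.
  have : (m * n = n * m)%N by rewrite mulnC.
  move: d1 d2 d3 dW; move: (\dim (lker g)) (\dim (S :\: lker g)) (\dim S) (\dim (annihilator S)).
  move: (m * n)%N (n * m)%N => mn nm a b c d; lia.
- move=> A hA hu hv; apply/eqP; rewrite -memv0 -(capv_diff S (lker g)) memv_cap hA.
  by apply/kerP.
- move=> A; rewrite -{1}(addv_diff_cap S (lker g)) => /memv_addP[B hB [C hC ->]].
  exists B => //; move: hC; rewrite memv_cap => /andP[_ /kerP[hu hv]].
  by rewrite !mulmxDl hu hv !addr0.
Qed.

End RankTwo.

Section NormalForm.
Variables (m n : nat).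
Implicit Types (S : {vspace 'M['F_2]_(n, m)}) (A B : 'M['F_2]_(n, m)).
Implicit Types (x : 'rV['F_2]_n -> 'cV['F_2]_m) (phi : 'rV['F_2]_n) (y : 'cV['F_2]_m).

Lemma mem_span_l (vT : vectType 'F_2) (a b : vT) : a \in <<[:: a; b]>>%VS.
Proof. by rewrite memv_span ?mem_head. Qed.

Lemma mem_span_r (vT : vectType 'F_2) (a b : vT) : b \in <<[:: a; b]>>%VS.
Proof. by rewrite memv_span // !inE eqxx orbT. Qed.

Lemma span2_trans (vT : vectType 'F_2) (u v d1 d2 e : vT) :
  free [:: u; v] -> free [:: d1; d2] -> d1 \in <<[:: u; v]>>%VS ->
  d2 \in <<[:: u; v]>>%VS -> e \in <<[:: u; v]>>%VS -> e \in <<[:: d1; d2]>>%VS.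
Proof.
move=> fu fd h1 h2.
suff -> : <<[:: u; v]>>%VS = <<[:: d1; d2]>>%VS by [].
apply/esym/eqP; rewrite eqEdim (eqP (fu : free _)) (eqP (fd : free _)) leqnn andbT.
by apply/span_subvP => z; rewrite !inE => /orP[] /eqP->.
Qed.

Section Cover.
Variables (S : {vspace 'M['F_2]_(n, m)}) (x : 'rV['F_2]_n -> 'cV['F_2]_m).
Variables (u v : 'cV['F_2]_m) (G : {vspace 'M['F_2]_(n, m)}).
Hypothesis cr : critical S x.
Hypothesis hx : forall phi, phi != 0 -> x phi \in <<[:: u; v]>>%VS.
Hypothesis GS : (G <= S)%VS.
Hypothesis Ginj : forall A, A \in G -> A *m u = 0 -> A *m v = 0 -> A = 0.
Hypothesis Gsur : forall A, A \in S -> exists2 B, B \in G & A *m u = B *m u /\ A *m v = B *m v.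

Lemma cover_kernel A y : A *m u = 0 -> A *m v = 0 -> y \in <<[:: u; v]>>%VS -> acts_as x A y.
Proof.
move=> hu hv hy phi.
have z w : w \in <<[:: u; v]>>%VS -> A *m w = 0.
  by case/mem_span2 => ->; rewrite ?mulmxDr ?hu ?hv ?mulmx0 ?addr0.
rewrite /qform (z y hy); have [->|p0] := eqVneq phi 0; first by rewrite /pr !mul0mx.
by rewrite z // hx.
Qed.

Lemma cover_proper y : y \in <<[:: u; v]>>%VS -> ~ (forall A, A \in G -> acts_as x A y).
Proof.
move=> hy h; apply: (acts_as_local (y := y) cr) => A /Gsur[B BG [eu ev]].
rewrite (_ : A = B + (A + B)); last by char2.
apply: acts_asD; first exact: h.
by apply: cover_kernel; rewrite // mulmxDl ?eu ?ev add_self.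
Qed.

Lemma cover_class A : A \in G -> exists2 y, y \in <<[:: u; v]>>%VS & acts_as x A y.
Proof. by move=> /(subvP GS); exact: (acts_as_exists cr hx). Qed.

Lemma acts_span (X : seq 'M['F_2]_(n, m)) y : {in X, forall A, acts_as x A y} ->
  forall A, A \in <<X>>%VS -> acts_as x A y.
Proof.
elim: X => [|B X IH] h A.
  by rewrite span_nil memv0 => /eqP -> phi; rewrite /qform !mul0mx.
have hX : {in X, forall A, acts_as x A y} by move=> C hC; apply: h; rewrite inE hC orbT.
rewrite mem_span_cons => /orP[|k]; first exact: IH.
rewrite (_ : A = A + B + B); last by char2.
by apply: acts_asD; [exact: IH|apply: h; rewrite mem_head].
Qed.

(** In the pairs (A y1, A y2), S is spanned by (p, 0), (al, p) and (be, al). *)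
Definition normal_form y1 y2 (p al be : 'cV['F_2]_n) :=
  [/\ free [:: y1; y2], free [:: p; al] & forall A, A \in S <-> exists r s t : 'F_2,
    A *m y1 = r *: p + s *: al + t *: be /\ A *m y2 = s *: p + t *: al].

Lemma span3_lincomb (P : 'M['F_2]_(n, m) -> Prop) a b c :
  (forall r s t : 'F_2, P (r *: a + s *: b + t *: c)) ->
  forall A, A \in <<[:: a; b; c]>>%VS -> P A.
Proof.
move=> h A; rewrite !span_cons span_nil addv0.
by case/memv_addP=> ? /vlineP[r ->] [? /memv_addP[? /vlineP[s ->] [? /vlineP[t ->] ->]] ->]; rewrite addrA.
Qed.

(** The equations between the values of the range-compatible map at
    a, b, c, c + b, c + a + b give a d1 = 0, c d1 = c d2 + b d2 and
    c d2 = a d2 + b d1 + b d2.  Put p = a d2, al = b d1 and be = b d2: in the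
    pairs (A d2, A d1), a becomes (p, 0), a + b + c becomes (al, p) and b becomes
    (be, al). *)
Lemma cover_normal_form a b c y0 d1 d2 : <<[:: a; b; c]>>%VS = G -> free [:: a; b; c] ->
  y0 \in <<[:: u; v]>>%VS -> d1 \in <<[:: u; v]>>%VS -> d2 \in <<[:: u; v]>>%VS ->
  free [:: d1; d2] ->
  acts_as x a y0 -> acts_as x b y0 ->
  acts_as x c (y0 + d1) -> acts_as x (c + a) (y0 + d1) ->
  acts_as x (c + b) (y0 + d2) -> acts_as x (c + a + b) (y0 + (d1 + d2)) ->
  exists y1 y2 p al be, normal_form y1 y2 p al be.
Proof.
move=> sG f3 hy0 hd1 hd2 fd Ka Kb Kc Kca Kcb Kcab.
have fuv := planar_free cr hx.
have ad1 : a *m d1 = 0.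
  have Ka' : acts_as x a (y0 + d1).
    by rewrite (_ : a = c + (c + a)); [exact: acts_asD|char2].
  exact: (proj1 (acts_as_add d1 Ka) Ka').
have cd1 : c *m d1 = c *m d2 + b *m d2.
  have h : c *m (y0 + d1) + b *m y0 = (c + b) *m (y0 + d2).
    apply/eqP; rewrite -addmove; apply/eqP/pr_eq0 => phi.
    by rewrite !prDr -(Kc phi) -(Kb phi) -(Kcb phi) qformD addF2.
  by move: h; rewrite !(mulmxDl, mulmxDr) => h; char2_by h.
have cd2 : c *m d2 = a *m d2 + b *m d1 + b *m d2.
  have h : c *m (y0 + d1) + a *m y0 + b *m y0 = (c + a + b) *m (y0 + (d1 + d2)).
    apply/eqP; rewrite -addmove; apply/eqP/pr_eq0 => phi.
    by rewrite !prDr -(Kc phi) -(Ka phi) -(Kb phi) -(Kcab phi) !qformD addF2.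
  by move: h; rewrite !(mulmxDl, mulmxDr) ad1 => h; char2_by h.
have inj A : A \in G -> A *m d1 = 0 -> A *m d2 = 0 -> A = 0.
  move=> hA h1 h2; apply: Ginj => //;
   [have := span2_trans fuv fd hd1 hd2 (mem_span_l u v)|have := span2_trans fuv fd hd1 hd2 (mem_span_r u v)];
   by case/mem_span2 => ->; rewrite ?mulmxDr ?h1 ?h2 ?mulmx0 ?addr0.
have [aG bG cG] : [/\ a \in G, b \in G & c \in G].
  by rewrite -sG; split; apply: memv_span; rewrite !inE eqxx ?orbT.
have [a0 b0 c0] : [/\ a != 0, b != 0 & c != 0] by move: f3; rewrite free3E => /and5P[-> -> ->].
pose p := a *m d2; pose al := b *m d1; pose be := b *m d2.
have gen y : {in [:: a; b; c], forall A, acts_as x A y} -> y \in <<[:: u; v]>>%VS -> False.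
  by move=> h hy; apply: (cover_proper hy) => A; rewrite -sG; exact: acts_span.
have hd01 : y0 + d1 \in <<[:: u; v]>>%VS by rewrite memvD.
have Ka1 : acts_as x a (y0 + d1) by apply: (proj2 (acts_as_add d1 Ka)).
have fp : free [:: p; al].
  rewrite free2E; apply/and3P; split; apply/negP => /eqP e.
  - by case/negP: a0; rewrite (inj a aG ad1 e).
  - apply: (gen (y0 + d1)) => // z; rewrite !inE => /or3P[] /eqP-> //.
    by apply: (proj2 (acts_as_add d1 Kb)).
  - apply: (gen y0) => // z; rewrite !inE => /or3P[] /eqP-> //.
    have k : c *m d1 = 0 by rewrite cd1 cd2 -/p -/al; char2_by e.
    by have := proj2 (acts_as_add d1 Kc) k; rewrite (_ : y0 + d1 + d1 = y0) //; char2.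
exists d2, d1, p, al, be; split => //.
  by move: fd; rewrite !free2E [d2 + d1]addrC => /and3P[-> -> ->].
have vals r s t : (r *: a + s *: (a + b + c) + t *: b) *m d2 = r *: p + s *: al + t *: be /\
    (r *: a + s *: (a + b + c) + t *: b) *m d1 = s *: p + t *: al.
  rewrite !mulmxDl -!scalemxAl !mulmxDl cd1 cd2 ad1 -/p -/al -/be; split.
    by rewrite (_ : p + be + (p + al + be) = al) //; char2.
  rewrite scaler0 add0r (_ : 0 + al + (p + al + be + be) = p) //; char2.
have sG' : <<[:: a; (a + b + c)%R; b]>>%VS = G.
  rewrite -sG; apply/eqP; rewrite eqEsubv; apply/andP; split; apply/span_subvP => z;
   rewrite !inE => /or3P[] /eqP->; rewrite ?sG ?memvD //.
  - by apply: memv_span; rewrite !inE eqxx.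
  - by apply: memv_span; rewrite !inE eqxx !orbT.
  - have ec : c = a + (a + b + c) + b by char2.
    by rewrite [X in X \in _]ec; apply: memvD; [apply: memvD|]; apply: memv_span; rewrite !inE eqxx ?orbT.
move=> A; split=> [/Gsur[B BG [eu ev]]|[r [s [t [h1 h2]]]]].
  have ed d : d \in <<[:: u; v]>>%VS -> A *m d = B *m d.
    by case/mem_span2 => ->; rewrite ?mulmxDr ?eu ?ev ?mulmx0.
  rewrite !ed //; move: BG; rewrite -sG' => BG; move: B BG {ed eu ev}.
  by apply: span3_lincomb => r s t; exists r, s, t; exact: vals.
pose B := r *: a + s *: (a + b + c) + t *: b.
have BG : B \in G by rewrite !memvD // memvZ // !memvD.
have [k2 k1] := vals r s t.
rewrite (_ : A = (A + B) + B); last by char2.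
apply: memvD; last exact: (subvP GS).
have z d : d \in <<[:: u; v]>>%VS -> (A + B) *m d = 0.
  move=> /(span2_trans fuv fd hd1 hd2).
  have z1 : (A + B) *m d1 = 0 by rewrite mulmxDl h2 /B k1 add_self.
  have z2 : (A + B) *m d2 = 0 by rewrite mulmxDl h1 /B k2 add_self.
  by case/mem_span2 => ->; rewrite ?mulmxDr ?z1 ?z2 ?mulmx0 ?addr0.
by apply: (kernel_sub cr hx); apply: z; [exact: mem_span_l|exact: mem_span_r].
Qed.

(** G is covered by the four subspaces on which the map is A |-> A y, y in the
    plane of u and v, all of them proper.  Among five nonzero elements two
    share a subspace, which gives a plane <A, B>.  The four elements of its
    other coset lie in the three remaining subspaces, two of them in the same
    one; the last two are then forced into two further distinct subspaces. *)
Lemma cover_exists : \dim G = 3%N -> exists y1 y2 p al be, normal_form y1 y2 p al be.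
Proof.
move=> dG.
have fuv := planar_free cr hx; set D := <<[:: u; v]>>%VS.
have [|g1 G1 n1] := @exists_notin_span _ [::] G; first by rewrite dG.
rewrite span_nil memv0 in n1.
have f1 : free [:: g1] by rewrite seq1_free.
have [|g2 G2 n2] := @exists_notin_span _ [:: g1] G; first by rewrite dG.
have f2 : free [:: g1; g2] := free_rcons f1 n2.
have [|g3 G3 n3] := @exists_notin_span _ [:: g1; g2] G; first by rewrite dG.
have f3 : free [:: g1; g2; g3] := free_rcons f2 n3.
have uD := mem_span_l u v; have vD := mem_span_r u v.
pose R A (j : 'I_4) := acts_as x A (nth 0 [:: 0; u; v; u + v] j).
have [A [B [j [As Bs AB RA RB]]]] :
    exists a b j, [/\ a \in [:: g1; g2; g3; g1 + g2; g1 + g3], b \in [:: g1; g2; g3; g1 + g2; g1 + g3],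
       a != b, R a j & R b j].
  apply: pigeonhole => //.
    move: f3; rewrite free3E => /and5P[k1 k2 k3 k12 /and3P[k13 k23 k123]].
    have neq (p q : 'M['F_2]_(n, m)) : p + q != 0 -> (p == q) = false.
      by rewrite addmove => /negbTE.
    have e1 : (g1 == g1 + g2) = false by apply: neq; nonzero.
    have e2 : (g1 == g1 + g3) = false by apply: neq; nonzero.
    have e3 : (g2 == g1 + g2) = false by apply: neq; nonzero.
    have e4 : (g2 == g1 + g3) = false by apply: neq; nonzero.
    have e5 : (g3 == g1 + g2) = false by apply: neq; nonzero.
    have e6 : (g3 == g1 + g3) = false by apply: neq; nonzero.
    have e7 : (g1 + g2 == g1 + g3) = false by apply: neq; nonzero.
    by rewrite /= !inE e1 e2 e3 e4 e5 e6 e7 (neq _ _ k12) (neq _ _ k13) (neq _ _ k23).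
  move=> a ha.
  have aG : a \in G by move: ha; rewrite !inE => /or4P[/eqP->|/eqP->|/eqP->|/orP[] /eqP->]; rewrite ?memvD.
  have [y /mem_span2[] -> Ky] := cover_class aG.
  - by exists 0.
  - by exists 1.
  - by exists (inord 2); rewrite /R inordK.
  - by exists (inord 3); rewrite /R inordK.
rewrite /R in RA RB; set y0 := nth 0 _ j in RA RB.
have y0D : y0 \in D.
  rewrite /y0; case: (j : nat) (ltn_ord j) => [|[|[|[|//]]]] _ /=; rewrite ?mem0v ?memvD //.
have mem5 z : z \in [:: g1; g2; g3; g1 + g2; g1 + g3] -> z \in G /\ z != 0.
  move: f3; rewrite free3E => /and5P[k1 k2 k3 k12 /and3P[k13 k23 k123]].
  by rewrite !inE => /or4P[/eqP->|/eqP->|/eqP->|/orP[] /eqP->]; rewrite ?memvD.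
have [[AG A0] [BG B0]] := (mem5 _ As, mem5 _ Bs).
have fAB : free [:: A; B] by rewrite free2E A0 B0 addmove.
have [|C CG nC] := @exists_notin_span _ [:: A; B] G; first by rewrite dG.
have fABC : free [:: A; B; C] := free_rcons fAB nC.
have spanG a b c : free [:: a; b; c] -> [/\ a \in G, b \in G & c \in G] -> <<[:: a; b; c]>>%VS = G.
  move=> f [ha hb hc]; apply/eqP; rewrite eqEdim (eqP (f : free _)) dG leqnn andbT.
  by apply/span_subvP => z; rewrite !inE => /or3P[] /eqP->.
have gen y a b c : free [:: a; b; c] -> [/\ a \in G, b \in G & c \in G] -> y \in D ->
    acts_as x a y -> acts_as x b y -> acts_as x c y -> False.
  move=> f h hy ka kb kc; apply: (cover_proper hy) => Z; rewrite -(spanG _ _ _ f h).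
  by apply: acts_span => z; rewrite !inE => /or3P[] /eqP->.
have notK c : c \in G -> c \notin <<[:: A; B]>>%VS -> ~ acts_as x c y0.
  move=> hc nc kc; exact: (gen y0 A B c (free_rcons fAB nc)).
have cls c : c \in G -> c \notin <<[:: A; B]>>%VS ->
    exists2 d, [/\ d \in D, d != 0 & acts_as x c (y0 + d)] & [\/ d = u, d = v | d = u + v].
  move=> hc nc; have [y yD ky] := cover_class hc.
  exists (y0 + y).
    rewrite memvD // (_ : y0 + (y0 + y) = y); last by char2.
    split=> //; apply/negP => /eqP e; apply: (notK c hc nc).
    by have -> : y0 = y by char2_by e.
  have : y0 + y \in D by rewrite memvD.
  case/mem_span2 => e; [exfalso|by constructor 1|by constructor 2|by constructor 3].
  by apply: (notK c hc nc); have -> : y0 = y by char2_by e.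
pose R' c (i : 'I_3) := acts_as x c (y0 + nth 0 [:: u; v; u + v] i).
have memAB z : z \in <<[:: A; B]>>%VS -> z + C \notin <<[:: A; B]>>%VS.
  by move=> hz; rewrite rpredDl.
have [AS BS] := (mem_span_l A B, mem_span_r A B).
pose s := [:: 0 + C; A + C; B + C; A + B + C].
have sP z : z \in s -> z \in G /\ z + C \in <<[:: A; B]>>%VS.
  have cc w : w + C + C = w by char2.
  by rewrite !inE => /or4P[] /eqP->; rewrite cc; split; rewrite ?memvD ?mem0v.
have sN z : z \in s -> z \notin <<[:: A; B]>>%VS.
  by rewrite !inE => /or4P[] /eqP->; apply: memAB; rewrite ?memvD ?mem0v.
have [P [Q [i [Ps Qs PQ RP RQ]]]] : exists a b i, [/\ a \in s, b \in s, a != b, R' a i & R' b i].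
  apply: pigeonhole => //.
    have ne (p q r : 'M['F_2]_(n, m)) : (p + r == q + r) = (p == q) by rewrite (inj_eq (addIr r)).
    have eA : (0 == A) = false by rewrite eq_sym (negbTE A0).
    have eB : (0 == B) = false by rewrite eq_sym (negbTE B0).
    rewrite /= !inE !ne eA eB (negbTE AB) /=.
    have -> : (0 == A + B) = false by rewrite eq_sym addmove (negbTE AB).
    have -> : (A == A + B) = false.
      by rewrite -addmove (_ : A + (A + B) = B) ?(negbTE B0) //; char2.
    by rewrite -addmove (_ : B + (A + B) = A) ?(negbTE A0) //; char2.
  move=> z hz; have [zG _] := sP _ hz; have [d [_ _ kd] hd] := cls z zG (sN _ hz).
  case: hd kd => -> kd; [exists 0|exists 1|exists (inord 2)] => //; by rewrite /R' inordK.
rewrite /R' in RP RQ; set d1 := nth 0 _ i in RP RQ.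
have d1D : d1 \in D.
  by rewrite /d1; case: (i : nat) (ltn_ord i) => [|[|[|//]]] _ /=; rewrite ?memvD.
have [[PG PC] [QG QC]] := (sP _ Ps, sP _ Qs).
have [a ea] : exists a, a = P + Q by eexists.
have aS : a \in <<[:: A; B]>>%VS.
  have -> : a = P + C + (Q + C) by rewrite ea; char2.
  exact: memvD.
have a0 : a != 0 by rewrite ea addmove.
have [b bS fab] : exists2 b, b \in <<[:: A; B]>>%VS & free [:: a; b].
  have [e|ne] := eqVneq a A; [exists B|exists A] => //; first by rewrite e.
  by rewrite free2E a0 A0 addmove.
have KAB z : z \in <<[:: A; B]>>%VS -> acts_as x z y0.
  by apply: acts_span => w; rewrite !inE => /orP[] /eqP->.
have [Ka Kb] := (KAB _ aS, KAB _ bS).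
have nP : P \notin <<[:: a; b]>>%VS.
  apply: contra (sN _ Ps) => /mem_span2[] ->; rewrite ?mem0v ?memvD //.
have fabP : free [:: a; b; P] := free_rcons fab nP.
have sAB : (<<[:: A; B]>> <= G)%VS by apply/span_subvP => z; rewrite !inE => /orP[] /eqP->.
have [aG bG] := (subvP sAB _ aS, subvP sAB _ bS).
have iG : [/\ a \in G, b \in G & P \in G] by [].
have PaQ : P + a = Q by rewrite ea; char2.
have y0d1 : y0 + d1 \in D by rewrite memvD.
have Ka1 : acts_as x a (y0 + d1) by rewrite ea; exact: (acts_asD RP RQ).
have nPb : P + b \notin <<[:: A; B]>>%VS by rewrite rpredDr // sN.
have nQb : Q + b \notin <<[:: A; B]>>%VS by rewrite rpredDr // sN.
(* P and Q act through y0 + d1; the remaining elements of the coset are P + b and Q + b *)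
have [d2 [d2D d20 k2] _] := cls (P + b) (memvD PG bG) nPb.
have [d3 [d3D d30 k3] _] := cls (Q + b) (memvD QG bG) nQb.
have d10 : d1 != 0.
  apply/negP => /eqP e; apply: (notK P PG (sN _ Ps)).
  by have := RP; rewrite e addr0.
have fd : free [:: d1; d2].
  rewrite free2E d10 d20 addmove; apply/negP => /eqP e.
  apply: (gen (y0 + d1) a b P) => //.
  rewrite (_ : b = P + (P + b)); last by char2.
  by apply: acts_asD => //; rewrite e.
have k3' : acts_as x (P + a + b) (y0 + (d1 + d2)).
  rewrite PaQ.
  have := span2_trans fuv fd d1D d2D d3D; case/mem_span2 => e.
  - by rewrite e eqxx in d30.
  - exfalso; apply: (gen (y0 + d1) a b P) => //.
    rewrite (_ : b = Q + (Q + b)); last by char2.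
    by apply: acts_asD => //; rewrite -e.
  - exfalso; have Ka2 : acts_as x a (y0 + d2).
      rewrite (_ : a = (P + b) + (Q + b)); last by rewrite ea; char2.
      by apply: acts_asD => //; rewrite -e.
    have z1 := proj1 (acts_as_add _ Ka) Ka1; have z2 := proj1 (acts_as_add _ Ka) Ka2.
    have z d : d \in D -> a *m d = 0.
      move=> /(span2_trans fuv fd d1D d2D) /mem_span2[] ->;
      by rewrite ?mulmxDr ?z1 ?z2 ?mulmx0 ?addr0.
    by move: a0; rewrite (Ginj aG (z u uD) (z v vD)) eqxx.
  - by rewrite -e.
apply: (cover_normal_form (a := a) (b := b) (c := P) (y0 := y0) (d1 := d1) (d2 := d2)) => //.
- exact: spanG.
- by rewrite PaQ.
Qed.

End Cover.

End NormalForm.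

(** * From normal forms to types *)

Lemma forall_I2 (P : 'I_2 -> Prop) : P 0 -> P 1 -> forall i, P i.
Proof.
move=> h0 h1 [[|[|//]] hi].
- by rewrite (_ : Ordinal hi = 0) //; apply: val_inj.
- by rewrite (_ : Ordinal hi = 1) //; apply: val_inj.
Qed.

Section Vee.
Variables (m n : nat).
Implicit Types (S : {vspace 'M['F_2]_(n, m)}) (A B : 'M['F_2]_(n, m)).

(** S is determined by the columns ys, on which A takes values in the span of
    zs; completing ys and zs to bases gives the block form. *)
Lemma vee_rep S (ys : seq 'cV['F_2]_m) (zs : seq 'cV['F_2]_n)
    (M0 : {set 'M['F_2]_(size zs, size ys)}) :
  free ys -> free zs ->
  (forall A, A \in S <-> exists2 X, X \in M0 & A *m mx_of_cols ys = mx_of_cols zs *m X) ->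
  exists r p, mx_rep S (vee M0 [set: 'M['F_2]_(r, p)]).
Proof.
move=> fy fz hS.
have [p [C [Q' [q1 q2]]]] := complete_cols fy.
have [r [D [P [p1 p2]]]] := complete_cols fz.
exists r, p, P, (row_mx (mx_of_cols zs) D), (row_mx (mx_of_cols ys) C), Q'; split=> // A.
have Pz X : P *m (mx_of_cols zs *m X) = col_mx X 0.
  have -> : mx_of_cols zs *m X = row_mx (mx_of_cols zs) D *m col_mx X 0.
    by rewrite mul_row_col mulmx0 addr0.
  by rewrite mulmxA p2 mul1mx.
rewrite mul_mx_row inE; apply/idP/idP.
  move=> /hS[X hX e]; apply/existsP; exists X; rewrite hX /=.
  apply/existsP; exists (dsubmx (P *m A *m C)); rewrite inE /=.
  apply/existsP; exists (usubmx (P *m A *m C)).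
  by rewrite block_mxEh vsubmxK -mulmxA e Pz.
case/existsP=> X /andP[hX /existsP[B /andP[_ /existsP[Z /eqP]]]].
rewrite block_mxEh => /eq_row_mx[e _]; apply/hS; exists X => //.
have := congr1 (mulmx (row_mx (mx_of_cols zs) D)) e.
by rewrite -mulmxA mulmxA p1 mul1mx mul_row_col mulmx0 addr0.
Qed.

Lemma mul_cols2 A y1 y2 : A *m mx_of_cols [:: y1; y2] = mx_of_cols [:: A *m y1; A *m y2].
Proof.
apply/matrixP => i j; rewrite mul_mx_of_cols [RHS]mxE.
by case: j => [[|[|//]]].
Qed.

Lemma mx_of_cols2_inj k (a b c d : 'cV['F_2]_k) :
  mx_of_cols [:: a; b] = mx_of_cols [:: c; d] <-> a = c /\ b = d.
Proof.
split=> [/matrixP h|[-> ->]] //.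
by split; apply/colP => i; [have := h i 0|have := h i 1]; rewrite !mxE.
Qed.

Lemma cols3_V2 (p al be : 'cV['F_2]_n) r s t :
  mx_of_cols [:: p; al; be] *m mx_of_rows 3 2 [:: [:: r; s]; [:: s; t]; [:: t; 0]] =
  mx_of_cols [:: r *: p + s *: al + t *: be; s *: p + t *: al].
Proof.
apply/matrixP => i j; rewrite !mxE !big_ord_recl big_ord0 !mxE /=.
case: j => [[|[|//]]] hj; rewrite /= !mxE ?mulr0 !addr0.
  by rewrite ![_ * p _ _]mulrC ![_ * al _ _]mulrC ![_ * be _ _]mulrC addrA.
by rewrite ![_ * p _ _]mulrC ![_ * al _ _]mulrC.
Qed.

Lemma cols2_sym (p al : 'cV['F_2]_n) r s t :
  mx_of_cols [:: p; al] *m mx_of_rows 2 2 [:: [:: r; s]; [:: s; t]] =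
  mx_of_cols [:: r *: p + s *: al; s *: p + t *: al].
Proof.
apply/matrixP => i j; rewrite !mxE !big_ord_recl big_ord0 !mxE /=.
by case: j => [[|[|//]]] hj; rewrite /= !mxE !addr0 ![_ * p _ _]mulrC ![_ * al _ _]mulrC.
Qed.

Definition vee_type S k (M0 : {set 'M['F_2]_(k, 2)}) :=
  exists r p, mx_rep S (vee M0 [set: 'M['F_2]_(r, p)]).

Lemma sym2P (X : 'M['F_2]_2) : X \in sym_mx 2 <->
  exists r s t, X = mx_of_rows 2 2 [:: [:: r; s]; [:: s; t]].
Proof.
rewrite inE; split=> [/eqP h|[r [s [t ->]]]]; last first.
  by apply/eqP/matrixP => i j; rewrite !mxE; case: i j => [[|[|//]]] hi [[|[|//]]] hj.
exists (X 0 0), (X 0 1), (X 1 1); apply/matrixP.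
have e : X 1 0 = X 0 1 by rewrite -{1}h mxE.
by apply: forall_I2; apply: forall_I2; rewrite mxE /= ?e.
Qed.

Lemma sym2_type S y1 y2 (p al : 'cV['F_2]_n) : free [:: y1; y2] -> free [:: p; al] ->
  (forall A, A \in S <-> exists r s t : 'F_2,
    A *m y1 = r *: p + s *: al /\ A *m y2 = s *: p + t *: al) ->
  vee_type S (sym_mx 2).
Proof.
move=> fy fp hS; apply: (vee_rep (ys := [:: y1; y2]) (zs := [:: p; al])) => // A.
rewrite hS mul_cols2; split=> [[r [s [t [h1 h2]]]]|[X /sym2P[r [s [t ->]]]]].
  exists (mx_of_rows 2 2 [:: [:: r; s]; [:: s; t]]); first by apply/sym2P; exists r, s, t.
  by rewrite cols2_sym h1 h2.
by rewrite cols2_sym => /mx_of_cols2_inj[h1 h2]; exists r, s, t.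
Qed.

Lemma V2_type S y1 y2 (p al be : 'cV['F_2]_n) : free [:: y1; y2] -> free [:: p; al; be] ->
  (forall A, A \in S <-> exists r s t : 'F_2,
    A *m y1 = r *: p + s *: al + t *: be /\ A *m y2 = s *: p + t *: al) ->
  vee_type S V2.
Proof.
move=> fy fp hS; apply: (vee_rep (ys := [:: y1; y2]) (zs := [:: p; al; be])) => // A.
rewrite hS mul_cols2; split=> [[r [s [t [h1 h2]]]]|[X]].
  exists (mx_of_rows 3 2 [:: [:: r; s]; [:: s; t]; [:: t; 0]]).
    by rewrite inE; apply/existsP; exists r; apply/existsP; exists s; apply/existsP; exists t.
  by rewrite cols3_V2 h1 h2.
rewrite inE => /existsP[r /existsP[s /existsP[t /eqP ->]]].
by rewrite cols3_V2 => /mx_of_cols2_inj[h1 h2]; exists r, s, t.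
Qed.

(** Independent p, al, be give V2.  Otherwise be is a combination of p and al,
    which a change of the first column y1 and of the parameters removes. *)
Lemma normal_form_type S y1 y2 p al be : normal_form S y1 y2 p al be ->
  vee_type S (sym_mx 2) \/ vee_type S V2.
Proof.
move=> [fy fp hS].
have [|nb] := boolP (be \in <<[:: p; al]>>%VS); last first.
  by right; apply: (V2_type fy (free_rcons fp nb)).
have fy' : free [:: y1 + y2; y2].
  move: fy; rewrite !free2E => /and3P[? ? ?]; repeat (apply/andP; split); nonzero.
have y1E A : A *m y1 = A *m (y1 + y2) + A *m y2 by rewrite mulmxDr; char2.
case/mem_span2 => e; left; rewrite e in hS.
- apply: (sym2_type fy fp) => A; rewrite hS.
  by split=> -[r [s [t [h1 h2]]]]; exists r, s, t; rewrite h1 h2 scaler0 addr0.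
- apply: (sym2_type fy fp) => A; rewrite hS.
  split=> -[r [s [t [h1 h2]]]]; exists (r + t), s, t; rewrite h1 h2; split=> //.
    by rewrite scalerDl; char2.
  by rewrite scalerDl; char2.
- apply: (sym2_type fy' fp) => A; rewrite hS.
  split=> -[r [s [t [h1 h2]]]]; exists (r + s), s, t.
    by rewrite mulmxDr h1 h2; split=> //; rewrite scalerDl; char2.
  by rewrite y1E h1 h2; split=> //; rewrite scalerDl; char2.
- apply: (sym2_type fy' fp) => A; rewrite hS.
  split=> -[r [s [t [h1 h2]]]]; exists (r + t + s), s, t.
    by rewrite mulmxDr h1 h2; split=> //; rewrite !scalerDl scalerDr; char2.
  by rewrite y1E h1 h2; split=> //; rewrite !scalerDl scalerDr; char2.
Qed.

Lemma planar_type S x : critical S x -> planar x -> vee_type S (sym_mx 2) \/ vee_type S V2.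
Proof.
move=> cr [c [u [v h]]].
have cr' := critical_shift (shift_equiv_const _ _ x c) cr.
have [G [GS dG Gi Gs]] := planar_dim3 cr' h.
have [y1 [y2 [p [al [be nf]]]]] := cover_exists cr' h GS Gi Gs dG.
exact: normal_form_type nf.
Qed.

(** A plane of rows has only three nonzero elements. *)
Lemma dim_two_planar (x : 'rV['F_2]_n -> 'cV['F_2]_m) : n = 2%N -> planar x.
Proof.
move=> n2; have dE : \dim {: 'rV['F_2]_n} = 2%N by rewrite dim_rV.
have [|a _] := @exists_notin_span _ [::] {: 'rV['F_2]_n}; first by rewrite dE.
rewrite span_nil memv0 => a0; have fa : free [:: a] by rewrite seq1_free.
have [|b _ bn] := @exists_notin_span _ [:: a] {: 'rV['F_2]_n}; first by rewrite dE.
have fab : free [:: a; b] := free_rcons fa bn.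
have full e : e \in <<[:: a; b]>>%VS.
  apply: contraT => h; have := free_size_dim (free_rcons fab h) (fun z _ => memvf z).
  by rewrite dE.
exists (x (a + b)), (x a + x (a + b)), (x b + x (a + b)) => phi p0.
case: (mem_span2 (full phi)) p0 => ->; first by rewrite eqxx.
- by rewrite mem_span_l.
- by rewrite mem_span_r.
- by rewrite add_self mem0v.
Qed.

End Vee.

Theorem critical_classification m n (S : {vspace 'M['F_2]_(n, m)}) x : critical S x ->
  [\/ exists r p, mx_rep S (vee (sym_mx 2) [set: 'M['F_2]_(r, p)]),
      exists r p, mx_rep S (vee V2 [set: 'M['F_2]_(r, p)]),
      exists p, mx_rep S (mx_coprod (sym_mx 3) [set: 'M['F_2]_(3, p)]) |
   [\/ exists p, mx_rep S (mx_coprod G3 [set: 'M['F_2]_(3, p)]),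
      exists p, mx_rep S (mx_coprod H3 [set: 'M['F_2]_(3, p)]),
      exists p, mx_rep S (mx_coprod I3 [set: 'M['F_2]_(3, p)]) |
      exists p, mx_rep S (mx_coprod H4 [set: 'M['F_2]_(3, p)])]].
Proof.
move=> cr.
suff : (exists2 x', critical S x' & planar x') \/
   [\/ exists p, mx_rep S (mx_coprod (sym_mx 3) [set: 'M['F_2]_(3, p)]),
    exists p, mx_rep S (mx_coprod G3 [set: 'M['F_2]_(3, p)]),
      exists p, mx_rep S (mx_coprod H3 [set: 'M['F_2]_(3, p)]) |
      exists p, mx_rep S (mx_coprod I3 [set: 'M['F_2]_(3, p)])] \/
      exists p, mx_rep S (mx_coprod H4 [set: 'M['F_2]_(3, p)]).
  case=> [[x' cr' /(planar_type cr')[]]|[[]|]] h.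
  - by constructor 1.
  - by constructor 2.
  - by constructor 3.
  - by constructor 4; constructor 1.
  - by constructor 4; constructor 2.
  - by constructor 4; constructor 3.
  - by constructor 4; constructor 4.
have [hx nl dW] := cr.
have [n3|n3] := ltnP 3 n.
  left; have [|| x' e [c [u [v h]]]] := critical_plane hx _ _ nl; rewrite ?dim_rV ?dW //.
  by exists x'; [exact: critical_shift e cr|exists c, u, v => phi; apply: h; exact: memvf].
have n2 : (1 < n)%N by lia.
have [n2'|n2'] := ltnP n 3.
  by left; exists x => //; apply: dim_two_planar; lia.
have e : n = 3%N by lia.
move: S x cr {hx nl dW n3 n2 n2'}; rewrite e => S x cr.
have [|a _] := @exists_notin_span _ [::] {: 'rV['F_2]_3}; first by rewrite dim_rV.
rewrite span_nil memv0 => a0; have fa : free [:: a] by rewrite seq1_free.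
have [|b _ bn] := @exists_notin_span _ [:: a] {: 'rV['F_2]_3}; first by rewrite dim_rV.
have fab : free [:: a; b] := free_rcons fa bn.
have [|c _ cn] := @exists_notin_span _ [:: a; b] {: 'rV['F_2]_3}; first by rewrite dim_rV.
have fabc : free [:: a; b; c] := free_rcons fab cn.
by have [p|p] := dim_three cr fabc; [left; exists x|right].
Qed.

(** * Coordinates and the main theorem *)

Section Coordinates.
Variables (T : vectType 'F_2) (k : nat) (e : k.-tuple T).
Hypothesis be : basis_of fullv e.

Definition coords (w : T) : 'cV['F_2]_k := \col_i coord e i w.

Lemma coords_sum w : w = \sum_i coords w i 0 *: e`_i.
Proof.
rewrite {1}(coord_basis be (memvf w)); apply: eq_bigr => i _; by rewrite mxE.
Qed.

Lemma coords_inj : injective coords.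
Proof. by move=> w w' h; rewrite (coords_sum w) h -coords_sum. Qed.

Lemma coordsD w w' : coords (w + w') = coords w + coords w'.
Proof. by apply/colP => i; rewrite !mxE linearD. Qed.

Lemma coordsZ a w : coords (a *: w) = a *: coords w.
Proof. by apply/colP => i; rewrite !mxE linearZ. Qed.

Definition of_coords (c : 'cV['F_2]_k) : T := \sum_i c i 0 *: e`_i.

Lemma of_coordsK c : coords (of_coords c) = c.
Proof. by apply/colP => i; rewrite mxE coord_sum_free // (basis_free be). Qed.

Variables (k' : nat) (P : 'M['F_2]_(k', k)) (P' : 'M['F_2]_(k, k')).
Hypotheses (PP' : P *m P' = 1%:M) (P'P : P' *m P = 1%:M).

Definition new_basis : k'.-tuple T := [tuple of_coords (col j P') | j < k'].

Lemma new_basis_sum w : w = \sum_j (P *m coords w) j 0 *: new_basis`_j.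
Proof.
apply: coords_inj.
have cs (I : finType) (f : I -> T) : coords (\sum_i f i) = \sum_i coords (f i).
  elim/big_ind2: _ => //; last by move=> a b c d <- <-; rewrite coordsD.
  by apply/colP => i; rewrite !mxE linear0.
rewrite cs -[LHS]mul1mx -P'P -mulmxA; apply/colP => i; rewrite mxE summxE.
apply: eq_bigr => j _; rewrite coordsZ nth_mktuple of_coordsK !mxE.
by rewrite mulrC.
Qed.

Lemma new_basisP : basis_of fullv new_basis.
Proof.
rewrite basisEdim; apply/andP; split.
  apply/subvP => w _; rewrite (new_basis_sum w); apply: memv_suml => j _.
  by rewrite memvZ // memv_span // mem_nth // size_tuple.
by rewrite size_tuple (size_basis be) (mulmx1_min PP').
Qed.

Lemma new_basis_coord w i : coord new_basis i w = (P *m coords w) i 0.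
Proof. by rewrite {1}(new_basis_sum w) coord_sum_free // (basis_free new_basisP). Qed.

End Coordinates.

Section Bridge.
Variables (U V : vectType 'F_2) (S : {vspace 'Hom(U, V)}).
Variables (m n : nat) (eU : m.-tuple U) (eV : n.-tuple V).
Hypotheses (bU : basis_of fullv eU) (bV : basis_of fullv eV).

Definition mat (s : 'Hom(U, V)) : 'M['F_2]_(n, m) := mx_in_bases eU eV s.

Fact mat_linear : linear mat.
Proof.
move=> k s t; apply/matrixP => i j.
by rewrite !mxE add_lfunE scale_lfunE linearD linearZ.
Qed.
HB.instance Definition _ :=
  GRing.isLinear.Build 'F_2 'Hom(U, V) 'M['F_2]_(n, m) _ mat mat_linear.

Lemma mat_coords s w : mat s *m coords eU w = coords eV (s w).
Proof.
apply/colP => i; rewrite !mxE {2}(coords_sum bU w) !linear_sum /=.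
by apply: eq_bigr => j _; rewrite !mxE !linearZ /= mulrC (tnth_nth 0).
Qed.

Lemma mat_inj : injective mat.
Proof.
move=> s t h; apply/lfunP => w; apply: (coords_inj bV).
by rewrite -!mat_coords h.
Qed.

Definition matS : {vspace 'M['F_2]_(n, m)} := (linfun mat @: S)%VS.

Lemma mat_mem s : (mat s \in matS) = (s \in S).
Proof.
apply/idP/idP=> [/memv_imgP[t tS]|h]; first by rewrite lfunE /= => /mat_inj ->.
by apply/memv_imgP; exists s; rewrite ?lfunE.
Qed.

Lemma dim_matS : \dim matS = \dim S.
Proof.
apply: limg_dim_eq; apply/eqP; rewrite -subv0; apply/subvP => s.
rewrite memv_cap memv_ker lfunE memv0 /= => /andP[_ /eqP h]; apply/eqP.
by apply: mat_inj; rewrite h linear0.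
Qed.

Lemma mx_rep_represented n' m' (M : {set 'M['F_2]_(n', m')}) :
  mx_rep matS M -> represented_by S M.
Proof.
move=> [P [P' [Q [Q' [h1 h2 h3 h4 hS]]]]].
exists (new_basis eU Q), (new_basis eV P'); split.
- exact: (new_basisP bU h4 h3).
- exact: (new_basisP bV h1 h2).
move=> s; rewrite -mat_mem hS.
suff -> : mx_in_bases (new_basis eU Q) (new_basis eV P') s = P *m mat s *m Q by [].
apply/matrixP => i j.
rewrite mxE (new_basis_coord bV h1 h2) -mat_coords tnth_mktuple (of_coordsK bU).
by rewrite mulmxA !mxE; apply: eq_bigr => l _; rewrite [col _ _ _ _]mxE.
Qed.

(** A form on X that vanishes with f factors through f, here by means of a right
    inverse of the restriction of f to X. *)
Lemma factor_form k l (X : {vspace 'M['F_2]_(n, m)}) (f : 'Hom('M['F_2]_(n, m), 'M['F_2]_(k, l)))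
    (g : 'M['F_2]_(n, m) -> 'F_2) : (forall A B, g (A + B) = g A + g B) ->
  (forall A, A \in X -> f A = 0 -> g A = 0) ->
  exists N, forall A, A \in X -> g A = \tr (f A *m N).
Proof.
move=> gD hg; pose q := (f \o projv X)%VF; pose h r := g (projv X ((q^-1)%VF r)).
have [|N hN] := @linform_trace k l h.
  by move=> a b; rewrite /h !linearD gD.
exists N => A hA; rewrite -hN /h.
set B := projv X _.
have BX : B \in X by exact: memv_proj.
have qA : q A = f A by rewrite comp_lfunE projv_id.
have fB : f B = f A.
  have := limg_lfunVK (memv_img q (memvf A)); rewrite qA => e.
  by rewrite -[RHS]e /B comp_lfunE.
have := hg _ (memvD hA BX); rewrite linearD /= fB add_self gD => /(_ erefl) k0.
by char2_by k0.
Qed.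

Variable F : {linear subvs_of S -> V}.
Hypothesis hF : range_compatible F.

(** For a fixed row phi, the form A |-> phi F(A) vanishes whenever phi A = 0,
    because F(A) is in the image of A; hence it factors through phi A. *)
Lemma range_compatible_tensor : exists x : 'rV['F_2]_n -> 'cV['F_2]_m,
  forall phi (s : subvs_of S),
    pr phi (coords eV (F s)) = pr phi (mat (vsval s) *m x phi).
Proof.
have /fin_all_exists[x hx] : forall phi : 'rV['F_2]_n, exists y : 'cV['F_2]_m,
    forall s : subvs_of S, pr phi (coords eV (F s)) = pr phi (mat (vsval s) *m y).
  move=> phi.
  pose inv := ((linfun mat)^-1)%VF.
  have invK s : inv (mat s) = s.
    have := lker0_lfunK (f := linfun mat); rewrite /inv => h.
    have /h : lker (linfun mat) == 0%VS.
      apply/eqP/eqP; rewrite -subv0; apply/subvP => t.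
      rewrite memv_ker lfunE memv0 /= => /eqP e; apply/eqP.
      by apply: mat_inj; rewrite e linear0.
    by move=> /(_ s); rewrite lfunE.
  pose g (A : 'M['F_2]_(n, m)) := pr phi (coords eV (F (vsproj S (inv A)))).
  have [|A|N hN] := @factor_form 1 m matS (linfun (mulmx phi)) g.
  - by move=> A B; rewrite /g !linearD /= coordsD prDr.
  - move=> /memv_imgP[s sS ->]; rewrite !lfunE /= /g invK => h.
    have /memv_imgP[w _ ->] := hF (vsproj S s).
    by rewrite vsprojK // -mat_coords /pr mulmxA h mul0mx mxE.
  exists N => s; have sS := valP s.
  have := hN (mat (vsval s)); rewrite mat_mem /g invK vsvalK lfunE /= => ->; last exact: subvsP.
  by rewrite -mulmxA -pr_trace.
by exists x.
Qed.

Lemma local_or_critical : (codimv S + 3 = 2 * \dim {: V})%N ->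
  local_map F \/ exists x, critical matS x.
Proof.
move=> hc; have [x hx] := range_compatible_tensor.
have repr A : A \in matS -> exists s : subvs_of S, A = mat (vsval s).
  move=> /memv_imgP[s sS ->]; exists (vsproj S s); by rewrite lfunE /= vsprojK.
have dim : (\dim (annihilator matS) + 3 = 2 * n)%N.
  have := dim_annihilator matS; rewrite dim_matS => d.
  have dV : \dim {: V} = n by exact: size_basis bV.
  have dU : \dim {: U} = m by exact: size_basis bU.
  have dH : \dim {: 'Hom(U, V)} = (m * n)%N.
    by rewrite dimvf /= -dU -dV !dimvf.
  have := dimvS (subvf S); move: hc; rewrite /codimv dH dV.
  lia.
have [/localP[u hu]|/localP nl] := boolP (localb (annihilator matS) fullv x).
  left; exists (of_coords eU u) => s; apply: (coords_inj bV).
  rewrite -mat_coords (of_coordsK bU); apply/eqP; rewrite -addmove; apply/eqP/pr_eq0 => phi.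
  rewrite prDr hx -prDr -mulmxDr -trace_tensor.
  have /annihilatorP := hu phi (memvf _); apply; rewrite mat_mem; exact: subvsP.
right; exists x; split => // phi psi _ _; apply/annihilatorP => A /repr[s ->].
by rewrite trace_defect /qform -!hx prDl addF2.
Qed.

End Bridge.

Theorem theorem1p6 (U V : vectType 'F_2) (S : {vspace 'Hom(U, V)})
    (hcodim : (codimv S + 3 = 2 * \dim {: V})%N)
    (h1 : ~ type1 S) (h2 : ~ type2 S) (h3 : ~ type3 S) (h4 : ~ type4 S)
    (h5 : ~ type5 S) (h6 : ~ type6 S) (h7 : ~ type7 S)
    (F : {linear subvs_of S -> V}) (hF : range_compatible F) :
  local_map F.
Proof.
have [bU bV] := (vbasisP {: U}, vbasisP {: V}).
have [//|[x cr]] := local_or_critical bU bV hF hcodim; exfalso.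
have rep n m (M : {set 'M['F_2]_(n, m)}) := mx_rep_represented bU bV (M := M).
case: (critical_classification cr) => [[r [p h]]|[r [p h]]|[p h]|[] [p h]].
- by apply: h1; exists r, p; apply: rep.
- by apply: h3; exists r, p; apply: rep.
- by apply: h2; exists p; apply: rep.
- by apply: h4; exists p; apply: rep.
- by apply: h5; exists p; apply: rep.
- by apply: h6; exists p; apply: rep.
- by apply: h7; exists p; apply: rep.
Qed.
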